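(* Let $n \in \mathbb{Z}_+$, $t, s \in \mathbb{R}$ and $p \in [1,2]$. Let $G \subset \mathcal{F}^s(\mathbb{R}^n)$ be a subgroup. Suppose that $f, g \in H^s(\mathbb{R}^n)$, and write $A_{f\cap g} := \operatorname{supp}(\hat f) \cap \operatorname{supp}(\hat g)$. Then $$d([f],[g])^2 \leq \left\Vert \langle\xi\rangle^s\left(|\hat f| - |\hat g|\right)\right\Vert_{L^2(\mathbb{R}^n)}^2 + R(f,g),$$ where $$R(f,g) := c_{n,p}\, \left\Vert \chi_{A_{f\cap g}} \langle\xi\rangle^{2s-2t}\right\Vert_{L^{\frac{p}{2-p}}(\mathbb{R}^n)} \ \inf_{P,Q\in G} \Vert Pf - Qg\Vert_{H^{t,p}(\mathbb{R}^n)}^2 .$$ Moreover, the constant $\left\Vert \chi_{A_{f\cap g}} \langle\xi\rangle^{2s-2t}\right\Vert_{L^{\frac{p}{2-p}}(\mathbb{R}^n)}$ is finite if one of the following sufficient conditions holds: (i) $A_{f\cap g}$ is compact; (ii) $A_{f\cap g}$ has finite (Lebesgue) measure and $s \leq t$; (iii) $s < t - a$, where $a = n\left(\frac1p - \frac12\right)$.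
   Context: Functions are complex valued. The Fourier transform is $\hat f(\xi) = \mathcal{F}f(\xi) = (2\pi)^{-n/2}\int_{\mathbb{R}^n} e^{-ix\cdot\xi} f(x)\,dx$, extended to the space $\mathcal{S}'(\mathbb{R}^n)$ of tempered distributions. Write $\langle\xi\rangle = \sqrt{1+|\xi|^2}$, and let $\chi_A$ denote the characteristic function of a set $A$. The set $\operatorname{supp}(\hat f)$ is the support of the tempered distribution $\hat f$. Sobolev spaces: for $s\in\mathbb{R}$, $H^s(\mathbb{R}^n) = \{u\in\mathcal{S}'(\mathbb{R}^n) : \mathcal{F}^{-1}(\langle\cdot\rangle^s\hat u)\in L^2(\mathbb{R}^n)\}$ with norm $\Vert u\Vert_{H^s(\mathbb{R}^n)} = \Vert\langle\cdot\rangle^s\hat u\Vert_{L^2(\mathbb{R}^n)}$. In particular, for $u \in H^s(\mathbb{R}^n)$, $\hat u$ is a measurable function defined up to almost everywhere equality. Bessel potential spaces: for $t\in\mathbb{R}$ and $p\in[1,\infty]$, $H^{t,p}(\mathbb{R}^n) = \{f\in\mathcal{S}'(\mathbb{R}^n) : \mathcal{F}^{-1}(\langle\cdot\rangle^t\hat f)\in L^p(\mathbb{R}^n)\}$ with norm $\Vert f\Vert_{H^{t,p}(\mathbb{R}^n)} = \Vert\mathcal{F}^{-1}(\langle\cdot\rangle^t\hat f)\Vert_{L^p(\mathbb{R}^n)}$. If $f\in\mathcal{S}'(\mathbb{R}^n)$ and $f\notin H^{t,p}(\mathbb{R}^n)$, one sets $\Vert f\Vert_{H^{t,p}(\mathbb{R}^n)}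 = \infty$. The group $\mathcal{F}^s(\mathbb{R}^n)$: it consists of all bijective and additive (not necessarily linear) operators $P: H^s(\mathbb{R}^n)\to H^s(\mathbb{R}^n)$ such that $|\hat f(\xi)| = |\widehat{Pf}(\xi)|$ for all $\xi\in\mathbb{R}^n$ and all $f\in H^s(\mathbb{R}^n)$ (equality of measurable functions, i.e. for almost every $\xi$); the group operation is composition. Quotient distance: for a subgroup $G\subset\mathcal{F}^s(\mathbb{R}^n)$ and $f,g\in H^s(\mathbb{R}^n)$, $[f]=[g]$ if and only if $f = Pg$ for some $P\in G$, and $d([f],[g]) = \inf_{P\in G}\Vert f-Pg\Vert_{H^s(\mathbb{R}^n)}$. Constants and conventions: $c_{n,p} := \Vert\mathcal{F}\Vert_{L^p(\mathbb{R}^n)\to L^{p/(p-1)}(\mathbb{R}^n)}^2$ is the squared operator norm of the Fourier transform, where $p/(p-1)$ is the Hölder conjugate of $p$ (equal to $\infty$ when $p=1$). When $p=2$, $\frac{p}{2-p}$ is understood as $\infty$. Quantities may take the value $+\infty$, and the product convention $0\cdot\infty=0$ is used in $R(f,g)$. *)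

(* Defs.v *)
From HB Require Import structures.
From mathcomp Require Import all_boot all_order all_algebra.
From mathcomp Require Import complex.
From mathcomp Require Import all_classical all_reals all_analysis.
From mathcomp Require Import measurable_realfun.

Set Implicit Arguments.
Unset Strict Implicit.
Unset Printing Implicit Defensive.

Import Order.TTheory GRing.Theory Num.Theory.
Import numFieldNormedType.Exports.
Import ComplexField.Normc.

Local Open Scope classical_set_scope.
Local Open Scope ring_scope.
Local Open Scope complex_scope.

Local Notation Re := complex.Re.
Local Notation Im := complex.Im.

(* R^n is 'rV[R]_n, with the sigma-algebra generated by the coordinates, which
   is its Borel sigma-algebra. *)
Section rV_measurable.
Context {R : realType} {n : nat}.

Definition rV_coord (i : 'I_n) (x : 'rV[R]_n) : R := x ord0 i.

Definition rV_measurable : set (set 'rV[R]_n) := g_sigma_preimage rV_coord.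

Let rV_measurable0 : rV_measurable set0.
Proof. exact: sigma_algebra0. Qed.

Let rV_measurableC A : rV_measurable A -> rV_measurable (~` A).
Proof. exact: sigma_algebraC. Qed.

Let rV_measurable_bigcup (F : (set 'rV[R]_n)^nat) :
  (forall i, rV_measurable (F i)) -> rV_measurable (\bigcup_i F i).
Proof. exact: sigma_algebra_bigcup. Qed.

HB.instance Definition _ := @isMeasurable.Build default_measure_display
  'rV[R]_n rV_measurable rV_measurable0 rV_measurableC rV_measurable_bigcup.

End rV_measurable.

Section rV_measurable_theory.
Context {R : realType}.

Lemma measurable_rV_coord n (i : 'I_n) :
  measurable_fun [set: 'rV[R]_n] (rV_coord i).
Proof.
move=> _ Y mY; rewrite setTI; apply: sub_sigma_algebra => /=.
rewrite -bigcup_seq/=; exists i => /=; first by rewrite mem_index_enum.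
by exists Y => //; rewrite setTI.
Qed.

Lemma measurable_fun_rV d (T : measurableType d) n (f : T -> 'rV[R]_n) :
  (forall i, measurable_fun [set: T] (rV_coord i \o f)) ->
  measurable_fun [set: T] f.
Proof.
move=> mf _ Y mY; rewrite setTI.
suff : @rV_measurable R n `<=` [set A | measurable (f @^-1` A)] by apply.
apply: smallest_sub => [|A /=].
  split => /=.
  - by rewrite preimage_set0.
  - by move=> A mA; rewrite setTD preimage_setC; exact: measurableC.
  - by move=> F mF; rewrite preimage_bigcup; exact: bigcupT_measurable.
rewrite -bigcup_seq/= => -[i _ [B mB <-]].
by rewrite setTI -comp_preimage -[X in measurable X]setTI; exact: mf.
Qed.

Definition rV_cons n (p : R * 'rV[R]_n) : 'rV[R]_n.+1 :=
  row_mx (const_mx p.1 : 'rV_1) p.2.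

Lemma rV_coord_cons0 n : @rV_coord R n.+1 ord0 \o @rV_cons n = fst.
Proof.
apply/funext => -[a v] /=; rewrite /rV_coord /rV_cons /=.
transitivity (row_mx (const_mx a : 'rV[R]_1) v ord0 (lshift n ord0)).
  by congr (row_mx _ _ _ _); exact/val_inj.
by rewrite row_mxEl mxE.
Qed.

Lemma rV_coord_consS n (i : 'I_n) :
  @rV_coord R n.+1 (lift ord0 i) \o @rV_cons n = rV_coord i \o snd.
Proof.
apply/funext => -[a v] /=; rewrite /rV_coord /rV_cons /=.
transitivity (row_mx (const_mx a : 'rV[R]_1) v ord0 (rshift 1 i)).
  by congr (row_mx _ _ _ _); exact/val_inj.
by rewrite row_mxEr.
Qed.

Lemma measurable_rV_cons n : measurable_fun setT (@rV_cons n).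
Proof.
apply: measurable_fun_rV => i; have [j ->|->] := unliftP ord0 i.
  rewrite rV_coord_consS; apply: measurableT_comp => //.
  exact: measurable_rV_coord.
by rewrite rV_coord_cons0.
Qed.

Definition rV_uncons n (x : 'rV[R]_n.+1) : R * 'rV[R]_n :=
  (x ord0 ord0, \row_i x ord0 (lift ord0 i)).

Lemma rV_consK n : cancel (@rV_cons n) (@rV_uncons n).
Proof.
move=> [a v]; congr (_, _); first exact: (congr1 (@^~ (a, v)) (rV_coord_cons0 n)).
apply/rowP => i; rewrite mxE.
exact: (congr1 (@^~ (a, v)) (rV_coord_consS i)).
Qed.

Lemma measurable_rV_uncons n : measurable_fun setT (@rV_uncons n).
Proof.
apply: measurable_fun_pair; first exact: measurable_rV_coord.
apply: measurable_fun_rV => i.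
rewrite (_ : _ \o _ = rV_coord (lift ord0 i)); last first.
  by apply/funext => x; rewrite /rV_coord /= mxE.
exact: measurable_rV_coord.
Qed.

End rV_measurable_theory.

Section lebesgue_rV_cons.
Local Open Scope ereal_scope.
Context {R : realType} {n : nat}.
Variable mu : {sigma_finite_measure set 'rV[R]_n -> \bar R}.

Definition lebesgue_rV_cons : set 'rV[R]_n.+1 -> \bar R :=
  pushforward (@lebesgue_measure R \x mu) (@rV_cons R n).

Let lebesgue_rV_cons0 : lebesgue_rV_cons set0 = 0.
Proof. by rewrite /lebesgue_rV_cons /pushforward preimage_set0 measure0. Qed.

Let lebesgue_rV_cons_ge0 A : 0 <= lebesgue_rV_cons A.
Proof. exact: (measure_ge0 (@lebesgue_measure R \x mu)%E). Qed.

Let lebesgue_rV_cons_sigma_additive : semi_sigma_additive lebesgue_rV_cons.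
Proof.
have mX A : measurable A -> measurable (@rV_cons R n @^-1` A).
  by move=> mA; rewrite -[X in measurable X]setTI; exact: measurable_rV_cons.
move=> F mF tF mUF; rewrite /lebesgue_rV_cons /pushforward preimage_bigcup.
apply: measure_semi_sigma_additive => //.
- by move=> i; exact: mX.
- apply/trivIsetP => /= i j _ _ ij; rewrite -preimage_setI.
  by move/trivIsetP : tF => /(_ _ _ _ _ ij) ->//; rewrite preimage_set0.
- by rewrite -preimage_bigcup; exact: mX.
Qed.

HB.instance Definition _ := isMeasure.Build _ _ _ lebesgue_rV_cons
  lebesgue_rV_cons0 lebesgue_rV_cons_ge0 lebesgue_rV_cons_sigma_additive.

Let lebesgue_rV_cons_sigma_finite : sigma_finite setT lebesgue_rV_cons.
Proof.
have /sigma_finiteP[F [TF ndF Foo]] := sigma_finiteT (@lebesgue_measure R).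
have /sigma_finiteP[G [TG ndG Goo]] := sigma_finiteT mu.
exists (fun k => @rV_uncons R n @^-1` (F k `*` G k)).
  rewrite -preimage_bigcup (_ : \bigcup_k _ = setT) ?preimage_setT//.
  rewrite -subTset => -[x v] _.
  have [i _ Fix] : (\bigcup_k F k) x by rewrite -TF.
  have [j _ Gjv] : (\bigcup_k G k) v by rewrite -TG.
  exists (maxn i j) => //; split => /=.
  - by move: Fix; exact/subsetPset/ndF/leq_maxl.
  - by move: Gjv; exact/subsetPset/ndG/leq_maxr.
move=> k; have [mFk Fkoo] := Foo k; have [mGk Gkoo] := Goo k; split.
  rewrite -[X in measurable X]setTI; apply: measurable_rV_uncons => //.
  exact: measurableX.
rewrite /lebesgue_rV_cons /pushforward -comp_preimage (_ : _ \o _ = id).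
  by rewrite preimage_id product_measure1E// lte_mul_pinfty// ge0_fin_numE.
by apply/funext => x; exact: rV_consK.
Qed.

HB.instance Definition _ := Measure_isSigmaFinite.Build _ _ _
  lebesgue_rV_cons lebesgue_rV_cons_sigma_finite.

End lebesgue_rV_cons.

(* Lebesgue measure on R^n is the n-fold product of the one on R; on R^0 it is
   the unit mass. *)
Fixpoint lebesgue_rV (R : realType) (n : nat) :
    {sigma_finite_measure set 'rV[R]_n -> \bar R} :=
  match n with
  | 0 => \d_(0 : 'rV[R]_0)
  | m.+1 => lebesgue_rV_cons (lebesgue_rV R m)
  end.
Arguments lebesgue_rV {R n}.

Section complex_integral.
Context d {T : measurableType d} {R : realType}.
Variable mu : {measure set T -> \bar R}.
Implicit Types h : T -> R[i].

Definition cmeasurable h :=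
  measurable_fun setT (@Re R \o h) /\ measurable_fun setT (@Im R \o h).

Definition cintegrable h :=
  mu.-integrable setT (EFin \o (@Re R \o h)) /\
  mu.-integrable setT (EFin \o (@Im R \o h)).

Definition cintegral h : R[i] :=
  (\int[mu]_x Re (h x)) +i* (\int[mu]_x Im (h x)).

Definition cLnorm (p : \bar R) h : \bar R :=
  Lnorm mu p (fun x => (normc (h x))%:E).

End complex_integral.

Section euclidean.
Context {R : realType} {n : nat}.
Implicit Types x y : 'rV[R]_n.

Definition dotrV x y : R := \sum_(i < n) x ord0 i * y ord0 i.

Definition japanese x : R := Num.sqrt (1 + dotrV x x).

Definition cexpi (a : R) : R[i] := cos a +i* sin a.

Lemma dotrV_ge0 x : 0 <= dotrV x x.
Proof. by apply: sumr_ge0 => i _; rewrite -expr2 sqr_ge0. Qed.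

Lemma japanese_ge1 x : 1 <= japanese x.
Proof. by rewrite -[leLHS]sqrtr1 ler_wsqrtr// lerDl dotrV_ge0. Qed.

Lemma japanese_ge0 x : 0 <= japanese x.
Proof. exact: sqrtr_ge0. Qed.

End euclidean.

Section schwartz_functions.
Context {R : realType} {n : nat}.
Implicit Types f g : 'rV[R]_n -> R[i].

(* R[i] is not a normed module over R, so the real and imaginary parts are
   differentiated separately. *)
Definition cdifferentiable f x :=
  differentiable (@Re R \o f) x /\ differentiable (@Im R \o f) x.

Definition partial (i : 'I_n) f : 'rV[R]_n -> R[i] := fun x =>
  'D_(delta_mx ord0 i) (@Re R \o f) x +i* 'D_(delta_mx ord0 i) (@Im R \o f) x.

Definition partials (s : seq 'I_n) f := foldr partial f s.

(* C^oo: every iterated partial derivative is differentiable everywhere. *)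
Definition smooth f := forall s x, cdifferentiable (partials s f) x.

Definition schwartz_seminorm (N : nat) f : \bar R :=
  ereal_sup [set y | exists (s : seq 'I_n) (x : 'rV[R]_n), (size s <= N)%N /\
    y = (japanese x ^+ N * normc (partials s f x))%:E].

Definition schwartz_pred : {pred 'rV[R]_n -> R[i]} :=
  mem [set f | smooth f /\ forall N, (schwartz_seminorm N f < +oo)%E].

Lemma modulus_ge0 (a : R[i]) : 0 <= normc a.
Proof. by case: a => ? ?; exact: sqrtr_ge0. Qed.

Lemma ReD (a b : R[i]) : Re (a + b) = Re a + Re b.
Proof. by case: a => ? ?; case: b. Qed.

Lemma ImD (a b : R[i]) : Im (a + b) = Im a + Im b.
Proof. by case: a => ? ?; case: b. Qed.

Lemma ReZ (a b : R[i]) : Re (a *: b) = Re a * Re b - Im a * Im b.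
Proof. by case: a => ? ?; case: b. Qed.

Lemma ImZ (a b : R[i]) : Im (a *: b) = Re a * Im b + Im a * Re b.
Proof. by case: a => ? ?; case: b => ? ?. Qed.

Lemma Re_lin (a : R[i]) f g : @Re R \o (a *: f + g) =
  Re a \*: (@Re R \o f) + (- Im a) \*: (@Im R \o f) + (@Re R \o g).
Proof. by apply/funext => x /=; rewrite ReD ReZ -mulNr. Qed.

Lemma Im_lin (a : R[i]) f g : @Im R \o (a *: f + g) =
  Re a \*: (@Im R \o f) + Im a \*: (@Re R \o f) + (@Im R \o g).
Proof. by apply/funext => x /=; rewrite ImD ImZ. Qed.

Lemma cdifferentiable_lin (a : R[i]) f g x :
  cdifferentiable f x -> cdifferentiable g x -> cdifferentiable (a *: f + g) x.
Proof.
move=> [f1 f2] [g1 g2]; split; [rewrite Re_lin|rewrite Im_lin].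
  exact: (differentiableD (differentiableD (differentiableZ _ f1)
    (differentiableZ _ f2)) g1).
exact: (differentiableD (differentiableD (differentiableZ _ f2)
  (differentiableZ _ f1)) g2).
Qed.

Lemma derive_lin3 (a b : R) (u v w : 'rV[R]_n -> R) x e :
  differentiable u x -> differentiable v x -> differentiable w x ->
  'D_e (a \*: u + b \*: v + w) x = a * 'D_e u x + b * 'D_e v x + 'D_e w x.
Proof.
move=> /(@diff_derivable _ _ _ _ _ e) du /(@diff_derivable _ _ _ _ _ e) dv.
move=> /(@diff_derivable _ _ _ _ _ e) dw.
have dau := derivableZ (k := a) du; have dbv := derivableZ (k := b) dv.
rewrite (deriveD (derivableD dau dbv) dw) (deriveD dau dbv).
by rewrite (deriveZ _ du) (deriveZ _ dv).
Qed.

Lemma partial_lin i (a : R[i]) f g : (forall x, cdifferentiable f x) ->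
  (forall x, cdifferentiable g x) ->
  partial i (a *: f + g) = a *: partial i f + partial i g.
Proof.
move=> df dg; apply/funext => x; have [? ?] := df x; have [? ?] := dg x.
rewrite /partial Re_lin Im_lin.
by rewrite !derive_lin3// mulNr; case: a => a b.
Qed.

Lemma partials_lin (a : R[i]) f g : smooth f -> smooth g ->
  forall s, partials s (a *: f + g) = a *: partials s f + partials s g.
Proof.
move=> sf sg; elim=> //= i s ->; apply: partial_lin.
- exact: sf.
- exact: sg.
Qed.

Lemma schwartz_seminorm_ub N f s x : (size s <= N)%N ->
  ((japanese x ^+ N * normc (partials s f x))%:E <= schwartz_seminorm N f)%E.
Proof. by move=> sN; apply: ereal_sup_ubound; exists s, x. Qed.

Lemma schwartz_seminorm_lin (a : R[i]) f g N : smooth f -> smooth g ->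
  (schwartz_seminorm N (a *: f + g)%R <=
   (normc a)%:E * schwartz_seminorm N f + schwartz_seminorm N g)%E.
Proof.
move=> sf sg; apply: ge_ereal_sup => _ [s [x [sN ->]]].
rewrite partials_lin//.
apply: (@le_trans _ _ ((normc a * (japanese x ^+ N * normc (partials s f x)) +
   japanese x ^+ N * normc (partials s g x))%:E)).
  rewrite lee_fin mulrCA -mulrDr ler_wpM2l ?exprn_ge0 ?japanese_ge0//.
  by rewrite -normcM; exact: le_normcD.
rewrite EFinD EFinM leeD ?schwartz_seminorm_ub//.
by rewrite lee_wpmul2l ?schwartz_seminorm_ub// lee_fin modulus_ge0.
Qed.

Lemma partials0 s : partials s (0 : 'rV[R]_n -> R[i]) = 0.
Proof.
elim: s => //= i s ->; apply/funext => x; rewrite /partial.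
have -> : @Re R \o (0 : 'rV[R]_n -> R[i]) = cst 0 by [].
have -> : @Im R \o (0 : 'rV[R]_n -> R[i]) = cst 0 by [].
by rewrite !derive_cst.
Qed.

Lemma cdifferentiable0 x : cdifferentiable (0 : 'rV[R]_n -> R[i]) x.
Proof. by split; exact: (differentiable_cst (0 : R) x). Qed.

Lemma schwartz_submod_closed : submod_closed schwartz_pred.
Proof.
split=> [|a f g].
  rewrite inE; split=> [s x|N].
    by rewrite partials0; exact: cdifferentiable0.
  apply: (@le_lt_trans _ _ 0%E) => //; apply: ge_ereal_sup => _ [s [x [_ ->]]].
  by rewrite partials0 normc0 mulr0.
rewrite !inE => -[sf nf] [sg ng]; split=> [s x|N].
  by rewrite partials_lin//; exact: cdifferentiable_lin.
apply: (le_lt_trans (schwartz_seminorm_lin _ _ sf sg)).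
by rewrite lte_add_pinfty// lte_mul_pinfty// lee_fin modulus_ge0.
Qed.

HB.instance Definition _ := GRing.isSubmodClosed.Build _ _ schwartz_pred
  schwartz_submod_closed.

End schwartz_functions.

Record schwartz (R : realType) (n : nat) := Schwartz {
  schwartz_fun :> 'rV[R]_n -> R[i] ;
  _ : schwartz_fun \in schwartz_pred
}.

HB.instance Definition _ (R : realType) (n : nat) :=
  [isSub for @schwartz_fun R n].
HB.instance Definition _ (R : realType) (n : nat) :=
  [Choice of schwartz R n by <:].
HB.instance Definition _ (R : realType) (n : nat) :=
  [SubChoice_isSubLmodule of schwartz R n by <:].

Section tempered_distributions.
Context {R : realType} {n : nat}.

(* Sends a function that is not Schwartz to 0. It is only applied to functions
   that are Schwartz: Fourier transforms of Schwartz functions and products of a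
   Schwartz function by a power of the Japanese bracket. *)
Definition to_schwartz (f : 'rV[R]_n -> R[i]) : schwartz R n := insubd 0 f.

Definition fourier_fun (f : 'rV[R]_n -> R[i]) (xi : 'rV[R]_n) : R[i] :=
  ((2 * pi) `^ (- (n%:R / 2)))%:C *
  cintegral lebesgue_rV (fun x => cexpi (- dotrV x xi) * f x).

Definition fourier_inv_fun (f : 'rV[R]_n -> R[i]) (x : 'rV[R]_n) : R[i] :=
  ((2 * pi) `^ (- (n%:R / 2)))%:C *
  cintegral lebesgue_rV (fun xi => cexpi (dotrV x xi) * f xi).

(* The operations on distributions are defined by duality, on all functionals
   on the Schwartz space; [tempered] carves out S'(R^n). *)
Definition functional := schwartz R n -> R[i].

Definition tempered (u : functional) :=
  scalar u /\ exists (C : R) (N : nat), forall phi : schwartz R n,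
    ((normc (u phi))%:E <= C%:E * schwartz_seminorm N phi)%E.

Definition dfourier (u : functional) : functional :=
  fun phi => u (to_schwartz (fourier_fun phi)).

Definition dfourier_inv (u : functional) : functional :=
  fun phi => u (to_schwartz (fourier_inv_fun phi)).

Definition dmul (m : 'rV[R]_n -> R) (u : functional) : functional :=
  fun phi => u (to_schwartz (fun x => (m x)%:C * phi x)).

Definition bessel (t : R) (u : functional) : functional :=
  dfourier_inv (dmul (fun xi => japanese xi `^ t) (dfourier u)).

Definition dist_of (h : 'rV[R]_n -> R[i]) : functional :=
  fun phi => cintegral lebesgue_rV (fun x => h x * phi x).

Definition represents (u : functional) (h : 'rV[R]_n -> R[i]) :=
  [/\ cmeasurable h,
      forall phi : schwartz R n,
        cintegrable lebesgue_rV (fun x => h x * phi x) &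
      u = dist_of h].

Definition in_Lp (p : \bar R) (u : functional) :=
  exists2 h, represents u h & (cLnorm lebesgue_rV p h < +oo)%E.

(* The L^p norm of the function representing u, which is unique up to a.e.
   equality, and +oo if there is none. *)
Definition dLnorm (p : \bar R) (u : functional) : \bar R :=
  ereal_inf [set cLnorm lebesgue_rV p h | h in represents u].

Definition bessel_norm (t : R) (p : \bar R) (u : functional) : \bar R :=
  dLnorm p (bessel t u).

(* The Fourier transform of u as a function, when it is one. *)
Definition fourier_hat (u : functional) : 'rV[R]_n -> R[i] :=
  xget (cst 0) (represents (dfourier u)).

Definition dsupp (u : functional) : set 'rV[R]_n :=
  ~` [set x | exists U : set 'rV[R]_n, [/\ open U, U x &
    forall phi : schwartz R n, compact (closure [set y | phi y != 0]) ->
      closure [set y | phi y != 0] `<=` U -> u phi = 0]].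

Lemma le_schwartz_seminorm (N M : nat) (f : 'rV[R]_n -> R[i]) : (N <= M)%N ->
  (schwartz_seminorm N f <= schwartz_seminorm M f)%E.
Proof.
move=> NM; apply: ge_ereal_sup => _ [s [x [sN ->]]].
apply: le_trans (schwartz_seminorm_ub f x (leq_trans sN NM)).
by rewrite lee_fin ler_wpM2r ?modulus_ge0//; exact: ler_weXn2l (japanese_ge1 x) _ _ NM.
Qed.

Lemma schwartz_seminorm_ge0 (N : nat) (f : 'rV[R]_n -> R[i]) :
  (0 <= schwartz_seminorm N f)%E.
Proof.
apply: le_trans (schwartz_seminorm_ub (s := [::]) f 0 (leq0n N)).
by rewrite lee_fin mulr_ge0 ?modulus_ge0// exprn_ge0// japanese_ge0.
Qed.

Lemma tempered0 : tempered 0.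
Proof.
split=> [a x y|]; first by rewrite mulr0 addr0.
by exists 0, 0 => phi; rewrite normc0 mul0e.
Qed.

Lemma temperedB u v : tempered u -> tempered v -> tempered (u - v).
Proof.
move=> [lu [C [N uC]]] [lv [D [M vD]]]; split=> [a x y|].
  rewrite !fctE lu lv mulrBr opprD !addrA.
  by congr (_ + _); rewrite addrAC.
exists (`|C| + `|D|), (maxn N M) => phi.
apply: (@le_trans _ _ (normc (u phi) + normc (v phi))%:E).
  by rewrite lee_fin -[normc (v phi)]normcN; exact: le_normcD.
rewrite EFinD [in leRHS]EFinD ge0_muleDl ?lee_fin//; apply: leeD.
- apply: (le_trans (uC phi)).
  apply: (@le_trans _ _ (`|C|%:E * schwartz_seminorm N phi)%E).
    by rewrite lee_wpmul2r ?schwartz_seminorm_ge0// lee_fin ler_norm.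
  by rewrite lee_wpmul2l ?lee_fin// le_schwartz_seminorm// leq_maxl.
- apply: (le_trans (vD phi)).
  apply: (@le_trans _ _ (`|D|%:E * schwartz_seminorm M phi)%E).
    by rewrite lee_wpmul2r ?schwartz_seminorm_ge0// lee_fin ler_norm.
  by rewrite lee_wpmul2l ?lee_fin// le_schwartz_seminorm// leq_maxr.
Qed.

Lemma represents0 : represents 0 0.
Proof.
have E (phi : schwartz R n) :
    (fun x => (0 : 'rV[R]_n -> R[i]) x * phi x) = cst 0.
  by apply/funext => x; rewrite mul0r.
split.
- by split; exact: measurable_cst.
- by move=> phi; rewrite E; split; exact: integrable0.
- by apply/funext => phi; rewrite /dist_of E /cintegral /Rintegral /= !integral0.
Qed.

Lemma representsB u v g h :
  represents u g -> represents v h -> represents (u - v) (g - h).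
Proof.
move=> [[mg1 mg2] ig ->] [[mh1 mh2] ih ->].
have ReB (a b : R[i]) : Re (a - b) = Re a - Re b by case: a; case: b.
have ImB (a b : R[i]) : Im (a - b) = Im a - Im b by case: a; case: b.
split.
- split.
    rewrite (_ : _ \o _ = (@Re R \o g) \- (@Re R \o h)); first exact: measurable_funB.
    by apply/funext => x; rewrite /= ReB.
  rewrite (_ : _ \o _ = (@Im R \o g) \- (@Im R \o h)); first exact: measurable_funB.
  by apply/funext => x; rewrite /= ImB.
- move=> phi; have [ig1 ig2] := ig phi; have [ih1 ih2] := ih phi; split.
    apply: eq_integrable (integrableB _ ig1 ih1) => // x _ /=.
    by rewrite mulrBl ReB EFinB.
  apply: eq_integrable (integrableB _ ig2 ih2) => // x _ /=.
  by rewrite mulrBl ImB EFinB.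
- apply/funext => phi; have [ig1 ig2] := ig phi; have [ih1 ih2] := ih phi.
  rewrite /dist_of /cintegral /=.
  under eq_Rintegral do rewrite mulrBl ReB.
  rewrite (RintegralB _ ig1 ih1)//.
  under [X in _ = _ +i* X]eq_Rintegral do rewrite mulrBl ImB.
  by rewrite (RintegralB _ ig2 ih2).
Qed.

Lemma measurable_normc d (T : measurableType d) (h : T -> R[i]) :
  cmeasurable h -> measurable_fun setT (fun x => normc (h x)).
Proof.
move=> [m1 m2].
rewrite (_ : (fun _ => _) = (fun r => r `^ 2^-1) \o
  (fun x => Re (h x) ^+ 2 + Im (h x) ^+ 2)).
  apply: measurableT_comp; first exact: measurable_powR.
  by apply: measurable_funD; exact: measurable_funX.
apply/funext => x /=; rewrite powR12_sqrt ?addr_ge0 ?sqr_ge0//.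
by case: (h x).
Qed.

Definition sobolev_pred (s : R) : {pred functional} :=
  mem [set u | tempered u /\ in_Lp 2%:E (bessel s u)].

Lemma in_LpB (p : R) (u v : functional) : 1 <= p ->
  in_Lp p%:E u -> in_Lp p%:E v -> in_Lp p%:E (u - v).
Proof.
move=> p1 [g ug gp] [h vh hp]; exists (g - h); first exact: representsB.
have [mg _ _] := ug; have [mh _ _] := vh.
have [mgh _ _] := representsB ug vh.
have p0 : 0 < p by exact: lt_le_trans p1.
apply: (@le_lt_trans _ _ (Lnorm lebesgue_rV p%:E
  (EFin \o ((fun x => normc (g x)) \+ (fun x => normc (h x)))))).
  rewrite /cLnorm unlock /=; apply: gt0_ler_poweR.
  - by rewrite invr_ge0 ltW.
  - rewrite in_itv/= leey andbT; apply: integral_ge0 => x _.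
    by rewrite lee_fin powR_ge0.
  - rewrite in_itv/= leey andbT; apply: integral_ge0 => x _.
    by rewrite lee_fin powR_ge0.
  apply: ge0_le_integral => //.
  - apply/measurable_EFinP; apply: (measurableT_comp (measurable_powR _)).
    by apply: measurableT_comp => //; exact: measurable_normc.
  - apply/measurable_EFinP; apply: (measurableT_comp (measurable_powR _)).
    by apply: measurableT_comp => //; apply: measurable_funD;
      exact: measurable_normc.
  move=> x _; rewrite lee_fin; apply: ge0_ler_powR; rewrite ?nnegrE ?(ltW p0)//.
  rewrite !ger0_norm ?addr_ge0 ?modulus_ge0//.
  by rewrite -[normc (h x)]normcN; exact: (le_normcD (g x) (- h x)).
apply: (le_lt_trans (minkowski_EFin _ _ _ _)) => //.
- exact: measurable_normc.
- exact: measurable_normc.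
- exact: lte_add_pinfty.
Qed.

Lemma bessel0 t : bessel t 0 = 0.
Proof. by []. Qed.

Lemma besselB t u v : bessel t (u - v) = bessel t u - bessel t v.
Proof. by []. Qed.

Lemma sobolev_zmod_closed s : zmod_closed (sobolev_pred s).
Proof.
split=> [|u v]; rewrite !inE/=.
  split; first exact: tempered0.
  exists 0; first exact: represents0.
  rewrite /cLnorm (_ : (fun _ => _) = cst 0%E) ?Lnorm0 ?gt_eqF//.
  by apply/funext => x; rewrite normc0.
move=> [tu Lu] [tv Lv]; split; first exact: temperedB.
by rewrite besselB; apply: in_LpB => //; rewrite ler1n.
Qed.

HB.instance Definition _ s := GRing.isZmodClosed.Build _ (sobolev_pred s)
  (sobolev_zmod_closed s).

End tempered_distributions.
Arguments functional : clear implicits.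

Record sobolev (R : realType) (n : nat) (s : R) := Sobolev {
  sobolev_dist :> functional R n ;
  _ : sobolev_dist \in sobolev_pred s
}.

HB.instance Definition _ (R : realType) (n : nat) (s : R) :=
  [isSub for @sobolev_dist R n s].
HB.instance Definition _ (R : realType) (n : nat) (s : R) :=
  [Choice of sobolev n s by <:].
HB.instance Definition _ (R : realType) (n : nat) (s : R) :=
  [SubChoice_isSubZmodule of sobolev n s by <:].
Arguments sobolev : clear implicits.

Section fourier_group.
Context {R : realType} {n : nat} {s : R}.
Local Notation Hs := (sobolev R n s).
Implicit Types (P Q : Hs -> Hs) (f g : Hs) (G : set (Hs -> Hs)).

Definition sobolev_norm f : \bar R :=
  cLnorm lebesgue_rV 2%:E (fun xi => (japanese xi `^ s)%:C * fourier_hat f xi).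

Definition fourier_group : set (Hs -> Hs) :=
  [set P : Hs -> Hs | [/\ bijective P, {morph P : f g / f + g} &
    forall f, {ae lebesgue_rV, forall xi,
      normc (fourier_hat f xi) = normc (fourier_hat (P f) xi)}]].

Definition is_subgroup G :=
  [/\ G `<=` fourier_group, G id,
      forall P Q, G P -> G Q -> G (P \o Q) &
      forall P Q, G P -> cancel P Q -> cancel Q P -> G Q].

(* d([f],[g]), written on representatives *)
Definition quotient_dist G f g : \bar R :=
  ereal_inf [set sobolev_norm (f - P g) | P in G].

End fourier_group.

(* ||F||_(L^p -> L^p')^2, where p' is the conjugate exponent. *)
Definition fourier_const (R : realType) (n : nat) (p : R) : \bar R :=
  (ereal_sup [set dLnorm (hoelder_conjugate p%:E) (dfourier (dist_of h)) |
     h in [set h : 'rV[R]_n -> R[i] | cmeasurable h /\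
       cLnorm lebesgue_rV p%:E h <= 1]] ^+ 2)%E.

Definition hoelder_exponent (R : realType) (p : R) : \bar R :=
  if p == 2 then +oo%E else (p / (2 - p))%:E.

(* Main.v *)
Require Import Defs.
From HB Require Import structures.
From mathcomp Require Import all_boot all_order all_algebra.
From mathcomp Require Import complex.
From mathcomp Require Import all_classical all_reals all_analysis.
From mathcomp Require Import measurable_realfun ess_sup_inf ring lra.

Set Implicit Arguments.
Unset Strict Implicit.
Unset Printing Implicit Defensive.

Import Order.TTheory GRing.Theory Num.Theory.
Import numFieldNormedType.Exports.
Import ComplexField.Normc.

Local Open Scope classical_set_scope.
Local Open Scope ring_scope.
Local Open Scope complex_scope.
Local Notation Re := complex.Re.
Local Notation Im := complex.Im.

(** Put [u = P f - Q g] with [P] and [Q] in [G]. The operators in [G] keep the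
    moduli of Fourier transforms, hence the Sobolev norm, so the distance is at
    most the norm of [f - P^-1 Q g], which equals that of [u]
    ([quotient_dist_le]). At almost every point off the common support [A] one
    of the transforms of [f] and [g] is zero, and there the transform [U] of [u]
    has the modulus of the difference of their moduli. Writing [D] for the first
    term of the bound and [<xi>] for the bracket, this gives

      [d^2 <= D + \int_A <xi>^(2s) |U|^2]     ([quotient_dist_split]).

    The integrand is [<xi>^(2s-2t)] times the square of [<xi>^t |U|]. Hölder's
    inequality with the conjugate exponents [p / (2 - p)] and [p' / 2]
    ([hoelder_weight]) bounds the integral by [K] times the square of the
    [L^p'] norm of [<xi>^t U]. If [h] in [L^p] represents [bessel t u], then
    [<xi>^t U] is the Fourier transform of [h], so that norm is controlled by the
    definition of the constant [c] ([fourier_const_le], [weight_le]). It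
    remains to take the infimum over [P] and [Q].

    The product [c * K * inf] may contain factors zero and infinity. If [K] is
    zero, [A] is negligible. If the infimum is zero, the functions [h_j] of a
    fast minimising sequence are cut at height one into an [L^2] and an [L^1]
    part; their transforms then tend to zero almost everywhere
    ([Lp_transform], [fourier_hat_cvg0]), and dominated convergence removes the
    integral over [A] ([quotient_dist_null]). If [K] and the infimum are positive
    and a factor is infinite, the bound is infinite because [c] is positive
    ([fourier_const_gt0]).

    Two facts make the objects meaningful. A distribution determines the
    function that represents it up to a null set ([represents_unique]): testing
    with bumps that increase to the indicators of rectangles shows that a
    function which pairs to zero with all test functions supported in an open
    set vanishes almost everywhere there ([ae_vanish]). And the transform of a
    square integrable function is a square integrable function
    ([fourier_square_integrable]): by Plancherel's identity for Schwartz
    functions it is a bounded functional on a subspace of [L^2], to which Riesz'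
    theorem applies ([plancherel], [riesz_subspace]).

    Complex functions are handled through their real and imaginary parts. The
    transforms of these are combinations of the integrals [ctrans] of a function
    against [cos (xi . x + c)], for which stability of the Schwartz space
    ([rschwartz_ctrans]) and inversion ([ctrans_inversion]) are proved.

    The weight has a finite norm when [A] is compact or of finite measure and the
    weight is bounded on it ([weight_bounded_lty]), or because [<xi>^-a] is
    integrable for [a > n] ([integral_japanese_lty], [weight_decay_lty]). *)

(** * Measure theory of R^n *)

Section boxes.
Context {R : realType} {n : nat}.
Local Notation V := 'rV[R]_n.
Implicit Types (x a b c : V) (r : R) (U : set V).

Definition rect a b : set V := [set x | forall i, a ord0 i < x ord0 i < b ord0 i].

Definition rects : set (set V) := [set A | exists a b, A = rect a b].

Definition box c r : set V := [set x | forall i, `|x ord0 i - c ord0 i| < r].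

Definition cbox c r : set V := [set x | forall i, `|x ord0 i - c ord0 i| <= r].

Definition rat_box (q : 'rV[rat]_n * nat) : set V :=
  box (map_mx ratr q.1) q.2.+1%:R^-1.

Definition rat_cbox (q : 'rV[rat]_n * nat) : set V :=
  cbox (map_mx ratr q.1) q.2.+1%:R^-1.

Lemma box_rect c r : box c r = rect (\row_i (c ord0 i - r)) (\row_i (c ord0 i + r)).
Proof.
apply/seteqP; split=> x xc i; have := xc i; rewrite !mxE ltr_norml => /andP[? ?].
  by apply/andP; split; lra.
by apply/andP; split; lra.
Qed.

(** This is why rectangles are used besides the cubes [box]: Dynkin's lemma asks
    for a class stable under intersection. *)
Lemma rectsI : setI_closed rects.
Proof.
move=> _ _ [a [b ->]] [c [d ->]].
exists (\row_i Num.max (a ord0 i) (c ord0 i)), (\row_i Num.min (b ord0 i) (d ord0 i)).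
apply/seteqP; split=> x; rewrite /rect /=.
  move=> [xab xcd] i; rewrite !mxE gt_max lt_min.
  by case/andP: (xab i) => -> ->; case/andP: (xcd i) => -> ->.
move=> h; split=> i; have := h i; rewrite !mxE gt_max lt_min;
  by move=> /andP[/andP[? ?] /andP[? ?]]; apply/andP.
Qed.

Lemma rat_approx x (e : R) : 0 < e ->
  exists q : 'rV[rat]_n, forall i, `|x ord0 i - ratr (q ord0 i)| < e.
Proof.
move=> e0.
have h (i : 'I_n) : exists q : rat, ratr q \in `]x ord0 i - e, x ord0 i + e[.
  by apply: rat_in_itvoo; lra.
have [q hq] := choice h.
exists (\row_i q i) => i; rewrite mxE; move: (hq i); rewrite in_itv/= => /andP[a b].
by rewrite ltr_norml; apply/andP; split; lra.
Qed.

(** Rational boxes form a countable basis; that the closed boxes stay inside is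
    what makes bump functions supported in them admissible test functions. *)
Lemma open_rat_box U x : open U -> U x ->
  exists2 q, rat_cbox q `<=` U & rat_box q x.
Proof.
rewrite openE => /(_ x)/[apply]/nbhs_ballP[e /= e0 xU].
have [m] : exists m, m.+1%:R^-1 < e / 2.
  have := near_infty_natSinv_lt (PosNum (divr_gt0 e0 (ltr0Sn R 1))).
  by move=> [N _ h]; exists N; apply: h => /=.
move=> me.
have m0 : 0 < m.+1%:R^-1 :> R by rewrite invr_gt0.
have [q qx] := rat_approx x m0.
exists (q, m) => [y /= yq|i]; last by rewrite mxE; exact: qx.
apply: xU; split => // i j; rewrite (ord1 i) /ball/=.
have := yq j; have := qx j; rewrite mxE /= => h1 h2.
have -> : x ord0 j - y ord0 j = (x ord0 j - ratr (q ord0 j)) - (y ord0 j - ratr (q ord0 j)) by ring.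
apply: (le_lt_trans (ler_normB _ _)); rewrite (splitr e).
by apply: ltrD; [exact: lt_trans h1 me|exact: le_lt_trans h2 me].
Qed.

Lemma open_rects U : open U -> <<s rects >> U.
Proof.
move=> oU; pose F k : set V :=
  if unpickle k is Some q then (if `[< rat_cbox q `<=` U >] then rat_box q else set0)
  else set0.
have -> : U = \bigcup_k F k.
  apply/seteqP; split=> x.
    move=> /(open_rat_box oU)[q qU qx]; exists (pickle q) => //.
    by rewrite /F pickleK asboolT.
  move=> [k _]; rewrite /F; case: unpickle => // q.
  case: ifPn => // /asboolP qU qx; apply: qU => i; exact/ltW/qx.
apply: sigma_algebra_bigcup => k; rewrite /F.
case: unpickle => [q|]; last exact: sigma_algebra0.
case: ifP => // _; last exact: sigma_algebra0.
by apply: sub_sigma_algebra; rewrite /rat_box box_rect; eexists; eexists.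
Qed.

Lemma measurable_rects : measurable = <<s rects >> :> set (set V).
Proof.
apply/seteqP; split; last first.
  apply: smallest_sub; first exact: sigma_algebra_measurable.
  move=> _ [a [b ->]]; rewrite (_ : rect a b = \bigcap_(i in [set: 'I_n])
    (@rV_coord R n i @^-1` `]a ord0 i, b ord0 i[%classic)).
    apply: fin_bigcap_measurable; first exact: finite_finset.
    by move=> i _; rewrite -[X in measurable X]setTI; apply: measurable_rV_coord.
  by apply/seteqP; split=> x h i; have := h i; rewrite /= in_itv //=; apply.
apply: smallest_sub; first exact: smallest_sigma_algebra.
move=> A /=; rewrite -bigcup_seq /= => -[i _ [B mB <-]]; rewrite setTI.
have : measurable_fun [set: g_sigma_algebraType rects] (@rV_coord R n i).
  apply: (measurability _ (RGenOInfty.measurableE R)) => //.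
  move=> _ [_ [c ->] <-]; rewrite setTI; apply: open_rects.
  by apply: open_comp; [move=> y _; exact: coord_continuous|exact: interval_open].
by move=> /(_ measurableT _ mB); rewrite setTI.
Qed.

Lemma measurable_open U : open U -> measurable U.
Proof. by rewrite measurable_rects; exact: open_rects. Qed.

Lemma continuous_measurable_rV (u : 'rV[R]_n -> R) :
  continuous u -> measurable_fun setT u.
Proof.
move=> cu; apply: (measurability _ (RGenOInfty.measurableE R)) => //.
move=> _ [_ [a ->] <-]; rewrite setTI; apply: measurable_open.
by apply: open_comp => //; exact: interval_open.
Qed.

End boxes.

Section iterated_integral.
Context {R : realType}.
Local Open Scope ereal_scope.

Lemma lebesgue_translation (h : R) (f : R -> \bar R) :
  measurable_fun setT f -> (forall x, 0 <= f x) ->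
  \int[lebesgue_measure]_x f (x + h)%R = \int[lebesgue_measure]_x f x.
Proof.
move=> mf f0.
have mt : measurable_fun setT (fun x : measurableTypeR R => (x + h)%R : measurableTypeR R).
  by apply: measurable_funD.
transitivity (\int[pushforward lebesgue_measure (fun x : measurableTypeR R => (x + h)%R : measurableTypeR R)]_x f x).
  by rewrite (ge0_integral_pushforward mt).
apply: eq_measure_integral => A mA _.
apply/esym/(lebesgue_measure_unique (mu := pushforward lebesgue_measure (fun x : measurableTypeR R => (x + h)%R : measurableTypeR R))) => //= _ [[a b]] _ <-.
rewrite /pushforward (_ : _ @^-1` _ = `](a - h)%R, (b - h)%R]%classic); last first.
  by apply/seteqP; split=> x /=; rewrite !in_itv/= ltrBlDr lerBrDr.
rewrite /= !lebesgue_measure_itv/= !lte_fin.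
rewrite ltrD2r; case: ifP => // _; rewrite -!EFinB; congr EFin; ring.
Qed.

Lemma integral_rV0 (f : 'rV[R]_0 -> \bar R) :
  \int[lebesgue_rV]_x f x = f 0%R.
Proof.
rewrite /= integral_dirac//; first by rewrite diracT mul1e.
move=> _ Y mY; rewrite setTI.
have [h|h] := pselect (Y (f 0%R)).
  rewrite (_ : _ @^-1` _ = setT)//; apply/seteqP; split=> // x _ /=.
  by rewrite (_ : x = 0%R)//; apply/rowP => -[].
rewrite (_ : _ @^-1` _ = set0)//; apply/seteqP; split=> // x /=.
by rewrite (_ : x = 0%R)//; apply/rowP => -[].
Qed.

Lemma integral_rVS n (f : 'rV[R]_n.+1 -> \bar R) :
  measurable_fun setT f -> (forall x, 0 <= f x) ->
  \int[lebesgue_rV]_x f x =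
  \int[lebesgue_measure]_a \int[lebesgue_rV]_v f (rV_cons (a, v)).
Proof.
move=> mf f0.
transitivity (\int[(lebesgue_measure \x @lebesgue_rV R n)%E]_p f (rV_cons p)).
  have mc : measurable_fun setT (@rV_cons R n : measurableTypeR R * 'rV[R]_n -> _).
    exact: measurable_rV_cons.
  transitivity (\int[pushforward (@lebesgue_measure R \x @lebesgue_rV R n)
      (@rV_cons R n : measurableTypeR R * 'rV[R]_n -> _)]_x f x) => //.
  by rewrite (ge0_integral_pushforward mc).
rewrite fubini_tonelli1//.
by apply: measurableT_comp => //; exact: measurable_rV_cons.
Qed.

Lemma measurable_rV_shift n (h : 'rV[R]_n) :
  measurable_fun setT (fun x : 'rV[R]_n => x + h)%R.
Proof.
apply: measurable_fun_rV => i.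
rewrite (_ : _ \o _ = (fun x => x + h ord0 i)%R \o rV_coord i); last first.
  by apply/funext => x; rewrite /rV_coord /= mxE.
apply: measurableT_comp; last exact: measurable_rV_coord.
exact: measurable_funD.
Qed.

(** By Tonelli, a translation is a succession of one-dimensional ones. *)
Lemma ge0_integral_shift n (h : 'rV[R]_n) (f : 'rV[R]_n -> \bar R) :
  measurable_fun setT f -> (forall x, 0 <= f x) ->
  \int[lebesgue_rV]_x f (x + h)%R = \int[lebesgue_rV]_x f x.
Proof.
elim: n h f => [|n IH] h f mf f0.
  by rewrite !integral_rV0; congr f; apply/rowP => -[].
have mfc : measurable_fun setT (fun p => f (@rV_cons R n p)).
  by apply: measurableT_comp => //; exact: measurable_rV_cons.
rewrite [RHS](integral_rVS mf f0) [LHS](integral_rVS (f := fun x => f (x + h)%R)); last 2 first.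
- by apply: (measurableT_comp mf); exact: measurable_rV_shift.
- by move=> x; exact: f0.
pose F a := \int[lebesgue_rV]_v f (@rV_cons R n (a, v)).
rewrite -[RHS](lebesgue_translation (h ord0 ord0) (f := F)); last 2 first.
- by apply: measurable_fun_fubini_tonelli_F mfc _ => p.
- by move=> a; exact: integral_ge0.
apply: eq_integral => a _; rewrite /F.
pose h' : 'rV[R]_n := (\row_i h ord0 (lift ord0 i))%R.
rewrite -[RHS](IH h'); last 2 first.
- apply: (measurableT_comp (f := f)) => //.
  by apply: (measurableT_comp (@measurable_rV_cons R n)); exact: measurable_pair1.
- by [].
apply: eq_integral => v _; congr f.
have E (x : 'rV[R]_n.+1) : x = rV_cons (rV_uncons x).
  apply/rowP => i; have [j ->|->] := unliftP ord0 i.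
    by have /= := congr1 (@^~ (rV_uncons x)) (rV_coord_consS j); rewrite /rV_coord mxE => ->.
  by have /= := congr1 (@^~ (rV_uncons x)) (@rV_coord_cons0 R n).
rewrite [LHS]E; congr rV_cons; congr (_, _).
  rewrite mxE; congr (_ + _)%R.
  exact: (congr1 (@^~ (a, v)) (@rV_coord_cons0 R n)).
apply/rowP => i; rewrite [LHS]mxE [LHS]mxE [RHS]mxE [h' _ _]mxE; congr (_ + _)%R.
exact: (congr1 (@^~ (a, v)) (rV_coord_consS i)).
Qed.

Lemma integral_shift n (h : 'rV[R]_n) (f : 'rV[R]_n -> \bar R) :
  measurable_fun setT f ->
  \int[lebesgue_rV]_x f (x + h)%R = \int[lebesgue_rV]_x f x.
Proof.
move=> mf; rewrite integralE [RHS]integralE; congr (_ - _).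
  rewrite -[RHS](ge0_integral_shift h)//.
    by apply: eq_integral => x _; rewrite !funeposE.
  exact: measurable_funepos.
rewrite -[RHS](ge0_integral_shift h)//.
  by apply: eq_integral => x _; rewrite !funenegE.
exact: measurable_funeneg.
Qed.

Lemma ge0_integral_prod n (f : R -> R) (c : R) :
  measurable_fun setT f -> (forall t, (0 <= f t)%R) ->
  \int[lebesgue_measure]_t (f t)%:E = c%:E ->
  \int[lebesgue_rV]_x (\prod_i f ((x : 'rV[R]_n) ord0 i))%:E = (c ^+ n)%:E.
Proof.
move=> mf f0 fc.
have c0 : (0 <= c)%R by rewrite -lee_fin -fc; apply: integral_ge0 => t _; rewrite lee_fin.
have mp m : measurable_fun setT (fun x : 'rV[R]_m => (\prod_i f (x ord0 i))%:E).
  apply/measurable_EFinP; apply: measurable_prod => i _.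
  by apply: (measurableT_comp mf); exact: measurable_rV_coord.
have p0 m (x : 'rV[R]_m) : 0 <= (\prod_i f (x ord0 i))%:E.
  by rewrite lee_fin; apply: prodr_ge0.
elim: n => [|n IH].
  by rewrite integral_rV0 big_ord0 expr0.
rewrite integral_rVS//.
transitivity (\int[lebesgue_measure]_a ((f a)%:E * (c ^+ n)%:E)).
  apply: eq_integral => a _; rewrite -IH -ge0_integralZl//; [|exact: mp|by rewrite lee_fin].
  apply: eq_integral => v _; rewrite big_ord_recl EFinM; congr (_%:E * _%:E).
    by congr f; exact: (congr1 (@^~ (a, v)) (@rV_coord_cons0 R n)).
  apply: eq_bigr => i _; congr f.
  exact: (congr1 (@^~ (a, v)) (rV_coord_consS i)).
rewrite ge0_integralZr//; last 3 first.
- exact/measurable_EFinP.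
- by move=> x _; rewrite lee_fin.
- by rewrite lee_fin exprn_ge0.
by rewrite fc -EFinM exprS.
Qed.

End iterated_integral.

Section integrability.
Context {R : realType}.

Lemma powR_cvgy (e : R) : 0 < e -> (1 + t) `^ (- e) @[t --> +oo] --> 0.
Proof.
move=> e0; apply/cvgrPdist_lt => d d0; near=> t.
have h1 : d^-1 `^ e^-1 < 1 + t.
  rewrite -ltrBlDl; near: t; exact: nbhs_pinfty_gt.
have t0 : 0 < 1 + t by apply: le_lt_trans h1; exact: powR_ge0.
rewrite sub0r normrN ger0_norm ?powR_ge0// powRN invf_plt ?posrE ?powR_gt0//.
rewrite (_ : d^-1 = (d^-1 `^ e^-1) `^ e); last first.
  by rewrite -powRrM mulVf ?gt_eqF// powRr1// invr_ge0 ltW.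
by apply: gt0_ltr_powR; rewrite ?nnegrE ?powR_ge0// ltW.
Unshelve. all: by end_near. Qed.

Lemma is_derive_shift_powR (a t : R) : 0 <= t ->
  is_derive t 1 (fun t : R => (1 + t) `^ a) (a * (1 + t) `^ (a - 1)).
Proof.
move=> t0.
have t1 : 0 < 1 + t by rewrite ltr_pwDl.
have h1 : is_derive t 1 (fun t : R => 1 + t) 1.
  have := is_deriveD (is_derive_cst (1 : R) t 1) (is_derive_id t 1).
  by rewrite add0r.
have h2 := is_derive1_powR a t1.
have := is_derive1_comp h2 h1.
by rewrite mulr1.
Qed.

Lemma integral_powR_abs (c : R) : 1 < c ->
  (\int[lebesgue_measure]_t ((1 + `|t|) `^ (- c))%:E < +oo :> \bar R)%E.
Proof.
move=> c1.
rewrite ge0_symfun_integralT/=; last 3 first.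
- by move=> t; exact: powR_ge0.
- move=> t; apply: (@continuous_comp _ _ _ (fun t : R => `|t|) (fun t => (1 + t) `^ (- c))).
    exact: norm_continuous.
  by apply: differentiable_continuous; apply/derivable1_diffP;
    have [] := is_derive_shift_powR (- c) (normr_ge0 t).
- by move=> t /=; rewrite normrN.
rewrite lte_mul_pinfty//.
have -> : [set x : R | (0 <= x)%R] = `[0, +oo[%classic.
  by apply/seteqP; split=> x /=; rewrite in_itv/= andbT.
rewrite [X in (X < _)%E](_ : _ = \int[lebesgue_measure]_(t in `[0%R, +oo[) ((1 + t) `^ (- c))%:E)%E; last first.
  by apply: eq_integral => t; rewrite inE/= in_itv/= andbT => t0; rewrite ger0_norm.
rewrite (@ge0_continuous_FTC2y _ _ (fun t => - (c - 1)^-1 * (1 + t) `^ (- (c - 1))) 0 0)//.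
- by rewrite -EFinB ltey.
- by move=> t t0; exact: powR_ge0.
- apply: derivable_within_continuous => t; rewrite in_itv/= andbT => t0.
  by have [] := is_derive_shift_powR (- c) t0.
- rewrite -[X in _ --> X](mulr0 (- (c - 1)^-1)); apply: cvgMr.
  by apply: powR_cvgy; rewrite subr_gt0.
- move=> t t0; apply: derivableM => //.
  by have [] := is_derive_shift_powR (- (c - 1)) (ltW t0).
- apply: cvg_at_right_filter; apply: cvgMr.
  have [+ _] := is_derive_shift_powR (- (c - 1)) (lexx (0 : R)).
  by move=> /derivable1_diffP/differentiable_continuous; apply.
- move=> t; rewrite in_itv/= andbT => t0; rewrite derive1E.
  have [d1 d2] := is_derive_shift_powR (- (c - 1)) (ltW t0).
  rewrite deriveM// d2 derive_cst [_ *: 0]scaler0 addr0 /GRing.scale/=.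
  rewrite mulrA mulrNN mulVf ?mul1r; last by rewrite gt_eqF// subr_gt0.
  by congr (_ `^ _); ring.
Qed.

End integrability.

Section japanese_integrability.
Context {R : realType} {n : nat}.
Implicit Types x : 'rV[R]_n.

Lemma japanese_gt0 x : 0 < japanese x.
Proof. exact: lt_le_trans (japanese_ge1 x). Qed.

Lemma japanese_sqr x : japanese x ^+ 2 = 1 + dotrV x x.
Proof. by rewrite sqr_sqrtr// addr_ge0// dotrV_ge0. Qed.

Lemma coord_le_japanese x i : `|x ord0 i| <= japanese x.
Proof.
rewrite -(@ler_pXn2r _ 2)// ?nnegrE ?japanese_ge0// japanese_sqr real_normK ?num_real//.
rewrite /dotrV (bigD1 i)//= expr2 addrCA lerDl addr_ge0// sumr_ge0// => j _.
by rewrite -expr2 sqr_ge0.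
Qed.

Lemma measurable_coord i : measurable_fun setT (fun x => x ord0 i : R).
Proof. exact: measurable_rV_coord. Qed.

Lemma measurable_japanese : measurable_fun setT (fun x => japanese x).
Proof.
rewrite (_ : (fun _ => _) = (fun r => r `^ 2^-1) \o (fun x => 1 + dotrV x x)).
  apply: measurableT_comp; first exact: measurable_powR.
  apply: measurable_funD => //; apply: measurable_sum => i.
  by apply: measurable_funM; exact: measurable_coord.
by apply/funext => x /=; rewrite powR12_sqrt// addr_ge0// dotrV_ge0.
Qed.

Lemma measurable_japanese_powR a : measurable_fun setT (fun x => japanese x `^ a).
Proof. exact: (measurableT_comp (measurable_powR a) measurable_japanese). Qed.

(** Comparison with a product: each factor [(1 + |x_i|) / 2] is at most the
    bracket, so the integral splits into one-dimensional ones. *)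
Lemma integral_japanese_lty (a : R) : n%:R < a ->
  (\int[lebesgue_rV]_x (japanese (x : 'rV[R]_n) `^ (- a))%:E < +oo)%E.
Proof.
move=> na.
have [n0|n0] := eqVneq n 0.
  by move: na; subst n => na; rewrite integral_rV0 ltey.
have n1 : 0 < n%:R :> R by rewrite ltr0n lt0n.
have a0 : 0 < a by exact: lt_trans na.
pose f (t : R) := 2 `^ (a / n%:R) * (1 + `|t|) `^ (- (a / n%:R)).
have f0 t : 0 <= f t by rewrite mulr_ge0 ?powR_ge0.
have mf0 : measurable_fun [set: R] (fun t : R => (1 + `|t|) `^ (- (a / n%:R))).
  apply: (measurableT_comp (measurable_powR (- (a / n%:R)))).
  by apply: measurable_funD => //; exact: measurable_normr.
have mf : measurable_fun setT f by exact: measurable_funM.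
have [c fc] : exists c, (\int[lebesgue_measure]_t (f t)%:E = c%:E :> \bar R)%E.
  exists (fine (\int[lebesgue_measure]_t (f t)%:E)%E); rewrite fineK//.
  rewrite ge0_fin_numE; last by apply: integral_ge0 => t _; rewrite lee_fin.
  under eq_integral do rewrite EFinM.
  rewrite ge0_integralZl//; last exact/measurable_EFinP.
  rewrite lte_mul_pinfty ?lee_fin ?powR_ge0//.
  by apply: integral_powR_abs; rewrite ltr_pdivlMr// mul1r.
apply: (@le_lt_trans _ _ (\int[lebesgue_rV]_x (\prod_i f ((x : 'rV[R]_n) ord0 i))%:E)%E).
  apply: ge0_le_integral => //.
  - by move=> x _; rewrite lee_fin powR_ge0.
  - by apply/measurable_EFinP; exact: measurable_japanese_powR.
  - apply/measurable_EFinP; apply: measurable_prod => i _.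
    by apply: (measurableT_comp mf); exact: measurable_coord.
  move=> x _; rewrite lee_fin.
  rewrite (_ : japanese x `^ (- a) = \prod_(i < n) japanese x `^ (- (a / n%:R))); last first.
    rewrite prodr_const card_ord -powR_mulrn ?powR_ge0// -powRrM.
    by congr (_ `^ _); rewrite mulNr divfK// gt_eqF.
  apply: ler_prod => i _; rewrite powR_ge0/= /f !powRN.
  have h : 0 < 1 + `|x ord0 i| by rewrite ltr_pwDl.
  have h' : 1 + `|x ord0 i| <= 2 * japanese x.
    have := coord_le_japanese x i; have := japanese_ge1 x; lra.
  have e0 : 0 <= a / n%:R by rewrite divr_ge0// ltW.
  rewrite ler_pdivlMr ?powR_gt0// ler_pdivrMl ?powR_gt0 ?japanese_gt0// [_ * 2 `^ _]mulrC.
  rewrite -powRM ?japanese_ge0//.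
  by apply: ge0_ler_powR => //; rewrite nnegrE ?mulr_ge0 ?japanese_ge0// ltW.
by rewrite (ge0_integral_prod n mf f0 fc) ltey.
Qed.

End japanese_integrability.

(** * Differential calculus on R^n *)

Section gradients.
Context {R : realType} {n : nat}.
Local Notation V := 'rV[R]_n.
Implicit Types (x y : V) (u v : V -> R) (i : 'I_n).

Lemma dotrVC x y : dotrV x y = dotrV y x.
Proof. by apply: eq_bigr => i _; rewrite mulrC. Qed.

Lemma dotrVDr x y z : dotrV x (y + z) = dotrV x y + dotrV x z.
Proof. by rewrite /dotrV -big_split/=; apply: eq_bigr => i _; rewrite mxE mulrDr. Qed.

Lemma dotrVZr x a y : dotrV x (a *: y) = a * dotrV x y.
Proof. by rewrite /dotrV mulr_sumr; apply: eq_bigr => i _; rewrite mxE mulrCA. Qed.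

Lemma dotrVNr x y : dotrV x (- y) = - dotrV x y.
Proof. by rewrite -scaleN1r dotrVZr mulN1r. Qed.

Lemma dotrVBr x y z : dotrV x (y - z) = dotrV x y - dotrV x z.
Proof. by rewrite dotrVDr dotrVNr. Qed.

Lemma dotrV_delta x i : dotrV x (delta_mx ord0 i) = x ord0 i.
Proof.
rewrite /dotrV (bigD1 i)//= mxE !eqxx mulr1 big1 ?addr0// => j ji.
by rewrite mxE (negbTE ji) andbF mulr0.
Qed.

Lemma normr_coord_le x i : `|x ord0 i| <= `|x|.
Proof.
rewrite [leRHS]mx_normrE; apply/bigmax_geP; right => /=.
by exists (ord0, i).
Qed.

Lemma dotrV_le_norm x : dotrV x x <= n%:R * `|x| ^+ 2.
Proof.
rewrite /dotrV mulr_natl -[X in _ *+ X]card_ord -sumr_const; apply: ler_sum => i _.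
by rewrite -expr2 -real_normK ?num_real// ler_pXn2r ?nnegrE// normr_coord_le.
Qed.

Fact dotrV_linear y : linear (dotrV y).
Proof. by move=> a u v; rewrite dotrVDr dotrVZr. Qed.
HB.instance Definition _ y := GRing.isLinear.Build R V R *:%R (dotrV y) (dotrV_linear y).

Lemma dotrV_continuous y : continuous (dotrV y).
Proof.
rewrite (_ : dotrV y = \sum_(i < n) (y ord0 i *: (fun x : V => x ord0 i : R))).
  move=> x; apply: differentiable_continuous; apply: differentiable_sum => i.
  by apply: differentiableZ; exact: differentiable_coord.
by apply/funext => x; rewrite fct_sumE.
Qed.

(** A quadratic bound on the remainder gives differentiability; the bound passes
    through integrals, which is how transforms are differentiated below. *)
Lemma quadratic_diff u x y (C : R) :
  (forall h, `|u (x + h) - u x - dotrV y h| <= C * dotrV h h) ->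
  differentiable u x /\ forall i, 'D_(delta_mx ord0 i) u x = y ord0 i.
Proof.
move=> uC.
have C0 : 0 <= `|C| * n%:R by rewrite mulr_ge0.
have E : u \o shift x = cst (u x) + (dotrV y : V -> R) +o_ (0 : V) (id : V -> V).
  apply/eqaddoP => _ /posnumP[e].
  have [d [d0 dC]] : exists d : R, 0 < d /\ `|C| * n%:R * d <= e%:num.
    exists (e%:num / (`|C| * n%:R + 1)); split; first by rewrite divr_gt0// ltr_wpDl.
    rewrite mulrA ler_pdivrMr ?ltr_wpDl// mulrC mulrDr mulr1 lerDl//.
  apply: filterS (nbhs0_lt d0) => h hd /=.
  rewrite [X in `|X|](_ : _ = u (x + h) - u x - dotrV y h); last first.
    by rewrite !fctE/= [h + x]addrC opprD addrA.
  apply: (le_trans (uC h)); apply: (@le_trans _ _ (`|C| * (n%:R * `|h| ^+ 2))).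
    apply: (@le_trans _ _ (`|C| * dotrV h h)).
      by rewrite ler_wpM2r ?dotrV_ge0// ler_norm.
    by rewrite ler_wpM2l// dotrV_le_norm.
  rewrite expr2 !mulrA ler_wpM2r//; apply: le_trans dC.
  by rewrite ler_wpM2l// ltW.
have df : 'd u x = dotrV y :> (V -> R).
  by apply: diff_unique E; exact: dotrV_continuous.
have du : differentiable u x.
  by apply/diff_locallyP; rewrite df; split => //; exact: dotrV_continuous.
by split => // i; rewrite deriveE// df; exact: dotrV_delta.
Qed.

Definition has_grad u (g : 'I_n -> V -> R) :=
  forall x, differentiable u x /\ forall i, 'D_(delta_mx ord0 i) u x = g i x.

Definition dpart i u : V -> R := fun x => 'D_(delta_mx ord0 i) u x.

Lemma dpart_grad u g i : has_grad u g -> dpart i u = g i.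
Proof. by move=> ug; apply/funext => x; exact: (ug x).2. Qed.

Lemma has_grad_dpart u : (forall x, differentiable u x) -> has_grad u (dpart ^~ u).
Proof. by []. Qed.

Lemma has_grad_cst c : has_grad (cst c) (fun _ => cst 0).
Proof. by move=> x; split=> [|i]; [exact: differentiable_cst|exact: derive_cst]. Qed.

Lemma has_gradD u v g h : has_grad u g -> has_grad v h ->
  has_grad (fun x => u x + v x) (fun i x => g i x + h i x).
Proof.
move=> ug vh x; have [du Du] := ug x; have [dv Dv] := vh x; split=> [|i].
  exact: differentiableD.
by rewrite (deriveD (diff_derivable du) (diff_derivable dv)) Du Dv.
Qed.

Lemma has_gradM u v g h : has_grad u g -> has_grad v h ->
  has_grad (fun x => u x * v x) (fun i x => g i x * v x + u x * h i x).
Proof.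
move=> ug vh x; have [du Du] := ug x; have [dv Dv] := vh x; split=> [|i].
  exact: differentiableM.
rewrite (deriveM (diff_derivable du) (diff_derivable dv)) Du Dv.
by rewrite /GRing.scale/= addrC mulrC.
Qed.

Lemma has_grad_comp (f f' : R -> R) u g : (forall x, is_derive (u x) 1 f (f' (u x))) ->
  has_grad u g -> has_grad (fun x => f (u x)) (fun i x => f' (u x) * g i x).
Proof.
move=> df ug x; have [du Du] := ug x.
have dfx : differentiable f (u x) by apply/derivable1_diffP; have [] := df x.
have dfu : differentiable (f \o u) x by exact: differentiable_comp.
split=> // i; rewrite deriveE// diff_comp//= -Du deriveE//.
set t := 'd u x _; rewrite -[t]mulr1 -[t * 1]/(t *: 1) linearZ/=.
rewrite -deriveE//; have [_ ->] := df x; by rewrite /GRing.scale/= mulr1 mulrC.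
Qed.

Lemma has_grad_dotrV y : has_grad (dotrV y) (fun i => cst (y ord0 i)).
Proof.
move=> x; apply: (@quadratic_diff _ _ _ 0) => h.
by rewrite dotrVDr (_ : _ - _ - _ = 0) ?normr0 ?mul0r//; ring.
Qed.

Lemma has_grad_sqr : has_grad (fun x => dotrV x x) (fun i x => 2 * x ord0 i).
Proof.
move=> x; have [|d D] := @quadratic_diff (fun x => dotrV x x) x (2 *: x) 1.
  move=> h; rewrite mul1r [leRHS](_ : _ = `|dotrV h h|); last by rewrite ger0_norm ?dotrV_ge0.
  rewrite le_eqVlt; apply/orP; left; apply/eqP; congr `|_|.
  rewrite !dotrVDr [dotrV (x + h) x]dotrVC [dotrV (x + h) h]dotrVC !dotrVDr.
  rewrite [dotrV (2 *: x) h]dotrVC dotrVZr [dotrV h x]dotrVC; ring.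
by split => // i; rewrite D mxE.
Qed.

Lemma has_grad_coord i : has_grad (fun x => x ord0 i) (fun j => cst ((j == i)%:R)).
Proof.
have := has_grad_dotrV (delta_mx ord0 i).
rewrite (_ : dotrV (delta_mx ord0 i) = (fun x => x ord0 i)); last first.
  by apply/funext => x; rewrite dotrVC dotrV_delta.
rewrite (_ : (fun i0 => cst _) = (fun j => cst (j == i)%:R)) //.
by apply/funext => j; rewrite mxE eqxx.
Qed.

Lemma has_grad_eq u v g h : u =1 v -> (forall i, g i =1 h i) -> has_grad u g ->
  has_grad v h.
Proof.
move=> /funext <- gh ug x; have [? D] := ug x; split=> // i.
by rewrite D gh.
Qed.

Lemma has_grad_continuous u g : has_grad u g -> continuous u.
Proof. by move=> ug x; apply: differentiable_continuous; exact: (ug x).1. Qed.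

End gradients.

Section flat_function.
Context {R : realType}.

(** The derivatives of the flat function exp (-1/t) are combinations of these
    functions, so that the family is stable under derivation. *)
Definition flat (m : nat) (t : R) : R :=
  if 0 < t then t^-1 ^+ m * expR (- t^-1) else 0.

Lemma flat_ge0 m t : 0 <= flat m t.
Proof.
rewrite /flat; case: ifPn => // t0.
by rewrite mulr_ge0 ?expR_ge0// exprn_ge0// invr_ge0 ltW.
Qed.

(** Raise [s / m <= exp (s / m)] to the power [m]. *)
Lemma pow_le_expR (m : nat) (s : R) : 0 <= s -> s ^+ m <= m%:R ^+ m * expR s.
Proof.
move=> s0; case: m => [|m]; first by rewrite !expr0 mul1r (le_trans _ (expR_ge1Dx s))// lerDl.
have m0 : (0 : R) < m.+1%:R by rewrite ltr0n.
have -> : expR s = expR (s / m.+1%:R) ^+ m.+1.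
  by rewrite -expRM_natl mulrC divfK// gt_eqF.
rewrite -exprMn ler_pXn2r ?nnegrE ?mulr_ge0 ?expR_ge0//.
apply: (@le_trans _ _ (m.+1%:R * (s / m.+1%:R))); first by rewrite mulrC divfK// gt_eqF.
by rewrite ler_wpM2l// (le_trans _ (expR_ge1Dx _))// lerDr.
Qed.

Lemma flat_le m t : flat m t <= m%:R ^+ m.
Proof.
rewrite /flat; case: ifPn => [t0|_]; last by rewrite exprn_ge0.
rewrite expRN -ler_pdivlMr ?invr_gt0 ?expR_gt0// invrK.
by apply: pow_le_expR; rewrite invr_ge0 ltW.
Qed.

Lemma is_derive_quadratic (f : R -> R) (x d C : R) :
  (forall h, `|f (x + h) - f x - d * h| <= C * h ^+ 2) -> is_derive x (1 : R) f d.
Proof.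
move=> fC.
suff cf : h^-1 *: ((f \o shift x) (h *: (1 : R)) - f x) @[h --> (0 : R)^'] --> d.
  apply: DeriveDef; last exact: cvg_lim.
  by apply/cvg_ex; exists d.
apply/cvgrPdist_le => e e0.
have [k [k0 kC]] : exists k : R, 0 < k /\ `|C| * k <= e.
  exists (e / (`|C| + 1)); split; first by rewrite divr_gt0// ltr_wpDl.
  by rewrite mulrA ler_pdivrMr ?ltr_wpDl// mulrC mulrDr mulr1 lerDl ltW.
near=> h.
have h0 : h != 0 by near: h; exact: nbhs_dnbhs_neq.
have hk : `|h| < k by near: h; apply: dnbhs0_lt.
rewrite /= /GRing.scale/= mulr1 [h + x]addrC -normrN opprB.
rewrite (_ : _ - d = h^-1 * (f (x + h) - f x - d * h)); last by field.
rewrite normrM normfV ler_pdivrMl ?normr_gt0//; apply: (le_trans (fC h)).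
apply: (@le_trans _ _ (`|C| * h ^+ 2)); first by rewrite ler_wpM2r ?sqr_ge0// ler_norm.
rewrite -real_normK ?num_real// expr2 mulrCA ler_wpM2l//.
by apply: le_trans kC; rewrite ler_wpM2l// ltW.
Unshelve. all: by end_near. Qed.

Lemma is_derive_flat m (t : R) :
  is_derive t (1 : R) (flat m) (- m%:R * flat m.+1 t + flat m.+2 t).
Proof.
have [t0|t0|->] := ltgtP t 0.
- rewrite {2 3}/flat !ifN ?mulr0 ?addr0 -?leNgt ?ltW//.
  apply: (@near_eq_is_derive R R R (cst 0)).
  apply: filterS (lt_nbhsl t0) => x x0; by rewrite /flat ifN // -leNgt ltW.
- have : \forall x \near t, (fun t => t^-1 ^+ m * expR (- t^-1)) x = flat m x.
    by apply: filterS (lt_nbhsr t0) => x x0; rewrite /flat x0.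
  move/near_eq_is_derive; apply.
  have tn0 : t != 0 by rewrite gt_eqF.
  have h1 := is_deriveV tn0 (is_derive_id t 1).
  have h2 := is_deriveX m h1.
  have h3 := @is_derive1_comp R expR (fun x : R => - x^-1) t _ _ (is_derive_expR (- t^-1)) (is_deriveN h1).
  have := is_deriveM h2 h3; rewrite [X in is_derive _ _ X](_ : _ =
    (fun x => x^-1 ^+ m * expR (- x^-1))); last by apply/funext => x; rewrite !fctE.
  move=> h4; apply: (is_derive_eq h4); rewrite /flat t0 !fctE.
  rewrite /GRing.scale/= !mulr1 -!exprVn; clear; set q := t^-1.
  by case: m => [|m]; rewrite /= !exprS; ring.
(* At zero the remainder is [flat m s = flat m.+2 s * s ^+ 2], with a bounded
   factor. *)
- rewrite {2 3}/flat !ltxx mulr0 addr0.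
  apply: (@is_derive_quadratic _ _ _ (m.+2%:R ^+ m.+2)) => s.
  rewrite mul0r subr0 add0r {2}/flat ltxx subr0 ger0_norm ?flat_ge0//.
  have [s0|s0] := ltP 0 s; last first.
    by rewrite /flat ifN -?leNgt//; apply: mulr_ge0; [exact: exprn_ge0|exact: sqr_ge0].
  rewrite (_ : flat m s = flat m.+2 s * s ^+ 2).
    by rewrite ler_wpM2r ?flat_le// sqr_ge0.
  by rewrite /flat s0 !exprS; field; rewrite gt_eqF.
Qed.

End flat_function.

(** * Schwartz functions *)

Section schwartz_real.
Context {R : realType} {n : nat}.
Local Notation V := 'rV[R]_n.
Implicit Types (x y : V) (u v : V -> R) (i : 'I_n).

Definition rpartials (s : seq 'I_n) u := foldr (@dpart R n) u s.

Definition rapid_decay u := forall N : nat, exists C, forall x, japanese x ^+ N * `|u x| <= C.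

Definition rschwartz u :=
  forall s, (forall x, differentiable (rpartials s u) x) /\ rapid_decay (rpartials s u).

(** Coinduction: it suffices to place a function in some class of
    differentiable, rapidly decaying functions that is stable under partial
    derivatives. *)
Lemma rschwartz_coind (S : (V -> R) -> Prop) :
  (forall u, S u -> [/\ forall x, differentiable u x, rapid_decay u & forall i, S (dpart i u)]) ->
  forall u, S u -> rschwartz u.
Proof.
move=> HS u Su s; have /HS[] : S (rpartials s u); last by [].
by elim: s => //= i s /HS[].
Qed.

Lemma rschwartz_dpart u i : rschwartz u -> rschwartz (dpart i u).
Proof. by move=> su s; have := su (rcons s i); rewrite /rpartials foldr_rcons. Qed.

Lemma rschwartz_diff u : rschwartz u -> forall x, differentiable u x.
Proof. by move=> /(_ [::])[]. Qed.

Lemma rschwartz_grad u : rschwartz u -> has_grad u (dpart ^~ u).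
Proof. by move=> su; apply: has_grad_dpart; exact: rschwartz_diff. Qed.

Lemma rschwartz_decay u : rschwartz u -> rapid_decay u.
Proof. by move=> /(_ [::])[]. Qed.

Lemma rschwartz_continuous u : rschwartz u -> continuous u.
Proof. by move=> /rschwartz_grad/has_grad_continuous. Qed.

Lemma rschwartz_measurable u : rschwartz u -> measurable_fun setT u.
Proof. by move=> su; apply: continuous_measurable_rV; exact: rschwartz_continuous. Qed.

Definition slow_growth u := exists (C : R) (N : nat), forall x, `|u x| <= C * japanese x ^+ N.

Lemma slow_growthD u v : slow_growth u -> slow_growth v -> slow_growth (fun x => u x + v x).
Proof.
move=> [C [N uC]] [D [M vD]]; exists (`|C| + `|D|), (maxn N M) => x.
rewrite (le_trans (ler_normD _ _))// mulrDl lerD//.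
  apply: (le_trans (uC x)); apply: (@le_trans _ _ (`|C| * japanese x ^+ N)).
    by rewrite ler_wpM2r ?exprn_ge0 ?japanese_ge0// ler_norm.
  by rewrite ler_wpM2l// ler_weXn2l ?japanese_ge1// leq_maxl.
apply: (le_trans (vD x)); apply: (@le_trans _ _ (`|D| * japanese x ^+ M)).
  by rewrite ler_wpM2r ?exprn_ge0 ?japanese_ge0// ler_norm.
by rewrite ler_wpM2l// ler_weXn2l ?japanese_ge1// leq_maxr.
Qed.

Lemma slow_growthM u v : slow_growth u -> slow_growth v -> slow_growth (fun x => u x * v x).
Proof.
move=> [C [N uC]] [D [M vD]]; exists (C * D), (N + M)%N => x.
by rewrite normrM exprD mulrACA ler_pM.
Qed.

Lemma slow_growth_bounded u C : (forall x, `|u x| <= C) -> slow_growth u.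
Proof. by move=> uC; exists C, 0%N => x; rewrite expr0 mulr1. Qed.

Lemma rapid_decayD u v : rapid_decay u -> rapid_decay v -> rapid_decay (fun x => u x + v x).
Proof.
move=> du dv N; have [C uC] := du N; have [D vD] := dv N; exists (C + D) => x.
apply: le_trans (lerD (uC x) (vD x)); rewrite -mulrDr ler_wpM2l ?exprn_ge0 ?japanese_ge0//.
exact: ler_normD.
Qed.

Lemma rapid_decayM u v : slow_growth u -> rapid_decay v -> rapid_decay (fun x => u x * v x).
Proof.
move=> [C [M uC]] dv N; have [D vD] := dv (M + N)%N; exists (`|C| * D) => x.
rewrite normrM mulrCA; apply: (@le_trans _ _ ((`|C| * japanese x ^+ M) * (japanese x ^+ N * `|v x|))).
  rewrite ler_wpM2r ?mulr_ge0 ?exprn_ge0 ?japanese_ge0//; apply: (le_trans (uC x)).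
  by rewrite ler_wpM2r ?exprn_ge0 ?japanese_ge0// ler_norm.
by rewrite -mulrA ler_wpM2l// mulrA -exprD.
Qed.

Definition gauss (a : R) (x : V) : R := expR (- (a * dotrV x x)).

Lemma has_grad_gauss a : has_grad (gauss a) (fun i x => - (2 * a) * x ord0 i * gauss a x).
Proof.
have h1 : has_grad (fun x : V => - a * dotrV x x)
      (fun i x => 0 * dotrV x x + - a * (2 * x ord0 i)).
  exact: has_gradM (has_grad_cst (- a)) (@has_grad_sqr R n).
apply: has_grad_eq (has_grad_comp (f := expR) (f' := expR) _ h1).
- by move=> x; rewrite /gauss mulNr.
- by move=> i x; rewrite mul0r add0r mulNr /gauss; ring.
Qed.

(** The smooth functions of polynomial growth that are needed, presented so
    that stability under derivation can be read off. *)
Inductive multiplier : (V -> R) -> Prop :=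
| mult_cst c : multiplier (cst c)
| mult_coord i : multiplier (fun x => x ord0 i)
| mult_japanese t : multiplier (fun x => (1 + dotrV x x) `^ t)
| mult_cos y c : multiplier (fun x => cos (dotrV y x + c))
| mult_gauss a : 0 <= a -> multiplier (gauss a)
| mult_flat m a b i : multiplier (fun x => flat m (a * x ord0 i + b))
| mult_add u v : multiplier u -> multiplier v -> multiplier (fun x => u x + v x)
| mult_mul u v : multiplier u -> multiplier v -> multiplier (fun x => u x * v x).

Lemma multiplier_grad u : multiplier u ->
  exists2 g, has_grad u g & forall i, multiplier (g i).
Proof.
elim=> [c|i|t|y c|a a0|m a b i|{}u v _ [g ug mg] _ [h vh mh]|{}u v mu [g ug mg] mv [h vh mh]].
- exists (fun=> cst 0); [exact: has_grad_cst|move=> ?; exact: mult_cst].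
- exists (fun j => cst (j == i)%:R); [exact: has_grad_coord|move=> ?; exact: mult_cst].
- have h1 : has_grad (fun x : V => 1 + dotrV x x) (fun i x => 0 + 2 * x ord0 i).
    exact: has_gradD (has_grad_cst 1) (@has_grad_sqr R n).
  exists (fun i x => (t * (1 + dotrV x x) `^ (t - 1)) * (0 + 2 * x ord0 i)).
    refine (has_grad_comp (f := fun r : R => r `^ t) (f' := fun r : R => t * r `^ (t - 1)) _ h1) => x.
    by apply: is_derive1_powR; rewrite ltr_pwDl ?dotrV_ge0.
  move=> i; apply: (@mult_mul (fun x => t * _ ) (fun x => 0 + _)).
    by apply: (@mult_mul (cst t)); [exact: mult_cst|exact: mult_japanese].
  apply: (@mult_add (cst 0)); first exact: mult_cst.
  by apply: (@mult_mul (cst 2)); [exact: mult_cst|exact: mult_coord].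
- have h1 : has_grad (fun x => dotrV y x + c) (fun i x => y ord0 i + 0).
    exact: has_gradD (has_grad_dotrV y) (has_grad_cst c).
  exists (fun i x => - sin (dotrV y x + c) * (y ord0 i + 0)).
    by refine (has_grad_comp (f := cos) (f' := fun r : R => - sin r) _ h1) => x; exact: is_derive_cos.
  move=> i; apply: (@mult_mul (fun x => - sin _) (cst _)); last exact: mult_cst.
  rewrite (_ : (fun x => _) = (fun x => cos (dotrV y x + (c + pi / 2)))); first exact: mult_cos.
  by apply/funext => x; rewrite addrA cosDpihalf.
- exists (fun i x => - (2 * a) * x ord0 i * gauss a x); first exact: has_grad_gauss.
  move=> i; apply: mult_mul; last exact: mult_gauss.
  by apply: (@mult_mul (cst _)); [exact: mult_cst|exact: mult_coord].
- have h1 : has_grad (fun x : V => a * x ord0 i + b)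
      (fun j x => 0 * x ord0 i + a * (j == i)%:R + 0).
    exact: has_gradD (has_gradM (has_grad_cst a) (has_grad_coord i)) (has_grad_cst b).
  pose f' t : R := - m%:R * flat m.+1 t + flat m.+2 t.
  exists (fun j x => f' (a * x ord0 i + b) * (0 * x ord0 i + a * (j == i)%:R + 0)).
    by refine (has_grad_comp (f := flat m) (f' := f') _ h1) => x; exact: is_derive_flat.
  move=> j; rewrite (_ : (fun x => _) = (fun x => f' (a * x ord0 i + b) * (a * (j == i)%:R))); last first.
    by apply/funext => x; rewrite mul0r add0r addr0.
  apply: (@mult_mul (fun x => f' _) (cst _)); last exact: mult_cst.
  apply: mult_add; last exact: mult_flat.
  by apply: (@mult_mul (cst _)); [exact: mult_cst|exact: mult_flat].
- by exists (fun i x => g i x + h i x); [exact: has_gradD|move=> i; exact: mult_add].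
- exists (fun i x => g i x * v x + u x * h i x); first exact: has_gradM.
  by move=> i; apply: mult_add; exact: mult_mul.
Qed.

Lemma multiplier_slow u : multiplier u -> slow_growth u.
Proof.
elim=> [c|i|t|y c|a a0|m a b i|{}u v _ su _ sv|{}u v _ su _ sv].
- exact: (@slow_growth_bounded _ `|c|).
- by exists 1, 1%N => x; rewrite mul1r expr1 coord_le_japanese.
- have [N tN] : exists N : nat, 2 * t <= N%:R.
    by exists (Num.trunc (2 * t)).+1; apply/ltW/truncnS_gt.
  exists 1, N => x; rewrite mul1r ger0_norm ?powR_ge0// -japanese_sqr.
  rewrite -powR_mulrn ?japanese_ge0// -powRrM -powR_mulrn ?japanese_ge0//.
  by rewrite ler_powR// japanese_ge1.
- by apply: (@slow_growth_bounded _ 1) => x; rewrite ler_norml cos_geN1 cos_le1.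
- apply: (@slow_growth_bounded _ 1) => x; rewrite ger0_norm ?expR_ge0//.
  by rewrite -expR0 ler_expR oppr_le0 mulr_ge0// dotrV_ge0.
- by apply: (@slow_growth_bounded _ (m%:R ^+ m)) => x; rewrite ger0_norm ?flat_ge0// flat_le.
- exact: slow_growthD.
- exact: slow_growthM.
Qed.

Lemma multiplier_continuous u : multiplier u -> continuous u.
Proof. by move=> /multiplier_grad[g /has_grad_continuous]. Qed.

Lemma rschwartzD u v : rschwartz u -> rschwartz v -> rschwartz (fun x => u x + v x).
Proof.
move=> su sv; apply: (@rschwartz_coind (fun w => exists u v,
  [/\ rschwartz u, rschwartz v & w = (fun x => u x + v x)])); last by exists u, v.
move=> _ [{}u [{}v [{}su {}sv ->]]].
have h := has_gradD (rschwartz_grad su) (rschwartz_grad sv); split.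
- by move=> x; exact: (h x).1.
- by apply: rapid_decayD; exact: rschwartz_decay.
- move=> i; exists (dpart i u), (dpart i v); split; [exact: rschwartz_dpart..|].
  exact: dpart_grad h.
Qed.

(** Derivatives of a product [m x * u x] are sums of such products, so sums have
    to be included in the class given to [rschwartz_coind]. *)
Inductive multiplier_span : (V -> R) -> Prop :=
| span_mul m u : multiplier m -> rschwartz u -> multiplier_span (fun x => m x * u x)
| span_add u v : multiplier_span u -> multiplier_span v -> multiplier_span (fun x => u x + v x).

Lemma rschwartzM m u : multiplier m -> rschwartz u -> rschwartz (fun x => m x * u x).
Proof.
move=> mm su; apply: (@rschwartz_coind multiplier_span); last exact: span_mul.
move=> w {m u mm su}; elim=> [m u mm su|u v _ [d1 r1 p1] _ [d2 r2 p2]].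
  have [g mg gm] := multiplier_grad mm.
  have h := has_gradM mg (rschwartz_grad su); split.
  - by move=> x; exact: (h x).1.
  - by apply: rapid_decayM; [exact: multiplier_slow|exact: rschwartz_decay].
  - move=> i; rewrite (dpart_grad i h); apply: span_add; apply: span_mul => //.
    exact: rschwartz_dpart.
have h := has_gradD (has_grad_dpart d1) (has_grad_dpart d2); split.
- by move=> x; exact: (h x).1.
- exact: rapid_decayD.
- by move=> i; rewrite (dpart_grad i h); apply: span_add.
Qed.

Lemma rschwartzZ c u : rschwartz u -> rschwartz (fun x => c * u x).
Proof. by apply: rschwartzM; exact: (mult_cst c). Qed.

Lemma rschwartzN u : rschwartz u -> rschwartz (fun x => - u x).
Proof.
move=> su; rewrite (_ : (fun x => _) = (fun x => -1 * u x)); first exact: rschwartzZ.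
by apply/funext => x; rewrite mulN1r.
Qed.

Lemma rschwartzB u v : rschwartz u -> rschwartz v -> rschwartz (fun x => u x - v x).
Proof. by move=> su sv; apply: rschwartzD => //; exact: rschwartzN. Qed.

Lemma rschwartz0 : rschwartz (cst 0).
Proof.
apply: (@rschwartz_coind (eq^~ (cst 0))) => // _ ->; split.
- by move=> x; exact: differentiable_cst.
- by move=> N; exists 0 => x; rewrite normr0 mulr0.
- by move=> i; exact: (dpart_grad i (has_grad_cst 0)).
Qed.

(** Bound [1 + |x|^2] by a multiple of [exp (a |x|^2 / (N + 1))] and raise to
    the power [N + 1]. *)
Lemma gauss_decay a : 0 < a -> rapid_decay (gauss a).
Proof.
move=> a0 N; pose c := Num.max 1 (N.+1%:R / a).
have c0 : 0 < c by rewrite lt_max ltr01.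
exists (c ^+ N.+1) => x; rewrite ger0_norm ?expR_ge0// /gauss expRN.
rewrite ler_pdivrMr ?expR_gt0//.
apply: (@le_trans _ _ ((1 + dotrV x x) ^+ N.+1)).
  rewrite -japanese_sqr -exprM; apply: ler_weXn2l; first exact: japanese_ge1.
  by rewrite mul2n -addnn addSn -addnS leq_addr.
have -> : expR (a * dotrV x x) = expR (a * dotrV x x / N.+1%:R) ^+ N.+1.
  by rewrite -expRM_natl [_%:R * _]mulrC divfK// pnatr_eq0.
have d0 := dotrV_ge0 x.
rewrite -exprMn ler_pXn2r ?nnegrE ?mulr_ge0 ?addr_ge0 ?expR_ge0 ?(ltW c0)//.
apply: le_trans (ler_wpM2l (ltW c0) (expR_ge1Dx _)).
rewrite mulrDr mulr1 lerD//; first by rewrite le_max lexx.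
apply: (@le_trans _ _ ((N.+1%:R / a) * (a * dotrV x x / N.+1%:R))).
  have E (k d : R) : k != 0 -> k / a * (a * d / k) = d.
    by move=> k0; field; rewrite k0 gt_eqF.
  by rewrite E// pnatr_eq0.
by rewrite ler_wpM2r ?mulr_ge0 ?invr_ge0 ?(ltW a0)// le_max lexx orbT.
Qed.

Lemma rschwartz_gauss a : 0 < a -> rschwartz (gauss a).
Proof.
move=> a0; have mg : multiplier (gauss a) by apply: mult_gauss; exact: ltW.
apply: (@rschwartz_coind (fun w => exists2 m, multiplier m & w = fun x => m x * gauss a x)).
  move=> _ [m mm ->]; have [g mg' gm] := multiplier_grad mm.
  have h := has_gradM mg' (has_grad_gauss a); split.
  - by move=> x; exact: (h x).1.
  - by apply: rapid_decayM; [exact: multiplier_slow|exact: gauss_decay].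
  - move=> i; rewrite (dpart_grad i h).
    exists (fun x => g i x + m x * (- (2 * a) * x ord0 i)).
      apply: mult_add => //; apply: mult_mul => //.
      by apply: (@mult_mul (cst _)); [exact: mult_cst|exact: mult_coord].
    by apply/funext => x; ring.
exists (cst 1); first exact: mult_cst.
by apply/funext => x; rewrite mul1r.
Qed.

End schwartz_real.

Section complex_schwartz.
Context {R : realType} {n : nat}.
Local Notation V := 'rV[R]_n.
Implicit Types (x y : V) (u v : V -> R) (f : V -> R[i]).

Lemma normc_ge_Re (z : R[i]) : `|Re z| <= normc z.
Proof. by case: z => a b; rewrite /= -sqrtr_sqr ler_wsqrtr// lerDl sqr_ge0. Qed.

Lemma normc_ge_Im (z : R[i]) : `|Im z| <= normc z.
Proof. by case: z => a b; rewrite /= -sqrtr_sqr ler_wsqrtr// lerDr sqr_ge0. Qed.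

Lemma normc_le (z : R[i]) : normc z <= `|Re z| + `|Im z|.
Proof.
case: z => a b; rewrite /= -[leRHS]ger0_norm ?addr_ge0// -sqrtr_sqr ler_wsqrtr//.
by rewrite sqrrD !real_normK ?num_real// addrAC lerDl mulrn_wge0// mulr_ge0.
Qed.

Lemma normc_sqr (z : R[i]) : normc z ^+ 2 = Re z ^+ 2 + Im z ^+ 2.
Proof. by case: z => a b; rewrite /= sqr_sqrtr// addr_ge0 ?sqr_ge0. Qed.

Lemma Re_partials s f : @Re R \o partials s f = rpartials s (@Re R \o f).
Proof. by elim: s => //= i s <-. Qed.

Lemma Im_partials s f : @Im R \o partials s f = rpartials s (@Im R \o f).
Proof. by elim: s => //= i s <-. Qed.

(** A seminorm involves only finitely many sequences of derivatives, so it is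
    finite as soon as each of them is bounded. *)
Lemma schwartz_predP f : f \in schwartz_pred <->
  rschwartz (@Re R \o f) /\ rschwartz (@Im R \o f).
Proof.
rewrite inE; split=> [[sf nf]|[sr si]].
  have H s N : exists C, forall x, japanese x ^+ N * normc (partials s f x) <= C.
    have := nf (maxn N (size s)); set S := schwartz_seminorm _ _ => Sf.
    have S0 : (0 <= S)%E by exact: schwartz_seminorm_ge0.
    exists (fine S) => x; rewrite -lee_fin fineK ?ge0_fin_numE//.
    apply: le_trans (schwartz_seminorm_ub f x (leq_maxr N (size s))).
    by rewrite lee_fin ler_wpM2r ?modulus_ge0// ler_weXn2l ?japanese_ge1// leq_maxl.
  split=> s; split.
  - by move=> x; rewrite -Re_partials; exact: (sf s x).1.
  - move=> N; have [C HC] := H s N; exists C => x; apply: le_trans (HC x).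
    by rewrite ler_wpM2l ?exprn_ge0 ?japanese_ge0// -Re_partials normc_ge_Re.
  - by move=> x; rewrite -Im_partials; exact: (sf s x).2.
  - move=> N; have [C HC] := H s N; exists C => x; apply: le_trans (HC x).
    by rewrite ler_wpM2l ?exprn_ge0 ?japanese_ge0// -Im_partials normc_ge_Im.
split=> [s x|N].
  by split; rewrite ?Re_partials ?Im_partials; [exact: (sr s).1|exact: (si s).1].
have H s : exists C, forall x, japanese x ^+ N * normc (partials s f x) <= C.
  have [C HC] := (sr s).2 N; have [D HD] := (si s).2 N; exists (C + D) => x.
  apply: le_trans (lerD (HC x) (HD x)); rewrite -mulrDr -Re_partials -Im_partials.
  by rewrite ler_wpM2l ?exprn_ge0 ?japanese_ge0// normc_le.
have [C HC] := choice H.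
have C0 s : 0 <= C s.
  by apply: le_trans (HC s 0); rewrite mulr_ge0 ?modulus_ge0// exprn_ge0// japanese_ge0.
apply: (@le_lt_trans _ _ (\sum_(k < N.+1) \sum_(t : k.-tuple 'I_n) C t)%:E); last exact: ltey.
apply: ge_ereal_sup => _ [s [x [sN ->]]]; rewrite lee_fin; apply: (le_trans (HC s x)).
rewrite (bigD1 (Ordinal (sN : (size s < N.+1)%N)))//= (bigD1 (in_tuple s))//=.
rewrite -addrA lerDl addr_ge0 ?sumr_ge0// => k _; rewrite sumr_ge0//.
Qed.

Lemma schwartz_Re (phi : schwartz R n) : rschwartz (@Re R \o phi).
Proof. by case: phi => f /= /schwartz_predP[]. Qed.

Lemma schwartz_Im (phi : schwartz R n) : rschwartz (@Im R \o phi).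
Proof. by case: phi => f /= /schwartz_predP[]. Qed.

Lemma to_schwartzE f : rschwartz (@Re R \o f) -> rschwartz (@Im R \o f) ->
  to_schwartz f = f :> (V -> R[i]).
Proof.
by move=> fr fi; apply: insubdK; apply/schwartz_predP.
Qed.

Lemma rapid_integrable u : measurable_fun setT u -> rapid_decay u ->
  lebesgue_rV.-integrable setT (EFin \o u).
Proof.
move=> mu du; have [C uC] := du n.+1.
have C0 : 0 <= C by apply: le_trans (uC 0); rewrite mulr_ge0 ?exprn_ge0 ?japanese_ge0.
apply: (@le_integrable _ _ _ _ _ _ _ (fun x => (C * japanese x `^ (- n.+1%:R))%:E)) => //.
- exact/measurable_EFinP.
- move=> x _ /=; rewrite lee_fin [leRHS]ger0_norm ?mulr_ge0 ?powR_ge0//.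
  by rewrite powRN powR_mulrn ?japanese_ge0// ler_pdivlMr ?exprn_gt0 ?japanese_gt0// mulrC.
under eq_fun do rewrite EFinM.
apply: integrableZl => //; apply/integrableP; split.
  by apply/measurable_EFinP; exact: measurable_japanese_powR.
under eq_integral do rewrite gee0_abs ?lee_fin ?powR_ge0//.
by apply: integral_japanese_lty; rewrite ltr_nat.
Qed.

End complex_schwartz.

(** * The Fourier transform preserves the Schwartz space *)

Section real_integrable.
Context d {T : measurableType d} {R : realType} (mu : {measure set T -> \bar R}).
Implicit Types u v : T -> R.

Definition lint u := mu.-integrable setT (EFin \o u).

Lemma lint_measurable u : lint u -> measurable_fun setT u.
Proof. by move=> /measurable_int/measurable_EFinP. Qed.

Lemma lintD u v : lint u -> lint v -> lint (fun x => u x + v x).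
Proof.
by move=> iu iv; apply: eq_integrable (integrableD _ iu iv) => // x _ /=; rewrite EFinD.
Qed.

Lemma lintZ c u : lint u -> lint (fun x => c * u x).
Proof.
by move=> iu; apply: eq_integrable (integrableZl _ c iu) => // x _ /=; rewrite EFinM.
Qed.

Lemma lintB u v : lint u -> lint v -> lint (fun x => u x - v x).
Proof.
by move=> iu iv; apply: eq_integrable (integrableB _ iu iv) => // x _ /=; rewrite EFinB.
Qed.

Lemma lint_le u v : measurable_fun setT u -> (forall x, `|u x| <= v x) -> lint v -> lint u.
Proof.
move=> mu' uv iv; apply: (le_integrable _ _ _ iv) => //; first exact/measurable_EFinP.
by move=> x _; rewrite /= lee_fin (le_trans (uv x))// ler_norm.
Qed.

Lemma lint_norm u : lint u -> lint (fun x => `|u x|).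
Proof. by move=> iu; exact: (integrable_norm iu). Qed.

Lemma lintM C u v : measurable_fun setT u -> (forall x, `|u x| <= C) -> lint v ->
  lint (fun x => u x * v x).
Proof.
move=> mu' uC iv; apply: (@lint_le _ (fun x => C * `|v x|)).
- by apply: measurable_funM => //; exact: lint_measurable.
- by move=> x; rewrite normrM ler_wpM2r.
- by apply: lintZ; exact: lint_norm.
Qed.

Lemma le_norm_lint u v : lint u -> lint v -> (forall x, `|u x| <= v x) ->
  `|\int[mu]_x u x| <= \int[mu]_x v x.
Proof.
move=> iu iv uv; apply: (le_trans (le_normr_Rintegral _ _)) => //.
by apply: le_Rintegral => //; exact: lint_norm.
Qed.

Lemma rintZ c u : lint u -> \int[mu]_x (c * u x) = c * \int[mu]_x u x.
Proof. by move=> iu; exact: RintegralZl. Qed.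

Lemma rintD u v : lint u -> lint v ->
  \int[mu]_x (u x + v x) = \int[mu]_x u x + \int[mu]_x v x.
Proof. by move=> iu iv; exact: RintegralD. Qed.

Lemma rintB u v : lint u -> lint v ->
  \int[mu]_x (u x - v x) = \int[mu]_x u x - \int[mu]_x v x.
Proof. by move=> iu iv; exact: RintegralB. Qed.

Lemma lint0 : lint (fun=> 0).
Proof. exact: integrable0. Qed.

Lemma lint_sum I (s : seq I) (f : I -> T -> R) : (forall i, lint (f i)) ->
  lint (fun x => \sum_(i <- s) f i x) /\
  \int[mu]_x (\sum_(i <- s) f i x) = \sum_(i <- s) \int[mu]_x f i x.
Proof.
move=> fi; elim: s => [|i s [IH1 IH2]].
  rewrite (_ : (fun _ => _) = (fun=> 0)); last by apply/funext => x; rewrite big_nil.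
  by rewrite big_nil; split; [exact: lint0|rewrite /Rintegral integral0].
rewrite (_ : (fun _ => _) = (fun x => f i x + \sum_(i <- s) f i x)); last first.
  by apply/funext => x; rewrite big_cons.
by split; [exact: lintD|rewrite big_cons -IH2; by apply: (RintegralD measurableT (fi i) IH1)].
Qed.

Lemma lint_EFin u : lint u -> (\int[mu]_x (u x)%:E = (\int[mu]_x u x)%:E)%E.
Proof. by move=> iu; rewrite /Rintegral fineK//; exact: integrable_fin_num. Qed.

End real_integrable.

Section real_inequalities.
Context {R : realType}.

Lemma mvt_abs (f f' : R -> R) (a b : R) : (forall x : R, is_derive x (1 : R) f (f' x)) ->
  exists2 c, `|c - a| <= `|b - a| & f b - f a = f' c * (b - a).
Proof.
move=> df; have cf : continuous f.
  by move=> x; apply: differentiable_continuous; apply/derivable1_diffP; have [] := df x.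
have [ab|ba|->] := ltgtP a b; last by exists b; rewrite // !subrr mulr0.
- have [|c] := MVT ab (fun x _ => df x).
    by apply: continuous_subspaceT => x; exact: cf.
  rewrite in_itv/= => /andP[ac cb] ->; exists c => //.
  by rewrite !ger0_norm ?subr_ge0 ?(ltW ab) ?(ltW ac)// lerB// ltW.
- have [|c] := MVT ba (fun x _ => df x).
    by apply: continuous_subspaceT => x; exact: cf.
  rewrite in_itv/= => /andP[bc ca] E; exists c.
    by rewrite !ler0_norm ?subr_le0 ?(ltW ba) ?(ltW ca)// lerN2 lerB// ltW.
  by rewrite -opprB E; ring.
Qed.

Lemma eq_linear_rate (X Y K : R) :
  (forall delta : R, 0 < delta -> delta <= 1 -> `|X - Y| <= K * delta) -> X = Y.
Proof.
move=> H; apply/eqP; rewrite -subr_eq0 -normr_le0; apply/ler_addgt0Pl => e e0; rewrite addr0.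
have K0 : 0 < `|K| + 1 by rewrite ltr_wpDl.
apply: (le_trans (H (Num.min 1 (e / (`|K| + 1))) _ _)).
- by rewrite lt_min ltr01 divr_gt0.
- by rewrite ge_min lexx.
apply: (@le_trans _ _ (`|K| * (e / (`|K| + 1)))).
  apply: (@le_trans _ _ (`|K| * Num.min 1 (e / (`|K| + 1)))).
    by rewrite ler_wpM2r ?ler_norm// le_min ler01 divr_ge0 ?(ltW e0) ?(ltW K0).
  by rewrite ler_wpM2l// ge_min lexx orbT.
by rewrite mulrA ler_pdivrMr// mulrC ler_wpM2l ?(ltW e0)// lerDl.
Qed.

Lemma norm_sin_le (x : R) : `|sin x| <= `|x|.
Proof.
have [c _] := @mvt_abs sin cos 0 x (@is_derive_sin R).
rewrite sin0 !subr0 => ->; rewrite normrM -[leRHS]mul1r ler_wpM2r//.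
by rewrite ler_norml cos_geN1 cos_le1.
Qed.

(** Only the order of the remainder matters; the constant is not optimal. *)
Lemma cos_taylor (a b : R) : `|cos (a + b) - cos a + sin a * b| <= 2 * b ^+ 2.
Proof.
have h1 (x : R) : `|cos x - 1| <= `|x| * `|x|.
  have [c] := @mvt_abs cos (fun x => - sin x) 0 x (@is_derive_cos R).
  rewrite cos0 !subr0 => cx ->; rewrite normrM normrN ler_wpM2r//.
  exact: le_trans (norm_sin_le c) cx.
have h1' (x : R) : `|cos x - 1| <= `|x|.
  have [c] := @mvt_abs cos (fun x => - sin x) 0 x (@is_derive_cos R).
  rewrite cos0 !subr0 => cx ->; rewrite normrM normrN -[leRHS]mul1r ler_wpM2r//.
  by rewrite ler_norml sin_geN1 sin_le1.
have h2 (x : R) : `|sin x - x| <= `|x| * `|x|.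
  have [c] := @mvt_abs (fun x => sin x - x) (fun x => cos x - 1) 0 x _.
  rewrite sin0 !subr0 => cx ->; rewrite normrM ler_wpM2r//.
  exact: le_trans (h1' c) cx.
rewrite cosD [X in `|X|](_ : _ = cos a * (cos b - 1) - sin a * (sin b - b)); last by ring.
apply: (le_trans (ler_normB _ _)); rewrite !normrM mulr2n mulrDl !mul1r.
rewrite -real_normK ?num_real// expr2; apply: lerD.
  by apply: le_trans (h1 b); rewrite -[leRHS]mul1r ler_wpM2r// ler_norml cos_geN1 cos_le1.
by apply: le_trans (h2 b); rewrite -[leRHS]mul1r ler_wpM2r// ler_norml sin_geN1 sin_le1.
Qed.

(** Cauchy-Schwarz, from the square of [|y|^2 x - (x . y) y]. *)
Lemma dotrV_sqr_le n (x y : 'rV[R]_n) : dotrV x y ^+ 2 <= dotrV x x * dotrV y y.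
Proof.
have [y0|y0] := eqVneq (dotrV y y) 0.
  suff -> : y = 0 by rewrite -(subrr y) !dotrVBr !subrr expr0n mulr0.
  apply/rowP => i; rewrite mxE; move: y0; rewrite /dotrV.
  move/eqP; rewrite psumr_eq0; last by move=> j _; rewrite -expr2 sqr_ge0.
  by move=> /allP/(_ i (mem_index_enum _)); rewrite -expr2 sqrf_eq0 => /eqP.
have yy : 0 < dotrV y y by rewrite lt_neqAle eq_sym y0 dotrV_ge0.
pose z := dotrV y y *: x - dotrV x y *: y.
have zE w : dotrV z w = dotrV y y * dotrV x w - dotrV x y * dotrV y w.
  by rewrite dotrVC dotrVBr !dotrVZr [dotrV w x]dotrVC [dotrV w y]dotrVC.
have := dotrV_ge0 z; rewrite zE [dotrV x z]dotrVC [dotrV y z]dotrVC !zE [dotrV y x]dotrVC => h.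
rewrite -(ler_pM2l yy) -subr_ge0 (le_trans h)// le_eqVlt; apply/orP; left; apply/eqP.
ring.
Qed.

End real_inequalities.

Section cos_transform.
Context {R : realType} {n : nat}.
Local Notation V := 'rV[R]_n.
Local Notation mu := (@lebesgue_rV R n).
Implicit Types (x y xi : V) (u v w : V -> R) (i : 'I_n).

(** The real and imaginary parts of the Fourier transform are combinations of
    this family; keeping the phase as a parameter makes the family stable
    under derivation. *)
Definition ctrans (c : R) u xi : R := \int[mu]_x (cos (dotrV xi x + c) * u x).

Lemma norm_cos_le1 (t : R) : `|cos t| <= 1.
Proof. by rewrite ler_norml cos_geN1 cos_le1. Qed.

Lemma measurable_cos_dot xi c : measurable_fun setT (fun x => cos (dotrV xi x + c)).
Proof. by apply: continuous_measurable_rV; apply: multiplier_continuous; exact: mult_cos. Qed.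

Lemma ctrans_lint c u xi : lint mu u -> lint mu (fun x => cos (dotrV xi x + c) * u x).
Proof. by apply: lintM; [exact: measurable_cos_dot|move=> x; exact: norm_cos_le1]. Qed.

Lemma ctrans_bounded c u xi : lint mu u -> `|ctrans c u xi| <= \int[mu]_x `|u x|.
Proof.
move=> iu; apply: le_norm_lint; [exact: ctrans_lint|exact: lint_norm|].
by move=> x; rewrite normrM -[leRHS]mul1r ler_wpM2r// norm_cos_le1.
Qed.

Lemma rschwartz_lint u : rschwartz u -> lint mu u.
Proof.
by move=> su; apply: rapid_integrable; [exact: rschwartz_measurable|exact: rschwartz_decay].
Qed.

Lemma rschwartz_coord i u : rschwartz u -> rschwartz (fun x => x ord0 i * u x).
Proof. by apply: rschwartzM; exact: mult_coord. Qed.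

(** By Taylor's formula for the cosine, the remainder of the integrand is at most
    [|h|^2] times [2 (1 + |x|^2) |u x|], which is integrable. *)
Lemma has_grad_ctrans c u : rschwartz u ->
  has_grad (ctrans c u) (fun i => ctrans (c + pi / 2) (fun x => x ord0 i * u x)).
Proof.
move=> su xi.
pose g : V := \row_i ctrans (c + pi / 2) (fun x => x ord0 i * u x) xi.
have iu := rschwartz_lint su.
have ij : lint mu (fun x => (1 + dotrV x x) `^ 1 * u x).
  by apply/rschwartz_lint/rschwartzM => //; exact: mult_japanese.
pose w := fun x => 2 * ((1 + dotrV x x) * `|u x|).
have iw : lint mu w.
  rewrite (_ : w = fun x => 2 * `|(1 + dotrV x x) `^ 1 * u x|).
    by apply: lintZ; exact: lint_norm.
  apply/funext => x; rewrite normrM powRr1 ?addr_ge0 ?dotrV_ge0//.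
  by rewrite [`|1 + _|]ger0_norm// addr_ge0// dotrV_ge0.
have [|dc Dc] := @quadratic_diff R n (ctrans c u) xi g (\int[mu]_x w x); last first.
  by split=> // i; rewrite Dc mxE.
move=> h.
have gE : lint mu (fun x => - sin (dotrV xi x + c) * dotrV h x * u x) /\
    \int[mu]_x (- sin (dotrV xi x + c) * dotrV h x * u x) = dotrV g h.
  have H i : lint mu (fun x => h ord0 i * (cos (dotrV xi x + (c + pi / 2)) * (x ord0 i * u x))).
    by apply/lintZ/ctrans_lint/rschwartz_lint/rschwartz_coord.
  have [H1 H2] := lint_sum (index_enum 'I_n) H.
  rewrite (_ : (fun x => _) = (fun x => \sum_i
    (h ord0 i * (cos (dotrV xi x + (c + pi / 2)) * (x ord0 i * u x))))); last first.
    apply/funext => x; rewrite addrA cosDpihalf /dotrV mulr_sumr mulr_suml.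
    by apply: eq_bigr => i _; ring.
  split=> //; rewrite H2; apply: eq_bigr => i _.
  rewrite [g _ _]mxE [RHS]mulrC /ctrans -rintZ//.
  by apply: ctrans_lint; apply: rschwartz_lint; exact: rschwartz_coord.
have [gi <-] := gE.
rewrite /ctrans -rintB; [|exact: ctrans_lint..].
rewrite -rintB//; last by apply: lintB; exact: ctrans_lint.
rewrite mulrC -rintZ//; apply: le_norm_lint => //.
- by apply: lintB => //; apply: lintB; exact: ctrans_lint.
- exact: lintZ.
move=> x; set a := dotrV xi x + c.
rewrite (_ : dotrV (xi + h) x + c = a + dotrV h x); last first.
  by rewrite /a ![dotrV _ x]dotrVC dotrVDr; ring.
rewrite [X in `|X|](_ : _ = (cos (a + dotrV h x) - cos a + sin a * dotrV h x) * u x); last by ring.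
rewrite normrM /w !mulrA ler_wpM2r//; apply: (le_trans (cos_taylor _ _)).
rewrite [_ * 2]mulrC -mulrA ler_wpM2l//; apply: (le_trans (dotrV_sqr_le _ _)).
by rewrite ler_wpM2l ?dotrV_ge0// lerDr.
Qed.

Lemma lint_shift w x0 : lint mu w -> lint mu (fun x => w (x + x0)) /\
  \int[mu]_x w (x + x0) = \int[mu]_x w x.
Proof.
move=> iw; have mw := lint_measurable iw; split; last first.
  by congr fine; apply: (integral_shift _ (f := EFin \o w)); exact/measurable_EFinP.
apply/integrableP; split.
  by apply/measurable_EFinP; apply: (measurableT_comp mw); exact: measurable_rV_shift.
rewrite (integral_shift _ (f := fun x => `|(w x)%:E|%E)); last first.
  by apply: measurableT_comp => //; exact/measurable_EFinP.
by have /integrableP[] := iw.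
Qed.

Lemma is_derive_line (v : V -> R) x e (t : R) : differentiable v (x + t *: e) ->
  is_derive t (1 : R) (fun t => v (x + t *: e)) ('D_e v (x + t *: e)).
Proof.
move=> /(@diff_derivable _ _ _ _ _ e) dv.
have E : (fun h : R => h^-1 *: (((fun t => v (x + t *: e)) \o shift t) (h *: (1 : R)) -
    v (x + t *: e))) =
    (fun h : R => h^-1 *: ((v \o shift (x + t *: e)) (h *: e) - v (x + t *: e))).
  apply/funext => h /=; congr (_ *: (v _ - _)).
  by rewrite /GRing.scale/= mulr1 -/(GRing.scale _ _) scalerDl addrCA.
by apply: DeriveDef; rewrite /derivable /derive E.
Qed.

(** The integral of a partial derivative vanishes because translations
    preserve Lebesgue measure: the integral of [w (x + h e_i) - w x] is zero, and
    divided by [h] it is [O(h)]-close to the integral of the derivative. *)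
Lemma integral_dpart w i : rschwartz w -> \int[mu]_x (dpart i w x) = 0.
Proof.
move=> sw; pose e : V := delta_mx ord0 i.
have s1 := rschwartz_dpart i sw; have s2 := rschwartz_dpart i s1.
have line (v : V -> R) : rschwartz v -> forall x (t : R),
    is_derive t (1 : R) (fun t => v (x + t *: e)) (dpart i v (x + t *: e)).
  by move=> sv x t; apply: is_derive_line; exact: rschwartz_diff.
have [C HC] := rschwartz_decay s2 n.+1.
pose w2 (x : V) := 2 ^+ n.+1 * C * japanese x `^ (- n.+1%:R).
have iw2 : lint mu w2.
  apply: lintZ; apply/integrableP; split.
    by apply/measurable_EFinP; exact: measurable_japanese_powR.
  under eq_integral do rewrite /= ger0_norm ?powR_ge0//.
  by apply: integral_japanese_lty; rewrite ltr_nat.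
have peetre x (t : R) : `|t| <= 1 -> japanese x <= 2 * japanese (x + t *: e).
  move=> t1; set y := x + t *: e.
  have -> : x = y - t *: e by rewrite /y addrK.
  have ee : dotrV e e = 1 by rewrite dotrV_delta mxE !eqxx.
  have yi := dotrV_sqr_le y e; rewrite ee mulr1 in yi.
  rewrite -(@ler_pXn2r _ 2)// ?nnegrE ?mulr_ge0 ?japanese_ge0// exprMn !japanese_sqr.
  have -> : dotrV (y - t *: e) (y - t *: e) = dotrV y y - 2 * t * dotrV y e + t ^+ 2.
    rewrite dotrVBr dotrVZr [dotrV (_ - _) y]dotrVC [dotrV (_ - _) e]dotrVC !dotrVBr !dotrVZr ee.
    by rewrite [dotrV e y]dotrVC; ring.
  have t2 : t ^+ 2 <= 1 by rewrite -real_normK ?num_real// expr_le1.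
  have := sqr_ge0 (dotrV y e + t); have := dotrV_ge0 y; rewrite sqrrD => h1 h2.
  by nra.
have taylor x (h : R) : `|h| <= 1 ->
    `|w (x + h *: e) - w x - h * dpart i w x| <= h ^+ 2 * w2 x.
  move=> h1.
  have [c ch] := mvt_abs 0 h (line w sw x); rewrite scale0r addr0 subr0 => ->.
  have [c' c'c] := mvt_abs 0 c (line _ s1 x).
  rewrite scale0r addr0 !subr0 in ch c'c *.
  move=> E; rewrite [X in `|X|](_ : _ = h * (dpart i w (x + c *: e) - dpart i w x)); last by ring.
  rewrite E !normrM.
  have c'1 : `|c'| <= 1 by rewrite (le_trans c'c)// (le_trans ch).
  rewrite mulrCA [leRHS]mulrC -real_normK ?num_real// expr2; apply: ler_pM => //.
  - rewrite /w2 powRN powR_mulrn ?japanese_ge0// ler_pdivlMr ?exprn_gt0 ?japanese_gt0//.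
    apply: (@le_trans _ _ (2 ^+ n.+1 * (japanese (x + c' *: e) ^+ n.+1 *
        `|dpart i (dpart i w) (x + c' *: e)|))); last by rewrite ler_wpM2l ?exprn_ge0.
    rewrite mulrA mulrC ler_wpM2r// -exprMn ler_pXn2r ?nnegrE ?mulr_ge0 ?japanese_ge0//.
    exact: peetre.
  - by rewrite ler_wpM2l.
have iw : lint mu w by exact: rschwartz_lint.
have id : lint mu (dpart i w) by exact: rschwartz_lint.
have shiftE (h : R) := lint_shift (h *: e) iw.
pose K := \int[mu]_x w2 x.
have key (h : R) : 0 < h -> h <= 1 -> `|\int[mu]_x dpart i w x| <= h * K.
  move=> h0 h1; rewrite -(ler_pM2l h0) mulrA -expr2 -{1}(ger0_norm (ltW h0)) -normrM -rintZ//.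
  rewrite -rintZ// -normrN (_ : - _ = \int[mu]_x (w (x + h *: e) - w x - h * dpart i w x)).
    apply: le_norm_lint.
    - by apply: lintB; [apply: lintB => //; exact: (shiftE h).1|exact: lintZ].
    - exact: lintZ.
    - by move=> x; apply: taylor; rewrite ger0_norm// ltW.
  rewrite rintB; [|by apply: lintB => //; exact: (shiftE h).1|exact: lintZ].
  by rewrite rintB//; [rewrite (shiftE h).2 subrr sub0r|exact: (shiftE h).1].
by apply: (@eq_linear_rate _ _ _ K) => h h0 h1; rewrite subr0 mulrC; exact: key.
Qed.

(** Integration by parts: the derivative of the product of [u] and a cosine has
    integral zero. *)
Lemma ctrans_dpart c u i xi : rschwartz u ->
  xi ord0 i * ctrans c u xi = - ctrans (c - pi / 2) (dpart i u) xi.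
Proof.
move=> su; have sd := rschwartz_dpart i su.
have [g mg gm] := multiplier_grad (mult_cos xi (c - pi / 2)).
have gE : g i = fun x => xi ord0 i * cos (dotrV xi x + c).
  rewrite -(dpart_grad i mg).
  have h1 : has_grad (fun x => dotrV xi x + (c - pi / 2)) (fun i x => xi ord0 i + 0).
    exact: has_gradD (has_grad_dotrV xi) (has_grad_cst _).
  have h2 := has_grad_comp (f := cos) (f' := fun r => - sin r) (fun x => is_derive_cos _) h1.
  rewrite (dpart_grad i h2); apply/funext => x.
  by rewrite addr0 mulrC addrA sinBpihalf opprK.
have := integral_dpart i (rschwartzM (mult_cos xi (c - pi / 2)) su).
rewrite (dpart_grad i (has_gradM mg (rschwartz_grad su))) gE.
have i1 : lint mu (fun x => cos (dotrV xi x + c) * u x) by apply/ctrans_lint/rschwartz_lint.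
rewrite (_ : (fun x => _) = (fun x => xi ord0 i * (cos (dotrV xi x + c) * u x) +
    cos (dotrV xi x + (c - pi / 2)) * dpart i u x)); last first.
  by apply/funext => x; rewrite mulrA.
rewrite rintD; [|exact: lintZ|by apply/ctrans_lint/rschwartz_lint].
by rewrite rintZ// => /eqP; rewrite addr_eq0 => /eqP.
Qed.

Lemma ctrans_pi c u xi : lint mu u -> ctrans (c - pi / 2 - pi / 2) u xi = - ctrans c u xi.
Proof.
move=> iu; rewrite -[RHS]mulN1r /ctrans -rintZ; last exact: ctrans_lint.
by apply: eq_Rintegral => x _; rewrite !addrA cosBpihalf sinBpihalf mulN1r mulNr.
Qed.

(** Multiplying the transform by [1 + |xi|^2] amounts to adding the transforms
    of second derivatives of [u], so induction gives all even powers. *)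
Lemma ctrans_decay c u : rschwartz u -> rapid_decay (ctrans c u).
Proof.
move=> su N.
suff [C HC] : exists C, forall xi, japanese xi ^+ (2 * N) * `|ctrans c u xi| <= C.
  exists C => xi; apply: le_trans (HC xi); rewrite ler_wpM2r//.
  by rewrite ler_weXn2l ?japanese_ge1// leq_pmull.
elim: N u su => [|N IH] u su.
  exists (\int[mu]_x `|u x|) => xi; rewrite expr0 mul1r.
  by apply: ctrans_bounded; exact: rschwartz_lint.
have s2 i := rschwartz_dpart i (rschwartz_dpart i su).
have [C0 H0] := IH u su; have [C HC] := choice (fun i => IH _ (s2 i)).
exists (C0 + \sum_i C i) => xi.
have E : (1 + dotrV xi xi) * `|ctrans c u xi| = `|ctrans c u xi| +
    \sum_i `|ctrans c (dpart i (dpart i u)) xi|.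
  rewrite mulrDl mul1r {1}/dotrV mulr_suml; congr (_ + _); apply: eq_bigr => i _.
  rewrite -[xi ord0 i * _]ger0_norm -?expr2 ?sqr_ge0// -normrM expr2 -mulrA.
  rewrite ctrans_dpart// mulrN ctrans_dpart ?opprK; last exact: rschwartz_dpart.
  by rewrite ctrans_pi ?normrN//; exact: rschwartz_lint.
rewrite mulnS exprD japanese_sqr mulrAC E mulrC mulrDr lerD// mulr_sumr.
exact: ler_sum.
Qed.

Theorem rschwartz_ctrans c u : rschwartz u -> rschwartz (ctrans c u).
Proof.
move=> su; apply: (@rschwartz_coind _ _ (fun w => exists c u, rschwartz u /\ w = ctrans c u)).
  move=> _ [{}c [{}u [{}su ->]]]; have g := has_grad_ctrans c su; split.
  - by move=> x; exact: (g x).1.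
  - exact: ctrans_decay.
  - move=> i; rewrite (dpart_grad i g).
    by exists (c + pi / 2), (fun x => x ord0 i * u x); split=> //; exact: rschwartz_coord.
by exists c, u.
Qed.

End cos_transform.

(** * Gaussians and Fourier inversion *)

Section fubini_ctrans.
Context {R : realType} {n : nat}.
Local Notation V := 'rV[R]_n.
Local Notation mu := (@lebesgue_rV R n).
Implicit Types (x y xi : V) (u v w : V -> R) (i : 'I_n).

Lemma measurable_dot : measurable_fun setT (fun p : V * V => dotrV p.1 p.2).
Proof.
apply: measurable_sum => i; apply: measurable_funM.
  exact: (measurableT_comp (measurable_coord i) measurable_fst).
exact: (measurableT_comp (measurable_coord i) measurable_snd).
Qed.

Lemma integrable_cos_kernel c u w : lint mu u -> lint mu w ->
  (mu \x mu)%E.-integrable setT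
    (fun p : V * V => (cos (dotrV p.1 p.2 + c) * u p.2 * w p.1)%:E).
Proof.
move=> iu iw; have mu' := lint_measurable iu; have mw := lint_measurable iw.
have mF : measurable_fun setT (fun p : V * V => (cos (dotrV p.1 p.2 + c) * u p.2 * w p.1)%:E).
  apply/measurable_EFinP; apply: measurable_funM; last exact: (measurableT_comp mw measurable_fst).
  apply: measurable_funM; last exact: (measurableT_comp mu' measurable_snd).
  apply: (measurableT_comp (f := @cos R)).
    exact: continuous_measurable_fun (@continuous_cos R).
  by apply: measurable_funD => //; exact: measurable_dot.
apply/(integrable12ltyP _ _ mF).
apply: (@le_lt_trans _ _ (\int[mu]_x ((\int[mu]_y `|u y|) * `|w x|)%:E)%E).
  apply: ge0_le_integral => //.
  - by move=> x _; exact: integral_ge0.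
  - have mF' : measurable_fun setT (fun p : V * V =>
        `|(cos (dotrV p.1 p.2 + c) * u p.2 * w p.1)%:E|%E) by exact: measurableT_comp.
    by apply: measurable_fun_fubini_tonelli_F mF' _ => p.
  - by apply/measurable_EFinP; apply: measurable_funM => //; exact: measurableT_comp.
  move=> x _; rewrite EFinM -lint_EFin; last exact: lint_norm.
  rewrite -ge0_integralZr//; last exact/measurable_EFinP/measurableT_comp.
  apply: ge0_le_integral => //.
  - by apply: measurableT_comp => //; exact: (measurableT_comp mF (measurable_pair1 x)).
  - by apply/measurable_EFinP; apply: measurable_funM => //; exact: measurableT_comp.
  move=> y _; rewrite lee_fin !normrM ler_wpM2r// -[leRHS]mul1r ler_wpM2r//.
  exact: norm_cos_le1.
rewrite lint_EFin ?ltey//.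
by apply: lintZ; exact: lint_norm.
Qed.

Lemma lint_kernel_slice c u (b : R) xi : lint mu u ->
  lint mu (fun y => cos (dotrV xi y + c) * u y * b).
Proof.
move=> iu; rewrite (_ : (fun y => _) = (fun y => b * (cos (dotrV xi y + c) * u y))).
  by apply: lintZ; exact: ctrans_lint.
by apply/funext => y; rewrite mulrC.
Qed.

(** Fubini gives measurability once the kernel is integrable in both variables;
    the Gaussian is inserted for that and divided out afterwards. *)
Lemma measurable_ctrans c u : lint mu u -> measurable_fun setT (ctrans c u).
Proof.
move=> iu; have ig : lint mu (gauss 1) by apply: rschwartz_lint; exact: rschwartz_gauss.
have := measurable_fubini_F (integrable_cos_kernel c iu ig).
rewrite /fubini_F /= => m1.
rewrite (_ : ctrans c u = fun xi => (ctrans c u xi * gauss 1 xi) * (gauss (-1) xi)).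
  apply: measurable_funM; last first.
    by apply: continuous_measurable_rV; apply: has_grad_continuous; exact: has_grad_gauss.
  apply/measurable_EFinP; apply: eq_measurable_fun m1 => xi _.
  rewrite lint_EFin; last exact: lint_kernel_slice.
  congr EFin; rewrite mulrC -rintZ; last exact: ctrans_lint.
  by apply: eq_Rintegral => y _; rewrite mulrC.
apply/funext => xi; rewrite -mulrA /gauss -expRD.
by rewrite mul1r mulN1r opprK addNr expR0 mulr1.
Qed.

Lemma ctrans_swap c u w : lint mu u -> lint mu w ->
  \int[mu]_xi (ctrans c u xi * w xi) = \int[mu]_y (u y * ctrans c w y).
Proof.
move=> iu iw; have := Fubini (integrable_cos_kernel c iu iw) => /= H.
apply: EFin_inj; rewrite -lint_EFin; last first.
  by apply: (lintM (measurable_ctrans c iu) (fun x => ctrans_bounded c x iu) iw).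
rewrite -lint_EFin; last first.
  rewrite (_ : (fun y => _) = (fun y => ctrans c w y * u y)).
    by apply: (lintM (measurable_ctrans c iw) (fun x => ctrans_bounded c x iw) iu).
  by apply/funext => y; rewrite mulrC.
transitivity (\int[mu]_x \int[mu]_y (cos (dotrV x y + c) * u y * w x)%:E)%E.
  apply: eq_integral => xi _; rewrite lint_EFin; last exact: lint_kernel_slice.
  congr EFin; rewrite mulrC -rintZ; last exact: ctrans_lint.
  by apply: eq_Rintegral => y _; rewrite mulrC.
rewrite H; apply: eq_integral => y _.
transitivity (\int[mu]_x (u y * (cos (dotrV y x + c) * w x))%:E)%E.
  by apply: eq_integral => x _; rewrite dotrVC; congr EFin; ring.
rewrite lint_EFin; last by apply: lintZ; exact: ctrans_lint.
by rewrite rintZ//; exact: ctrans_lint.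
Qed.

End fubini_ctrans.

Section gaussian.
Context {R : realType} {n : nat}.
Local Notation V := 'rV[R]_n.
Local Notation mu := (@lebesgue_rV R n).
Implicit Types (x y xi : V) (u v w : V -> R) (i : 'I_n).

Definition gauss_mass (a : R) : R := Num.sqrt (pi / a) ^+ n.

Lemma measurable_expR_sqr (a : R) : measurable_fun setT (fun t : R => expR (- (a * t ^+ 2))).
Proof.
apply: measurableT_comp => //; apply: measurableT_comp => //.
by apply: measurable_funM => //; exact: measurable_funX.
Qed.

Lemma integral_expR_sqr (a : R) : 0 < a ->
  (\int[lebesgue_measure]_t (expR (- (a * t ^+ 2)))%:E = (Num.sqrt (pi / a))%:E :> \bar R)%E.
Proof.
move=> a0; pose s := Num.sqrt (2 * a)^-1.
have s2 : s ^+ 2 = (2 * a)^-1 by rewrite sqr_sqrtr// invr_ge0 mulr_ge0// ltW.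
have s0 : s != 0 by rewrite gt_eqF// sqrtr_gt0 invr_gt0 mulr_gt0.
have p0 : 0 < Num.sqrt (pi / a) :> R by rewrite sqrtr_gt0 divr_gt0// pi_gt0.
have := integral_normal_pdf 0 s; rewrite normal_pdfE//.
have pk : normal_peak s = (Num.sqrt (pi / a))^-1.
  by rewrite /normal_peak s2; congr (Num.sqrt _)^-1; field; rewrite gt_eqF.
under eq_integral => t _.
  rewrite pk EFinM (_ : normal_fun 0 s t = expR (- (a * t ^+ 2))); last first.
    by rewrite /normal_fun subr0 s2; congr expR; field; rewrite gt_eqF.
  over.
rewrite ge0_integralZl//; last by apply/measurable_EFinP; exact: measurable_expR_sqr.
set I := (\int[_]_x _)%E => E.
have : ((Num.sqrt (pi / a))%:E * ((Num.sqrt (pi / a))^-1%:E * I) = (Num.sqrt (pi / a))%:E)%E.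
  by rewrite E mule1.
by rewrite muleA -EFinM divff ?gt_eqF// mul1e.
Qed.

Lemma integral_gauss (a : R) : 0 < a -> \int[mu]_x gauss a x = gauss_mass a.
Proof.
move=> a0; rewrite /Rintegral.
have -> : (\int[mu]_x (gauss a x)%:E =
    \int[mu]_x (\prod_i expR (- (a * ((x : V) ord0 i) ^+ 2)))%:E)%E.
  apply: eq_integral => x _; congr EFin; rewrite /gauss /dotrV mulr_sumr -sumrN expR_sum.
  by apply: eq_bigr => i _; rewrite expr2.
rewrite (ge0_integral_prod n (f := fun t => expR (- (a * t ^+ 2))) _ _ (integral_expR_sqr a0))//.
exact: measurable_expR_sqr.
Qed.

Lemma gauss_mass_gt0 (a : R) : 0 < a -> 0 < gauss_mass a.
Proof. by move=> a0; rewrite exprn_gt0// sqrtr_gt0 divr_gt0// pi_gt0. Qed.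

Lemma gauss_massM (a : R) : 0 < a -> gauss_mass a * gauss_mass (4 * a)^-1 = (2 * pi) ^+ n.
Proof.
move=> a0; rewrite -exprMn -sqrtrM ?divr_ge0 ?pi_ge0 ?(ltW a0)//; congr (_ ^+ n).
rewrite [X in Num.sqrt X](_ : _ = (2 * pi) ^+ 2); last by field; rewrite gt_eqF.
by rewrite sqrtr_sqr ger0_norm// mulr_ge0// pi_ge0.
Qed.

Lemma derive_dir u z (e : V) : differentiable u z ->
  'D_e u z = \sum_i e ord0 i * dpart i u z.
Proof.
move=> du; rewrite deriveE// [X in 'd u _ X]row_sum_delta linear_sum.
by apply: eq_bigr => i _; rewrite linearZ/= -deriveE.
Qed.

Lemma has_grad0_cst u x y : has_grad u (fun=> cst 0) -> u x = u y.
Proof.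
move=> u0; pose e := x - y.
have d (t : R) : is_derive t (1 : R) (fun t => u (y + t *: e)) 0.
  have [du Du] := u0 (y + t *: e).
  suff <- : 'D_e u (y + t *: e) = 0 by exact: is_derive_line.
  by rewrite derive_dir// big1// => i _; rewrite [dpart _ _ _]Du mulr0.
have [c _] := mvt_abs 0 1 d; rewrite scale1r scale0r addr0 mul0r => /eqP.
by rewrite subr_eq0 /e addrC subrK => /eqP.
Qed.

(** Both sides satisfy the same first-order system: a derivative of the
    transform is the transform of a coordinate times the Gaussian, which is a
    multiple of a derivative of the Gaussian. *)
Lemma ctrans_gauss c (a : R) xi : 0 < a ->
  ctrans c (gauss a) xi = cos c * gauss_mass a * gauss (4 * a)^-1 xi.
Proof.
move=> a0; have sg := @rschwartz_gauss R n _ a0.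
have ig := rschwartz_lint sg.
pose b := (4 * a)^-1.
pose h (eta : V) := ctrans c (gauss a) eta * gauss (- b) eta.
have E i (eta : V) : ctrans (c + pi / 2) (fun x => x ord0 i * gauss a x) eta =
    - (2 * a)^-1 * (eta ord0 i * ctrans c (gauss a) eta).
  have := ctrans_dpart (c + pi / 2 + pi / 2) i eta sg.
  have -> : ctrans (c + pi / 2 + pi / 2) (gauss a) eta = - ctrans c (gauss a) eta.
    by have := ctrans_pi (c + pi / 2 + pi / 2) eta ig; rewrite !addrK => ->; rewrite opprK.
  rewrite addrK.
  rewrite (dpart_grad i (has_grad_gauss a)) mulrN => /oppr_inj ->.
  rewrite /ctrans -rintZ.
    by apply: eq_Rintegral => x _; field; rewrite gt_eqF.
  apply: ctrans_lint; apply: rschwartz_lint.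
  rewrite (_ : (fun x => _) = fun x => - (2 * a) * (x ord0 i * gauss a x)).
    by apply: rschwartzZ; exact: rschwartz_coord.
  by apply/funext => x; rewrite mulrA.
have gh : has_grad h (fun=> cst 0).
  apply: has_grad_eq (has_gradM (has_grad_ctrans c sg) (has_grad_gauss (- b))) => //.
  by move=> i eta /=; rewrite E /b; field; rewrite gt_eqF.
have := has_grad0_cst xi 0 gh; rewrite /h.
have d0 (x : V) : dotrV 0 x = 0 by apply: big1 => i _; rewrite mxE mul0r.
have -> : ctrans c (gauss a) (0 : V) = cos c * gauss_mass a.
  rewrite -integral_gauss// -rintZ//; apply: eq_Rintegral => x _.
  by rewrite d0 add0r.
have -> : gauss (- b) (0 : V) = 1 by rewrite /gauss d0 mulr0 oppr0 expR0.
rewrite mulr1 => <-; rewrite -mulrA /gauss -expRD -/b.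
by rewrite mulNr opprK subrr expR0 mulr1.
Qed.

End gaussian.

Section inversion.
Context {R : realType} {n : nat}.
Local Notation V := 'rV[R]_n.
Local Notation mu := (@lebesgue_rV R n).
Local Notation mass := (@gauss_mass R n).
Implicit Types (x y xi : V) (u v w : V -> R) (i : 'I_n).

Lemma rschwartz_bounded u : rschwartz u -> exists2 C : R, 0 <= C & forall x, `|u x| <= C.
Proof.
move=> /rschwartz_decay/(_ 0%N)[C uC]; exists C => [|x]; last by have := uC x; rewrite expr0 mul1r.
by apply: le_trans (uC 0); rewrite mulr_ge0 ?exprn_ge0 ?japanese_ge0.
Qed.

Lemma rschwartz_lipschitz u : rschwartz u ->
  exists2 L : R, 0 <= L & forall x y, `|u y - u x| <= L * Num.sqrt (dotrV (y - x) (y - x)).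
Proof.
move=> su; have [|C C0] := @choice _ _ (fun i (c : R) => 0 <= c /\ forall x, `|dpart i u x| <= c).
  by move=> i; have [c ? ?] := rschwartz_bounded (rschwartz_dpart i su); exists c.
exists (\sum_i C i); first by apply: sumr_ge0 => i _; exact: (C0 i).1.
move=> x y; pose e := y - x.
have d (t : R) := is_derive_line (e := e) (rschwartz_diff su (x + t *: e)).
have [c _] := mvt_abs 0 1 d.
rewrite scale1r scale0r addr0 subr0 mulr1 (_ : x + e = y) => [->|]; last by rewrite /e addrC subrK.
rewrite -/e.
rewrite derive_dir; last exact: rschwartz_diff.
rewrite mulr_suml; apply: (le_trans (ler_norm_sum _ _ _)); apply: ler_sum => i _.
rewrite normrM mulrC; apply: ler_pM => //; first exact: (C0 i).2.
rewrite -sqrtr_sqr ler_wsqrtr// /dotrV (bigD1 i)//= -expr2 lerDl sumr_ge0// => j _.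
by rewrite -expr2 sqr_ge0.
Qed.

Lemma gaussN (a : R) x : gauss a (- x) = gauss a x.
Proof. by rewrite /gauss dotrVNr dotrVC dotrVNr opprK. Qed.

Lemma lint_gauss (a : R) : 0 < a -> lint mu (gauss a).
Proof. by move=> a0; apply: rschwartz_lint; exact: rschwartz_gauss. Qed.

Lemma gauss_reflect (a : R) x : 0 < a -> lint mu (fun y => gauss a (x - y)) /\
  \int[mu]_y gauss a (x - y) = mass a.
Proof.
move=> a0; rewrite (_ : (fun y => _) = (fun y => gauss a (y - x))); last first.
  by apply/funext => y; rewrite -gaussN opprB.
by rewrite -integral_gauss//; apply: lint_shift; exact: lint_gauss.
Qed.

(** This is [r <= exp (r^2 / 2)] for [r = sqrt b * |x|]. *)
Lemma gauss_moment (b : R) x : 0 < b ->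
  Num.sqrt (dotrV x x) * gauss b x <= (Num.sqrt b)^-1 * gauss (b / 2) x.
Proof.
move=> b0; have sb : 0 < Num.sqrt b by rewrite sqrtr_gt0.
rewrite -ler_pdivrMl ?invr_gt0// invrK mulrA -sqrtrM ?(ltW b0)//.
set s := Num.sqrt _; have s2 : s ^+ 2 = b * dotrV x x.
  by rewrite sqr_sqrtr// mulr_ge0 ?(ltW b0)// dotrV_ge0.
rewrite /gauss -s2.
have -> : - (b / 2 * dotrV x x) = s ^+ 2 / 2 + - s ^+ 2 by rewrite s2; field.
rewrite expRD ler_wpM2r ?expR_ge0//; apply: le_trans (expR_ge1Dx _).
have := sqr_ge0 (s - 1); rewrite sqrrB1 => h; lra.
Qed.

(** Gaussians of width [delta] are an approximate identity. Schwartz functions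
    are Lipschitz, so the error is a first moment, of order [delta]. *)
Lemma gauss_approx u x : rschwartz u -> exists K, forall delta : R, 0 < delta ->
  `|mass (delta ^+ 2) * \int[mu]_y (u y * gauss (4 * delta ^+ 2)^-1 (x - y)) -
    (2 * pi) ^+ n * u x| <= K * delta.
Proof.
move=> su; have [L L0 uL] := rschwartz_lipschitz su.
exists (L * 2 * (2 * pi) ^+ n * Num.sqrt 2 ^+ n) => delta d0.
set a := delta ^+ 2; have a0 : 0 < a by rewrite exprn_gt0.
set b := (4 * a)^-1; have b0 : 0 < b by rewrite invr_gt0 mulr_gt0.
have b20 : 0 < b / 2 by rewrite divr_gt0.
have [ib Eb] := gauss_reflect x b0; have [ib2 Eb2] := gauss_reflect x b20.
have iu : lint mu (fun y => u y * gauss b (x - y)).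
  have [C C0 uC] := rschwartz_bounded su.
  exact: (lintM (rschwartz_measurable su) uC ib).
rewrite [X in `|X|](_ : _ = mass a *
    \int[mu]_y (u y * gauss b (x - y) - u x * gauss b (x - y))); last first.
  rewrite rintB//; last exact: lintZ.
  by rewrite rintZ// Eb -(gauss_massM (n := n) a0) -/b; ring.
rewrite normrM ger0_norm; last by rewrite ltW// (gauss_mass_gt0 a0).
have -> : L * 2 * (2 * pi) ^+ n * Num.sqrt 2 ^+ n * delta =
    mass a * (L * (Num.sqrt b)^-1 * mass (b / 2)).
  rewrite -(gauss_massM (n := n) a0) -/b.
  have -> : (Num.sqrt b)^-1 = 2 * delta.
    rewrite /b sqrtrV ?invrK//; last by rewrite mulr_ge0// ltW.
    rewrite (_ : 4 * a = (2 * delta) ^+ 2); last by rewrite /a; ring.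
    by rewrite sqrtr_sqr ger0_norm// mulr_ge0// ltW.
  have -> : mass (b / 2) = mass b * Num.sqrt 2 ^+ n.
    by rewrite -exprMn -sqrtrM ?divr_ge0 ?pi_ge0 ?(ltW b0)//; congr (Num.sqrt _ ^+ _); field; rewrite gt_eqF.
  ring.
rewrite ler_wpM2l ?(ltW (gauss_mass_gt0 (n := n) a0))// -Eb2 -rintZ//; apply: le_norm_lint.
- by apply: lintB => //; exact: lintZ.
- exact: lintZ.
move=> y; rewrite -mulrBl normrM [`|gauss _ _|]ger0_norm ?expR_ge0// -mulrA.
apply: (@le_trans _ _ (L * (Num.sqrt (dotrV (y - x) (y - x)) * gauss b (x - y)))).
  by rewrite mulrA ler_wpM2r ?expR_ge0// uL.
by rewrite ler_wpM2l// -[gauss b _]gaussN -[gauss (b / 2) _]gaussN opprB gauss_moment.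
Qed.

(** Fourier inversion for the phase-shifted transforms, by Gaussian
    regularisation of the outer integral. *)
Theorem ctrans_inversion c d u x : rschwartz u ->
  ctrans c (ctrans d u) x =
  (2 * pi) ^+ n / 2 * (cos (c + d) * u (- x) + cos (c - d) * u x).
Proof.
move=> su; have sd := rschwartz_ctrans d su; have iu := rschwartz_lint su.
have id := rschwartz_lint sd.
have [K1 HK1] := gauss_approx (- x) su; have [K2 HK2] := gauss_approx x su.
have ij : lint mu (fun xi => dotrV xi xi * `|ctrans d u xi|).
  apply: (@lint_le _ _ _ _ _ (fun xi => `|(1 + dotrV xi xi) `^ 1 * ctrans d u xi|)).
  - apply: measurable_funM; last by apply: measurableT_comp => //; exact: rschwartz_measurable.
    by apply: continuous_measurable_rV; exact: has_grad_continuous (@has_grad_sqr R n).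
  - move=> xi; rewrite !normrM normr_id ler_wpM2r// powRr1 ?addr_ge0 ?dotrV_ge0//.
    by rewrite !ger0_norm ?addr_ge0 ?dotrV_ge0// lerDr.
  - by apply: lint_norm; apply/rschwartz_lint/rschwartzM => //; exact: mult_japanese.
pose K3 := \int[mu]_xi (dotrV xi xi * `|ctrans d u xi|).
have K30 : 0 <= K3 by apply: Rintegral_ge0 => xi _; rewrite mulr_ge0// dotrV_ge0.
have P0 : 0 <= (2 * pi) ^+ n :> R by rewrite exprn_ge0// mulr_ge0// pi_ge0.
apply: (@eq_linear_rate _ _ _ (K3 + (`|K1| + `|K2|))) => delta d0 d1.
set a := delta ^+ 2; have a0 : 0 < a by rewrite exprn_gt0.
pose w xi := cos (dotrV x xi + c) * gauss a xi.
have ig := lint_gauss a0.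
have iw : lint mu w by exact: ctrans_lint.
pose b := (4 * a)^-1; have b0 : 0 < b by rewrite invr_gt0 mulr_gt0.
pose I z := mass a * \int[mu]_y (u y * gauss b (z - y)).
pose A := \int[mu]_xi (ctrans d u xi * w xi).
have iz z : lint mu (fun y => u y * gauss b (z - y)).
  have [C C0 uC] := rschwartz_bounded su.
  exact: (lintM (rschwartz_measurable su) uC (gauss_reflect z b0).1).
have AE : A = (cos (c + d) * I (- x) + cos (c - d) * I x) / 2.
  have E y : u y * ctrans d w y = cos (c + d) * mass a / 2 * (u y * gauss b (- x - y)) +
      cos (c - d) * mass a / 2 * (u y * gauss b (x - y)).
    have -> : ctrans d w y = 2^-1 * (ctrans (c + d) (gauss a) (x + y) + ctrans (c - d) (gauss a) (x - y)).
      rewrite /ctrans -rintD; [|exact: ctrans_lint..].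
      rewrite -rintZ; last by apply: lintD; exact: ctrans_lint.
      apply: eq_Rintegral => xi _; rewrite /w.
      rewrite ![dotrV _ xi]dotrVC dotrVDr dotrVBr.
      set p := dotrV xi x; set q := dotrV xi y.
      rewrite (_ : p + q + (c + d) = (p + c) + (q + d)); last by ring.
      rewrite (_ : p - q + (c - d) = (p + c) - (q + d)); last by ring.
      by set P := p + c; set Q := q + d; rewrite cosB cosD; field.
    by rewrite !ctrans_gauss// -/b -[gauss b (x + y)]gaussN opprD; field.
  rewrite /A ctrans_swap//.
  under eq_Rintegral do rewrite E.
  have e z k : \int[mu]_y (k * mass a / 2 * (u y * gauss b (z - y))) = k * I z / 2.
    by rewrite (rintZ _ (iz z)) /I; move: (\int[mu]_y _) => J; field.
  by rewrite rintD; [rewrite !e mulrDl|exact: lintZ..].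
have h1 : `|ctrans c (ctrans d u) x - A| <= K3 * delta.
  have -> : ctrans c (ctrans d u) x - A = \int[mu]_xi
      (cos (dotrV x xi + c) * (ctrans d u xi * (1 - gauss a xi))).
    rewrite /A /ctrans -rintB.
    - by apply: eq_Rintegral => xi _; rewrite /w; ring.
    - exact: ctrans_lint.
    - exact: (lintM (measurable_ctrans d iu) (fun x => ctrans_bounded d x iu) iw).
  rewrite mulrC -rintZ//.
  have g1 xi : `|1 - gauss a xi| <= delta * dotrV xi xi.
    have := expR_ge1Dx (- (a * dotrV xi xi)); have d2 := dotrV_ge0 xi.
    have g2 : gauss a xi <= 1 by rewrite /gauss -expR0 ler_expR oppr_le0 mulr_ge0// ltW.
    rewrite -/(gauss a xi) ger0_norm ?subr_ge0// => g3.
    apply: (@le_trans _ _ (a * dotrV xi xi)); first by rewrite lerBlDl -lerBlDr.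
    by rewrite ler_wpM2r// /a expr2 ger_pMr.
  apply: le_norm_lint.
  - apply: ctrans_lint; rewrite (_ : (fun _ => _) = (fun xi => (1 - gauss a xi) * ctrans d u xi)).
      apply: (@lintM _ _ _ _ 1) => //.
        by apply: measurable_funB => //; exact: lint_measurable ig.
      move=> xi; rewrite ger0_norm.
        by rewrite gerBl expR_ge0.
      by rewrite subr_ge0 /gauss -expR0 ler_expR oppr_le0 mulr_ge0 ?dotrV_ge0// ltW.
    by apply/funext => xi; rewrite mulrC.
  - exact: lintZ.
  move=> xi; rewrite normrM -[leRHS]mul1r; apply: ler_pM => //; first exact: norm_cos_le1.
  by rewrite normrM mulrC mulrA ler_wpM2r.
have h2 : `|A - (2 * pi) ^+ n / 2 * (cos (c + d) * u (- x) + cos (c - d) * u x)| <=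
    (`|K1| + `|K2|) * delta.
  have HI1 : `|I (- x) - (2 * pi) ^+ n * u (- x)| <= K1 * delta := HK1 _ d0.
  have HI2 : `|I x - (2 * pi) ^+ n * u x| <= K2 * delta := HK2 _ d0.
  rewrite AE; move: HI2 HI1.
  move: (I x) (I (- x)) (cos (c + d)) (cos (c - d)) (norm_cos_le1 (c + d)) (norm_cos_le1 (c - d)).
  move: (u x) (u (- x)) ((2 * pi) ^+ n) => u1 u2 P J1 J2 k1 k2 k11 k21 H1 H2.
  rewrite [X in `|X|](_ : _ = 2^-1 * (k1 * (J2 - P * u2)) + 2^-1 * (k2 * (J1 - P * u1))); last by field.
  apply: (le_trans (ler_normD _ _)); rewrite mulrDl.
  have half (k X K : R) : `|k| <= 1 -> `|X| <= K * delta -> `|2^-1 * (k * X)| <= `|K| * delta.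
    move=> k1' XK; rewrite !normrM; apply: (@le_trans _ _ (1 * (1 * `|X|))).
      apply: ler_pM => //; first by rewrite ger0_norm// invf_le1// ler1n.
      by rewrite ler_wpM2r.
    by rewrite !mul1r (le_trans XK)// ler_wpM2r ?(ltW d0)// ler_norm.
  by apply: lerD; apply: half.
by rewrite [leRHS]mulrDl; apply: le_trans (ler_distD A _ _) (lerD h1 h2).
Qed.

End inversion.

(** * Riesz representation of bounded functionals on subspaces of L^2 *)

Section square_integrable.
Context d {T : measurableType d} {R : realType} (mu : {measure set T -> \bar R}).
Implicit Types u v w : T -> R.
Local Notation lint := (lint mu).

Definition lint2 u := measurable_fun setT u /\ lint (fun x => u x ^+ 2).

Definition nrm2 u : R := \int[mu]_x (u x ^+ 2).

Lemma nrm2_ge0 u : 0 <= nrm2 u.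
Proof. by apply: Rintegral_ge0 => x _; exact: sqr_ge0. Qed.

Lemma lint2M u v : lint2 u -> lint2 v -> lint (fun x => u x * v x).
Proof.
move=> [mu' iu] [mv iv]; apply: (lint_le _ _ (lintD iu iv)); first exact: measurable_funM.
move=> x; rewrite normrM -(real_normK (num_real (u x))) -(real_normK (num_real (v x))).
have := sqr_ge0 (`|u x| - `|v x|); have := mulr_ge0 (normr_ge0 (u x)) (normr_ge0 (v x)).
by move: `|u x| `|v x| => a b; nra.
Qed.

Lemma lint2D u v : lint2 u -> lint2 v -> lint2 (fun x => u x + v x).
Proof.
move=> lu lv; have [mu' iu] := lu; have [mv iv] := lv; split; first exact: measurable_funD.
rewrite (_ : (fun _ => _) = (fun x => u x ^+ 2 + (2 * (u x * v x) + v x ^+ 2))).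
  by apply: lintD => //; apply: lintD => //; apply: lintZ; exact: lint2M.
by apply/funext => x; ring.
Qed.

Lemma lint2Z c u : lint2 u -> lint2 (fun x => c * u x).
Proof.
move=> [mu' iu]; split; first exact: measurable_funM.
by rewrite (_ : (fun _ => _) = (fun x => c ^+ 2 * u x ^+ 2)); [exact: lintZ|apply/funext => x; ring].
Qed.

Lemma lint2B u v : lint2 u -> lint2 v -> lint2 (fun x => u x - v x).
Proof.
move=> lu lv; rewrite (_ : (fun _ => _) = (fun x => u x + -1 * v x)).
  by apply: lint2D => //; exact: lint2Z.
by apply/funext => x; ring.
Qed.

Lemma lint2_le u v : measurable_fun setT u -> (forall x, `|u x| <= `|v x|) -> lint2 v -> lint2 u.
Proof.
move=> mu' uv [mv iv]; split=> //; apply: (lint_le _ _ iv); first exact: measurable_funX.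
by move=> x; rewrite normrX -(real_normK (num_real (v x))) lerXn2r ?nnegrE.
Qed.

Lemma nrm2D u v t : lint2 u -> lint2 v ->
  nrm2 (fun x => u x + t * v x) = nrm2 u + 2 * (\int[mu]_x (u x * v x)) * t + nrm2 v * t ^+ 2.
Proof.
move=> lu lv; have [_ iu] := lu; have [_ iv] := lv.
rewrite {1}/nrm2 (_ : (fun x => _) = (fun x => u x ^+ 2 + (2 * t * (u x * v x) + t ^+ 2 * v x ^+ 2))); last first.
  by apply/funext => x; ring.
have iuv := lint2M lu lv.
rewrite rintD//; last by apply: lintD; exact: lintZ.
by rewrite rintD ?rintZ//; [rewrite /nrm2; ring|exact: lintZ..].
Qed.

(** For positive [c], evaluate at the minimum of the quadratic. *)
Lemma discriminant_le (a b c : R) : 0 <= c ->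
  (forall t, 0 <= a + 2 * b * t + c * t ^+ 2) -> b ^+ 2 <= a * c.
Proof.
move=> c0 H; have [cz|cz] := eqVneq c 0.
  have [->|b0] := eqVneq b 0; first by rewrite cz expr0n mulr0.
  have := H (- (a + 1) / (2 * b)).
  rewrite cz mul0r addr0 (_ : _ * (_ / _) = - (a + 1)); last by field; rewrite b0.
  by rewrite opprD addNKr oppr_ge0 ler10.
have c1 : 0 < c by rewrite lt_neqAle eq_sym cz.
have := H (- b / c); rewrite -(pmulr_rge0 _ c1).
by rewrite [X in 0 <= X](_ : _ = a * c - b ^+ 2) ?subr_ge0//; field; exact: cz.
Qed.

Lemma cauchy_schwarz u v : lint2 u -> lint2 v ->
  (\int[mu]_x (u x * v x)) ^+ 2 <= nrm2 u * nrm2 v.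
Proof.
move=> lu lv; apply: discriminant_le; first exact: nrm2_ge0.
by move=> t; rewrite -nrm2D//; exact: nrm2_ge0.
Qed.

(** With summable [s], sums of squares weighted by [s^-1] control sums of
    absolute values. *)
Lemma le_sqrt_add (x s : R) : 0 < s -> `|x| <= s + s^-1 * x ^+ 2.
Proof.
move=> s0; rewrite -[x ^+ 2](real_normK (num_real x)); have := normr_ge0 x.
move: `|x| => r r0; have [rs|sr] := leP r s.
  by rewrite (le_trans rs)// lerDl mulr_ge0 ?invr_ge0 ?(ltW s0)// sqr_ge0.
apply: (@le_trans _ _ (s^-1 * r ^+ 2)); last by rewrite lerDr ltW.
by rewrite ler_pdivlMl// expr2 ler_wpM2r// ltW.
Qed.

Lemma nneseries_bounded (a : nat -> R) : (forall j, 0 <= a j) ->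
  (\sum_(0 <= j <oo) (a j)%:E < +oo)%E -> exists M, forall N, \sum_(0 <= j < N) a j <= M.
Proof.
move=> a0 aoo; exists (fine (\sum_(0 <= j <oo) (a j)%:E)%E) => N.
rewrite -lee_fin fineK ?ge0_fin_numE//; last by apply: nneseries_ge0 => j _ _; rewrite lee_fin.
by rewrite -sumEFin; apply: nneseries_lim_ge => j _ _; rewrite lee_fin.
Qed.

Lemma sum_geometric2 N : \sum_(0 <= j < N) 2^-1 ^+ j <= 2 :> R.
Proof.
have -> : \sum_(0 <= j < N) 2^-1 ^+ j = 2 - 2 * 2^-1 ^+ N :> R.
  elim: N => [|N IH]; first by rewrite big_nil expr0 mulr1 subrr.
  by rewrite big_nat_recr//= IH exprS; field.
by rewrite gerBl mulr_ge0// exprn_ge0// invr_ge0.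
Qed.

(** The sum has a finite integral, hence is finite almost everywhere. *)
Lemma ae_summable (f : nat -> T -> R) (C : R) : (forall j x, 0 <= f j x) ->
  (forall j, lint (f j)) -> (forall j, \int[mu]_x f j x <= C * 2^-1 ^+ j) ->
  {ae mu, forall x, (\sum_(0 <= j <oo) (f j x)%:E < +oo)%E}.
Proof.
move=> f0 lf fC; have f0' j x : (0 <= (f j x)%:E)%E by rewrite lee_fin.
have mf j : measurable_fun setT (fun x => (f j x)%:E) by exact: measurable_int (lf j).
have F0 x : (0 <= \sum_(0 <= j <oo) (f j x)%:E)%E by apply: nneseries_ge0 => j _ _.
have C0 : 0 <= C.
  by have := fC 0%N; rewrite expr0 mulr1; apply: le_trans; exact: Rintegral_ge0.
have iF : mu.-integrable setT (fun x => \sum_(0 <= j <oo) (f j x)%:E)%E.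
  apply/integrableP; split; first by apply: ge0_emeasurable_sum => // j x _ _.
  under eq_integral do rewrite gee0_abs//.
  rewrite integral_nneseries//.
  apply: (@le_lt_trans _ _ (C * 2)%:E); last exact: ltey.
  apply: lime_le; first by apply: is_cvg_nneseries => j _ _; exact: integral_ge0.
  apply: nearW => N; apply: (@le_trans _ _ (\sum_(0 <= j < N) (C * 2^-1 ^+ j)%:E)%E).
    by apply: lee_sum => j _; rewrite lint_EFin ?lee_fin.
  by rewrite sumEFin lee_fin -mulr_sumr ler_wpM2l// sum_geometric2.
have := integrable_ae measurableT iF; apply: filterS => x /(_ I) Fx.
by rewrite -ge0_fin_numE ?Fx//; exact: (F0 x).
Qed.

Lemma cvg_of_summable (a : nat -> R) :
  (\sum_(0 <= j <oo) (2 ^+ j * (a j.+1 - a j) ^+ 2)%:E < +oo)%E -> cvgn a.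
Proof.
move=> aoo; pose D j := a j.+1 - a j.
have nn j : (0 <= (2 ^+ j * D j ^+ 2)%:E)%E.
  by rewrite lee_fin; apply: mulr_ge0; [exact: exprn_ge0|exact: sqr_ge0].
have [M HM] : exists M, forall N, \sum_(0 <= j < N) 2 ^+ j * D j ^+ 2 <= M.
  by apply: nneseries_bounded => // j; rewrite -lee_fin.
have bd N : \sum_(0 <= j < N) `|D j| <= 2 + M.
  apply: le_trans (lerD (sum_geometric2 N) (HM N)); rewrite -big_split/=; apply: ler_sum => j _.
  have := @le_sqrt_add (D j) (2^-1 ^+ j); rewrite -exprVn invrK; apply.
  by rewrite exprn_gt0// invr_gt0.
have cD : cvgn (series D).
  apply: normed_cvg; apply: nondecreasing_is_cvgn.
    by apply/nondecreasing_seqP => m; rewrite /normed_series_of seriesSr lerDl; exact: normr_ge0.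
  exists (2 + M) => _ [N _ <-]; rewrite /series/=; exact: bd.
have -> : a = (fun N => a 0%N + series D N).
  apply/funext => N; rewrite /series/= telescope_sumr//; by rewrite addrC subrK.
by apply: is_cvgD => //; exact: is_cvg_cst.
Qed.

End square_integrable.

Section riesz.
Context d {T : measurableType d} {R : realType} (mu : {measure set T -> \bar R}).
Implicit Types u v w phi psi : T -> R.
Local Notation lint := (lint mu).
Local Notation lint2 := (lint2 mu).
Local Notation nrm2 := (nrm2 mu).

Lemma limn_einf_le (u : (\bar R)^nat) (c : \bar R) (j : nat) :
  (forall m, (j <= m)%N -> (u m <= c)%E) -> (limn_einf u <= c)%E.
Proof.
move=> uc; rewrite limn_einf_lim; apply: lime_le; first exact: is_cvg_einfs.
exists j => // m /= jm; apply: le_trans (uc m jm).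
by apply: ereal_inf_lbound; exists m => /=.
Qed.

(** A fast Cauchy sequence in L^2 converges almost everywhere, since the sum of
    the squared increments has finite integral, and Fatou's lemma gives the
    convergence in norm. *)
Lemma fast_cauchy_cvg (phi : nat -> T -> R) (B : R) : 0 <= B ->
  (forall j, lint2 (phi j)) ->
  (forall i j, nrm2 (fun x => phi i x - phi j x) <= B * (4^-1 ^+ i + 4^-1 ^+ j)) ->
  exists2 k : T -> R, measurable_fun setT k &
    forall j, lint2 (fun x => k x - phi j x) /\
      nrm2 (fun x => k x - phi j x) <= 2 * B * 4^-1 ^+ j.
Proof.
move=> B0 lphi Hphi.
have q0 : 0 < 4^-1 :> R by rewrite invr_gt0.
have mphi j : measurable_fun setT (phi j) := (lphi j).1.
have aeF : {ae mu, forall x, cvgn (phi ^~ x)}.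
  have lD j : lint (fun x => (phi j.+1 x - phi j x) ^+ 2) := (lint2B (lphi _) (lphi _)).2.
  have := @ae_summable _ _ _ mu (fun j x => 2 ^+ j * (phi j.+1 x - phi j x) ^+ 2) (2 * B).
  move=> H; have {}H := H (fun _ _ => mulr_ge0 (exprn_ge0 _ (ler0n _ 2)) (sqr_ge0 _))
    (fun j => lintZ _ (lD j)).
  apply: filterS (H _) => [x|j]; first exact: cvg_of_summable.
  rewrite rintZ// (_ : 2 * B * _ = 2 ^+ j * (B * (2 * 4^-1 ^+ j))).
    rewrite ler_wpM2l ?exprn_ge0//; apply: (le_trans (Hphi _ _)).
    rewrite ler_wpM2l// mulr2n mulrDl mul1r lerD2r exprS ger_pMl ?exprn_gt0// invf_le1//.
    by rewrite ler1n.
  rewrite (_ : 4^-1 = 2^-1 * 2^-1 :> R); last by field.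
  rewrite exprMn (_ : 2 ^+ j * _ = 2 * B * 2^-1 ^+ j * (2 * 2^-1) ^+ j).
    by rewrite divff// expr1n mulr1.
  by rewrite exprMn; ring.
pose k x := fine (limn_esup (fun j => (phi j x)%:E)).
have mk : measurable_fun setT k.
  apply: measurableT_comp => //; apply: measurable_fun_limn_esup => j.
  exact/measurable_EFinP.
have aek : {ae mu, forall x, phi ^~ x @ \oo --> k x}.
  apply: filterS aeF => x /cvg_ex[l xl].
  have xl' : (fun j => (phi j x)%:E) @ \oo --> l%:E by apply/fine_cvgP; split=> //; exact: nearW.
  by rewrite /k (cvg_limn_einf_sup xl').2.
exists k => // j.
have mkj : measurable_fun setT (fun x => k x - phi j x) by exact: measurable_funB.
pose g m x := ((phi m x - phi j x) ^+ 2)%:E.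
have mg m : measurable_fun setT (g m).
  by apply/measurable_EFinP; apply: measurable_funX; exact: measurable_funB.
have g0 m x : (0 <= g m x)%E by rewrite lee_fin sqr_ge0.
have fat := fatou mu measurableT mg (fun m x _ => g0 m x).
have le1 : (\int[mu]_x ((k x - phi j x) ^+ 2)%:E <= (2 * B * 4^-1 ^+ j)%:E)%E.
  apply: (@le_trans _ _ (\int[mu]_x limn_einf (g ^~ x))%E).
    rewrite le_eqVlt; apply/orP; left; apply/eqP; apply: ge0_ae_eq_integral => //.
    - by apply/measurable_EFinP; exact: measurable_funX.
    - rewrite /limn_einf; apply: measurableT_comp => //; apply: measurable_fun_limn_esup => m.
      exact: measurableT_comp.
    - by move=> x _; rewrite lee_fin sqr_ge0.
    - by move=> x _; rewrite limn_einf_lim; apply: lime_ge; [exact: is_cvg_einfs|];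
        apply: nearW => m; apply: le_ereal_inf_tmp => _ [i _ <-].
    apply: filterS aek => x xk _; apply/esym; apply: (cvg_limn_einf_sup _).1.
    apply/fine_cvgP; split; first exact: nearW.
    have h : (fun m => phi m x - phi j x) @ \oo --> k x - phi j x.
      by apply: cvgB => //; exact: cvg_cst.
    by rewrite expr2; exact: (cvgM h h).
  apply: (le_trans fat); apply: (@limn_einf_le _ _ j) => m jm.
  rewrite lint_EFin; last exact: (lint2B (lphi _) (lphi _)).2.
  rewrite lee_fin; apply: (le_trans (Hphi m j)).
  rewrite [2 * B]mulrC -mulrA ler_wpM2l// mulr2n mulrDl mul1r lerD2r.
  by rewrite ler_wiXn2l ?(ltW q0)// invf_le1// ler1n.
have ik : lint (fun x => (k x - phi j x) ^+ 2).
  apply/integrableP; split; first by apply/measurable_EFinP; exact: measurable_funX.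
  under eq_integral do rewrite /= ger0_norm ?sqr_ge0//.
  exact: le_lt_trans le1 (ltey _).
split; first by split.
by rewrite -lee_fin -lint_EFin.
Qed.

(** The functional [nrm2 phi - 2 * L phi] is minimised over [S]; by the
    parallelogram identity a minimising sequence is fast Cauchy, and [k] is its
    limit. As [S] need not be closed, [k] may lie outside it. The constant [20]
    is whatever the estimates of the first term and of the distance to the limit
    add up to. *)
Theorem riesz_subspace (S : (T -> R) -> Prop) (L : (T -> R) -> R) (B : R) :
  (forall phi, S phi -> lint2 phi) -> S (fun=> 0) ->
  (forall phi psi t, S phi -> S psi -> S (fun x => phi x + t * psi x)) ->
  (forall phi psi t, S phi -> S psi -> L (fun x => phi x + t * psi x) = L phi + t * L psi) ->
  0 < B -> (forall phi, S phi -> L phi ^+ 2 <= B * nrm2 phi) ->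
  exists k, [/\ lint2 k, nrm2 k <= 20 * B &
    forall phi, S phi -> L phi = \int[mu]_x (k x * phi x)].
Proof.
move=> S2 S0 SD LD B0 LB.
pose J phi := nrm2 phi - 2 * L phi.
have JB phi : S phi -> - B <= J phi.
  move=> Sp; have := LB _ Sp; have := nrm2_ge0 mu phi.
  rewrite /J; move: (nrm2 phi) (L phi) => N l N0 lN.
  have h : 2 * l <= B + N.
    have [l0|l0] := leP (2 * l) 0; first by apply: (le_trans l0); lra.
    rewrite -(@ler_pXn2r _ 2)// ?nnegrE; [|exact: ltW|lra].
    by have := sqr_ge0 (B - N); nra.
  lra.
have N0E : nrm2 (fun=> 0) = 0.
  by rewrite /nrm2 /Rintegral integral0_eq// => x _; rewrite expr0n.
have L0 : L (fun=> 0) = 0.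
  by have := LB _ S0; rewrite N0E mulr0 => h; apply/eqP; rewrite -sqrf_eq0 eq_le h sqr_ge0.
pose E := [set J phi | phi in S].
have infE : has_inf E.
  split; first by exists (J (fun=> 0)), (fun=> 0).
  by exists (- B) => _ [phi Sp <-]; exact: JB.
have IJ phi : S phi -> inf E <= J phi by move=> Sp; apply: ge_inf; [case: infE|exists phi].
have I0 : inf E <= 0 by apply: (le_trans (IJ _ S0)); rewrite /J N0E L0 mulr0 subrr.
have q0 j : 0 < B * 4^-1 ^+ j by rewrite mulr_gt0// exprn_gt0// invr_gt0.
have [|phi phiP] := @choice _ _ (fun j phi => S phi /\ J phi < inf E + B * 4^-1 ^+ j).
  by move=> j; have [_ [phi Sp <-] h] := inf_adherent (q0 j) infE; exists phi.
have Sphi j := (phiP j).1; have lphi j := S2 _ (Sphi j).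
have bound0 : nrm2 (phi 0%N) <= 6 * B.
  have := (phiP 0%N).2; have := LB _ (Sphi 0%N); have := nrm2_ge0 mu (phi 0%N).
  rewrite /J expr0 mulr1; move: (nrm2 _) (L _) => N l N0 lN h.
  rewrite leNgt; apply/negP => h6; have h7 : N - B < 2 * l by lra.
  have h8 : (N - B) ^+ 2 < (2 * l) ^+ 2 by rewrite ltr_pXn2r// nnegrE; lra.
  nra.
have cau i j : nrm2 (fun x => phi i x - phi j x) <= 2 * B * (4^-1 ^+ i + 4^-1 ^+ j).
  have Sm := SD _ _ 2^-1 S0 (SD _ _ 1 (Sphi i) (Sphi j)).
  have := IJ _ Sm; have := (phiP i).2; have := (phiP j).2; rewrite /J.
  rewrite LD//; last exact: SD.
  rewrite LD// L0 nrm2D; [|exact: S2|exact/S2/SD].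
  rewrite N0E nrm2D; [|exact: S2..].
  have -> : nrm2 (fun x => phi i x - phi j x) = nrm2 (fun x => phi i x + -1 * phi j x).
    by congr nrm2; apply/funext => x; rewrite mulN1r.
  rewrite nrm2D; [|exact: S2..].
  rewrite (_ : \int[mu]_x (0 * _) = 0); last first.
    by rewrite /Rintegral integral0_eq// => x _; rewrite mul0r.
  move: (nrm2 (phi i)) (nrm2 (phi j)) (L (phi i)) (L (phi j)) (\int[mu]_x _) (4^-1 ^+ i) (4^-1 ^+ j).
  by move=> a b li lj p ei ej; lra.
have [k mk Hk] := fast_cauchy_cvg (mulr_ge0 (ler0n _ 2) (ltW B0)) lphi cau.
have lk : lint2 k.
  have := lint2D (Hk 0%N).1 (lphi 0%N).
  by rewrite (_ : (fun x => _) = k)//; apply/funext => x; rewrite subrK.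
have nk : nrm2 k <= 20 * B.
  have [lk0 nk0] := Hk 0%N.
  have := nrm2_ge0 mu (fun x => (k x - phi 0%N x) + -1 * phi 0%N x).
  have -> : nrm2 k = nrm2 (fun x => (k x - phi 0%N x) + 1 * phi 0%N x).
    by congr nrm2; apply/funext => x; rewrite mul1r subrK.
  rewrite nrm2D// nrm2D//.
  move: nk0 bound0; rewrite expr0 mulr1.
  move: (nrm2 _) (nrm2 _) (\int[mu]_x _) => a b p; lra.
exists k; split=> // psi Spsi; have lpsi := S2 _ Spsi.
apply/eqP; rewrite -subr_eq0 -sqrf_eq0; apply/eqP.
apply/eqP; rewrite eq_le sqr_ge0 andbT.
have key j : (L psi - \int[mu]_x (k x * psi x)) ^+ 2 <= 10 * B * nrm2 psi * 4^-1 ^+ j.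
  have lj := (Hk j).1.
  have h1 : (\int[mu]_x (phi j x * psi x) - L psi) ^+ 2 <= B * 4^-1 ^+ j * nrm2 psi.
    apply: discriminant_le; first exact: nrm2_ge0.
    move=> t; have := IJ _ (SD _ _ t (Sphi j) Spsi); rewrite /J LD// nrm2D//.
    have := (phiP j).2; rewrite /J; move: (nrm2 _) (nrm2 _) (\int[mu]_x _) (L _) (L _) => a b p l l'.
    move: (B * _) => e; lra.
  have h2 := cauchy_schwarz lj lpsi.
  have h3 : (\int[mu]_x ((k x - phi j x) * psi x)) ^+ 2 <= 4 * B * 4^-1 ^+ j * nrm2 psi.
    apply: (le_trans h2); rewrite ler_wpM2r ?nrm2_ge0//; apply: (le_trans (Hk j).2).
    by rewrite !mulrA -natrM.
  have -> : \int[mu]_x (k x * psi x) = \int[mu]_x (phi j x * psi x) +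
      \int[mu]_x ((k x - phi j x) * psi x).
    rewrite -rintD; [|exact: lint2M..].
    by apply: eq_Rintegral => x _; ring.
  move: h1 h3; move: (\int[mu]_x _) (\int[mu]_x _) (L psi) (nrm2 psi) => p r l N h1 h3.
  have := sqr_ge0 ((p - l) - r); move: h1 h3; move: (4^-1 ^+ j) => e; nra.
have c0 : 0 <= 10 * B * nrm2 psi by rewrite !mulr_ge0 ?nrm2_ge0// ltW.
apply/ler_addgt0Pl => e e0; rewrite addr0.
have [j hj] : exists j : nat, 10 * B * nrm2 psi * 4^-1 ^+ j <= e.
  move: c0; move: (10 * B * nrm2 psi) => c c0.
  exists (Num.trunc (c / e)).+1; set j := (_.+1)%N.
  rewrite exprVn ler_pdivrMr ?exprn_gt0// mulrC -ler_pdivrMr//.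
  apply: (le_trans (ltW (truncnS_gt (c / e)))).
  by rewrite -natrX ler_nat ltnW// ltn_expl.
exact: le_trans (key j) hj.
Qed.

End riesz.

(** * Fourier transforms of functions, as distributions *)

Section fourier_components.
Context {R : realType} {n : nat}.
Local Notation V := 'rV[R]_n.
Local Notation mu := (@lebesgue_rV R n).
Implicit Types (x y xi : V) (u v p q k : V -> R) (f h : V -> R[i]).

Definition fourier_cst : R := (2 * pi) `^ (- (n%:R / 2)).

Lemma fourier_cst_ge0 : 0 <= fourier_cst.
Proof. exact: powR_ge0. Qed.

Lemma fourier_cst_sqr : fourier_cst ^+ 2 * (2 * pi) ^+ n = 1.
Proof.
have p0 : 0 < 2 * pi :> R by rewrite mulr_gt0// pi_gt0.
rewrite -powR_mulrn ?powR_ge0// -powRrM -[X in _ * X]powR_mulrn ?(ltW p0)// -powRD.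
  by rewrite (_ : _ + _ = 0) ?powRr0//; field.
by apply/implyP => _; rewrite gt_eqF.
Qed.

(** The cosine and sine transforms, in the normalisation of the Fourier
    transform. *)
Definition cosT u xi : R := fourier_cst * ctrans 0 u xi.
Definition sinT u xi : R := fourier_cst * ctrans (- (pi / 2)) u xi.

Lemma rschwartz_cosT u : rschwartz u -> rschwartz (cosT u).
Proof. by move=> su; apply: rschwartzZ; exact: rschwartz_ctrans. Qed.

Lemma rschwartz_sinT u : rschwartz u -> rschwartz (sinT u).
Proof. by move=> su; apply: rschwartzZ; exact: rschwartz_ctrans. Qed.

Lemma ctransD c u v t xi : lint mu u -> lint mu v ->
  ctrans c (fun x => u x + t * v x) xi = ctrans c u xi + t * ctrans c v xi.
Proof.
move=> iu iv; rewrite /ctrans -rintZ -?rintD.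
- by apply: eq_Rintegral => x _; ring.
- exact: ctrans_lint.
- by apply: lintZ; exact: ctrans_lint.
- exact: ctrans_lint.
Qed.

Lemma cosTD u v t xi : lint mu u -> lint mu v ->
  cosT (fun x => u x + t * v x) xi = cosT u xi + t * cosT v xi.
Proof. by move=> iu iv; rewrite /cosT ctransD//; ring. Qed.

Lemma sinTD u v t xi : lint mu u -> lint mu v ->
  sinT (fun x => u x + t * v x) xi = sinT u xi + t * sinT v xi.
Proof. by move=> iu iv; rewrite /sinT ctransD//; ring. Qed.

Lemma sin_dot xi x : cos (dotrV xi x - pi / 2) = sin (dotrV x xi).
Proof. by rewrite cosBpihalf dotrVC. Qed.

Section of_function.
Variable f : V -> R[i].
Let a := @Re R \o f.
Let b := @Im R \o f.
Hypotheses (ia : lint mu a) (ib : lint mu b).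

Lemma Re_fourier xi : Re (fourier_fun f xi) = cosT a xi + sinT b xi.
Proof.
rewrite /fourier_fun /cintegral -/fourier_cst /= mul0r subr0 /cosT /sinT -mulrDr.
congr (_ * _); rewrite /ctrans -rintD; [|exact: ctrans_lint..].
apply: eq_Rintegral => x _; rewrite addr0 sin_dot [dotrV xi x]dotrVC /a /b /=.
by case: (f x) => c d /=; rewrite cosN sinN; ring.
Qed.

Lemma Im_fourier xi : Im (fourier_fun f xi) = cosT b xi - sinT a xi.
Proof.
rewrite /fourier_fun /cintegral -/fourier_cst /= mul0r addr0 /cosT /sinT -mulrBr.
congr (_ * _); rewrite /ctrans -rintB; [|exact: ctrans_lint..].
apply: eq_Rintegral => x _; rewrite addr0 sin_dot [dotrV xi x]dotrVC /a /b /=.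
by case: (f x) => c d /=; rewrite cosN sinN; ring.
Qed.

Lemma Re_fourier_inv xi : Re (fourier_inv_fun f xi) = cosT a xi - sinT b xi.
Proof.
rewrite /fourier_inv_fun /cintegral -/fourier_cst /= mul0r subr0 /cosT /sinT -mulrBr.
congr (_ * _); rewrite /ctrans -rintB; [|exact: ctrans_lint..].
apply: eq_Rintegral => x _; rewrite addr0 sin_dot [dotrV xi x]dotrVC dotrVC /a /b /=.
by case: (f x) => c d /=; ring.
Qed.

Lemma Im_fourier_inv xi : Im (fourier_inv_fun f xi) = cosT b xi + sinT a xi.
Proof.
rewrite /fourier_inv_fun /cintegral -/fourier_cst /= mul0r addr0 /cosT /sinT -mulrDr.
congr (_ * _); rewrite /ctrans -rintD; [|exact: ctrans_lint..].
apply: eq_Rintegral => x _; rewrite addr0 sin_dot [dotrV xi x]dotrVC dotrVC /a /b /=.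
by case: (f x) => c d /=; ring.
Qed.

End of_function.

(** Together with [cos_sinT], this is Fourier inversion for real functions. *)
Lemma cos_cosT u x : rschwartz u -> cosT (cosT u) x + sinT (sinT u) x = u x.
Proof.
move=> su; have ic := rschwartz_lint (rschwartz_ctrans 0 su).
have is' := rschwartz_lint (rschwartz_ctrans (- (pi / 2)) su).
have Z (c : R) v y : lint mu v -> ctrans c (fun x => fourier_cst * v x) y = fourier_cst * ctrans c v y.
  move=> iv; rewrite -rintZ; last exact: ctrans_lint.
  by apply: eq_Rintegral => z _; rewrite mulrCA.
rewrite /cosT /sinT !Z// !ctrans_inversion// addr0 subrr -opprD subrr cos0 -splitr cosN cospi.
have := fourier_cst_sqr; move: ((2 * pi) ^+ n) => P HP.
by transitivity (fourier_cst ^+ 2 * P * u x); [field|rewrite HP mul1r].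
Qed.

Lemma cos_sinT u x : rschwartz u -> cosT (sinT u) x = sinT (cosT u) x.
Proof.
move=> su; have ic := rschwartz_lint (rschwartz_ctrans 0 su).
have is' := rschwartz_lint (rschwartz_ctrans (- (pi / 2)) su).
have Z (c : R) v y : lint mu v -> ctrans c (fun x => fourier_cst * v x) y = fourier_cst * ctrans c v y.
  move=> iv; rewrite -rintZ; last exact: ctrans_lint.
  by apply: eq_Rintegral => z _; rewrite mulrCA.
have e1 : ctrans 0 (ctrans (- (pi / 2)) u) x = 0.
  by rewrite ctrans_inversion// add0r sub0r opprK cosN cos_pihalf !mul0r addr0 mulr0.
have e2 : ctrans (- (pi / 2)) (ctrans 0 u) x = 0.
  by rewrite ctrans_inversion// addr0 subr0 cosN cos_pihalf !mul0r addr0 mulr0.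
by rewrite /cosT /sinT (Z 0 _ x is') (Z _ _ x ic) e1 e2.
Qed.

End fourier_components.

Section distributions.
Context {R : realType} {n : nat}.
Local Notation V := 'rV[R]_n.
Local Notation mu := (@lebesgue_rV R n).
Implicit Types (x y xi : V) (u v p q k : V -> R) (f h : V -> R[i]) (phi : schwartz R n).
Implicit Types w : functional R n.

Lemma schwartz_lint_Re phi : lint mu (@Re R \o phi).
Proof. by apply: rschwartz_lint; exact: schwartz_Re. Qed.

Lemma schwartz_lint_Im phi : lint mu (@Im R \o phi).
Proof. by apply: rschwartz_lint; exact: schwartz_Im. Qed.

Lemma Re_fourierE phi : @Re R \o fourier_fun phi =
  (fun xi => cosT (@Re R \o phi) xi + sinT (@Im R \o phi) xi).
Proof. by apply/funext => xi; apply: Re_fourier; [exact: schwartz_lint_Re|exact: schwartz_lint_Im]. Qed.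

Lemma Im_fourierE phi : @Im R \o fourier_fun phi =
  (fun xi => cosT (@Im R \o phi) xi - sinT (@Re R \o phi) xi).
Proof. by apply/funext => xi; apply: Im_fourier; [exact: schwartz_lint_Re|exact: schwartz_lint_Im]. Qed.

Lemma to_schwartz_fourier phi : to_schwartz (fourier_fun phi) = fourier_fun phi :> (V -> R[i]).
Proof.
have sr := schwartz_Re phi; have si := schwartz_Im phi.
apply: to_schwartzE; rewrite ?Re_fourierE ?Im_fourierE.
- by apply: rschwartzD; [exact: rschwartz_cosT|exact: rschwartz_sinT].
- by apply: rschwartzB; [exact: rschwartz_cosT|exact: rschwartz_sinT].
Qed.

Lemma complex_eqP (z z' : R[i]) : Re z = Re z' -> Im z = Im z' -> z = z'.
Proof. by case: z z' => a b [c d] /= -> ->. Qed.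

Lemma fourierK phi : fourier_inv_fun (to_schwartz (fourier_fun phi)) = phi :> (V -> R[i]).
Proof.
have sr := schwartz_Re phi; have si := schwartz_Im phi.
set a := @Re R \o phi in sr *; set b := @Im R \o phi in si *.
have lcr := rschwartz_lint (rschwartz_cosT sr); have lsr := rschwartz_lint (rschwartz_sinT sr).
have lci := rschwartz_lint (rschwartz_cosT si); have lsi := rschwartz_lint (rschwartz_sinT si).
have iFr := schwartz_lint_Re (to_schwartz (fourier_fun phi)).
have iFi := schwartz_lint_Im (to_schwartz (fourier_fun phi)).
have Er : @Re R \o to_schwartz (fourier_fun phi) = (fun xi => cosT a xi + 1 * sinT b xi).
  by rewrite to_schwartz_fourier Re_fourierE; apply/funext => xi; rewrite mul1r.
have Ei : @Im R \o to_schwartz (fourier_fun phi) = (fun xi => cosT b xi + -1 * sinT a xi).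
  by rewrite to_schwartz_fourier Im_fourierE; apply/funext => xi; rewrite mulN1r.
apply/funext => x; apply: complex_eqP.
  rewrite Re_fourier_inv// Er Ei cosTD// sinTD// (cos_sinT _ si) -[RHS](cos_cosT x sr); ring.
rewrite Im_fourier_inv// Er Ei cosTD// sinTD// (cos_sinT _ sr) -[RHS](cos_cosT x si); ring.
Qed.

Lemma schwartz_eqP (phi psi : schwartz R n) : phi = psi :> (V -> R[i]) -> phi = psi.
Proof. exact: val_inj. Qed.

Lemma to_schwartzK phi f : f = phi :> (V -> R[i]) -> to_schwartz f = phi.
Proof.
by move=> ->; apply: schwartz_eqP; apply: to_schwartzE; [exact: schwartz_Re|exact: schwartz_Im].
Qed.

Lemma dfourier_invK w : dfourier (dfourier_inv w) = w.
Proof.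
apply/funext => phi; rewrite /dfourier /dfourier_inv; congr w.
by apply: to_schwartzK; exact: fourierK.
Qed.

Lemma japanese_powRE t x : japanese x `^ t = (1 + dotrV x x) `^ (t / 2).
Proof.
by rewrite -japanese_sqr -powR_mulrn ?japanese_ge0// -powRrM mulrC divfK.
Qed.

Lemma rschwartz_japanese t u : rschwartz u -> rschwartz (fun x => japanese x `^ t * u x).
Proof.
move=> su; rewrite (_ : (fun x => _) = (fun x => (1 + dotrV x x) `^ (t / 2) * u x)).
  by apply: rschwartzM => //; exact: mult_japanese.
by apply/funext => x; rewrite japanese_powRE.
Qed.

Lemma to_schwartz_japanese t phi :
  to_schwartz (fun x => (japanese x `^ t)%:C * phi x) =
  (fun x => (japanese x `^ t)%:C * phi x) :> (V -> R[i]).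
Proof.
apply: to_schwartzE.
  rewrite (_ : _ \o _ = (fun x => japanese x `^ t * Re (phi x))).
    by apply: rschwartz_japanese; exact: schwartz_Re.
  by apply/funext => x /=; case: (phi x) => a b /=; rewrite mul0r subr0.
rewrite (_ : _ \o _ = (fun x => japanese x `^ t * Im (phi x))).
  by apply: rschwartz_japanese; exact: schwartz_Im.
by apply/funext => x /=; case: (phi x) => a b /=; rewrite mul0r addr0.
Qed.

Definition japmul t h : V -> R[i] := fun x => (japanese x `^ t)%:C * h x.

Lemma japanese_powRN t x : japanese x `^ t * japanese x `^ (- t) = 1.
Proof. by rewrite powRN mulfV// gt_eqF// powR_gt0// japanese_gt0. Qed.

Lemma japmulK t h : japmul (- t) (japmul t h) = h.
Proof.
apply/funext => x; rewrite /japmul mulrA.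
rewrite (_ : (japanese x `^ - t)%:C * (japanese x `^ t)%:C = 1) ?mul1r//.
by apply: complex_eqP => /=; rewrite ?mulr0 ?mul0r ?subr0 ?addr0// mulrC japanese_powRN.
Qed.

Lemma dmulK t w : dmul (fun x => japanese x `^ (- t)) (dmul (fun x => japanese x `^ t) w) = w.
Proof.
apply/funext => phi; rewrite /dmul; congr w; apply: to_schwartzK.
by rewrite to_schwartz_japanese -[RHS](japmulK (- t)) opprK.
Qed.

Lemma dfourier_bessel t w :
  dfourier (bessel t w) = dmul (fun x => japanese x `^ t) (dfourier w).
Proof. exact: dfourier_invK. Qed.

Lemma ReM (z w : R[i]) : Re (z * w) = Re z * Re w - Im z * Im w.
Proof. by case: z => a b; case: w. Qed.

Lemma ImM (z w : R[i]) : Im (z * w) = Re z * Im w + Im z * Re w.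
Proof. by case: z => a b; case: w. Qed.

Lemma Re_realM (a : R) (z : R[i]) : Re (a%:C * z) = a * Re z.
Proof. by case: z => c d /=; rewrite mul0r subr0. Qed.

Lemma Im_realM (a : R) (z : R[i]) : Im (a%:C * z) = a * Im z.
Proof. by case: z => c d /=; rewrite mul0r addr0. Qed.

Lemma represents_japmul t w h : represents w h ->
  represents (dmul (fun x => japanese x `^ t) w) (japmul t h).
Proof.
move=> [[mr mi] ih ->].
have E phi : (fun x => japmul t h x * phi x) =
    (fun x => h x * to_schwartz (fun x => (japanese x `^ t)%:C * phi x) x).
  by rewrite to_schwartz_japanese; apply/funext => x; rewrite /japmul mulrCA mulrA.
split.
- split.
    rewrite (_ : _ \o _ = (fun x => japanese x `^ t * Re (h x))).
      by apply: measurable_funM => //; exact: measurable_japanese_powR.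
    by apply/funext => x /=; rewrite Re_realM.
  rewrite (_ : _ \o _ = (fun x => japanese x `^ t * Im (h x))).
    by apply: measurable_funM => //; exact: measurable_japanese_powR.
  by apply/funext => x /=; rewrite Im_realM.
- by move=> phi; rewrite E; exact: ih.
- by apply/funext => phi; rewrite /dmul /dist_of E.
Qed.

Definition testable k := measurable_fun setT k /\
  forall u, rschwartz u -> lint mu (fun x => k x * u x).

Definition pairing p q u := \int[mu]_x (p x * cosT u x + q x * sinT u x).

(** The Fourier transform of [p +i* q] has real part [cosT p + sinT q]; here this
    is read weakly, with both transforms moved onto the test function. *)
Definition weak_transform p q k := testable k /\
  forall u, rschwartz u -> pairing p q u = \int[mu]_x (k x * u x).

Lemma testableD p q : testable p -> testable q -> testable (fun x => p x + q x).
Proof.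
move=> [mp ip] [mq iq]; split; first exact: measurable_funD.
move=> u su; rewrite (_ : (fun x => _) = (fun x => p x * u x + q x * u x)).
  by apply: lintD; [exact: ip|exact: iq].
by apply/funext => x; rewrite mulrDl.
Qed.

Lemma testableN p : testable p -> testable (fun x => - p x).
Proof.
move=> [mp ip]; split; first exact: measurableT_comp.
move=> u su; rewrite (_ : (fun x => _) = (fun x => -1 * (p x * u x))).
  by apply: lintZ; exact: ip.
by apply/funext => x; rewrite mulN1r mulNr.
Qed.

Lemma pairing_lint p q u : testable p -> testable q -> rschwartz u ->
  lint mu (fun x => p x * cosT u x) /\ lint mu (fun x => q x * sinT u x).
Proof.
move=> [_ ip] [_ iq] su; split; first by apply: ip; exact: rschwartz_cosT.
by apply: iq; exact: rschwartz_sinT.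
Qed.

Lemma weak_transformD p q k p' q' k' : testable p -> testable q -> testable p' -> testable q' ->
  weak_transform p q k -> weak_transform p' q' k' ->
  weak_transform (fun x => p x + p' x) (fun x => q x + q' x) (fun x => k x + k' x).
Proof.
move=> tp tq tp' tq' [tk k1] [tk' k1']; split; first exact: testableD.
move=> u su; have [i1 i2] := pairing_lint tp tq su; have [i3 i4] := pairing_lint tp' tq' su.
rewrite /pairing (_ : (fun x => _) = (fun x => (p x * cosT u x + q x * sinT u x) +
   (p' x * cosT u x + q' x * sinT u x))); last by apply/funext => x; ring.
rewrite rintD; [|exact: lintD..].
have := k1 _ su; have := k1' _ su; rewrite /pairing => -> ->.
rewrite -rintD; [|exact: tk.2|exact: tk'.2].
by apply: eq_Rintegral => x _; rewrite mulrDl.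
Qed.

Lemma testable_cintegrable h phi : testable (@Re R \o h) -> testable (@Im R \o h) ->
  cintegrable mu (fun x => h x * phi x).
Proof.
move=> [mr tr] [mi ti]; have sr := schwartz_Re phi; have si := schwartz_Im phi; split.
  rewrite (_ : _ \o _ = EFin \o (fun x => Re (h x) * Re (phi x) - Im (h x) * Im (phi x))).
    by apply: lintB; [exact: (tr _ sr)|exact: (ti _ si)].
  by apply/funext => x /=; case: (h x) => ? ?; case: (phi x).
rewrite (_ : _ \o _ = EFin \o (fun x => Re (h x) * Im (phi x) + Im (h x) * Re (phi x))).
  by apply: lintD; [exact: (tr _ si)|exact: (ti _ sr)].
by apply/funext => x /=; case: (h x) => ? ?; case: (phi x).
Qed.

(** The imaginary part of the transform of [h] is the real part of the transform
    of [- i h], whose components are [Im h] and [- Re h]. *)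
Lemma represents_dfourier h k1 k2 :
  testable (@Re R \o h) -> testable (@Im R \o h) ->
  weak_transform (@Re R \o h) (@Im R \o h) k1 ->
  weak_transform (@Im R \o h) (fun x => - Re (h x)) k2 ->
  represents (dfourier (dist_of h)) (fun x => k1 x +i* k2 x).
Proof.
set hr := @Re R \o h; set hi := @Im R \o h.
move=> tr ti [t1 T1] [t2 T2].
have tr' := testableN tr.
split.
- by split; [exact: t1.1|exact: t2.1].
- by move=> phi; apply: testable_cintegrable.
apply/funext => phi; have sr := schwartz_Re phi; have si := schwartz_Im phi.
rewrite /dfourier /dist_of to_schwartz_fourier.
set a := @Re R \o phi in sr *; set b := @Im R \o phi in si *.
have [iar iai] := pairing_lint tr ti sr; have [ibr ibi] := pairing_lint tr ti si.
have [jar jai] := pairing_lint ti tr' sr; have [jbr jbi] := pairing_lint ti tr' si.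
have Er xi : Re (fourier_fun phi xi) = cosT a xi + sinT b xi.
  by have /(congr1 (@^~ xi)) := Re_fourierE phi.
have Ei xi : Im (fourier_fun phi xi) = cosT b xi - sinT a xi.
  by have /(congr1 (@^~ xi)) := Im_fourierE phi.
apply: complex_eqP; rewrite /cintegral /=.
  transitivity (pairing hr hi a - pairing hi (fun x => - hr x) b).
    rewrite /pairing -rintB; [|exact: lintD..].
    apply: eq_Rintegral => x _.
    transitivity (hr x * Re (fourier_fun phi x) - hi x * Im (fourier_fun phi x)).
      exact: ReM.
    by rewrite Er Ei; ring.
  rewrite T1// T2// -rintB; [|exact: t1.2|exact: t2.2].
  by apply: eq_Rintegral => x _; rewrite ReM.
transitivity (pairing hr hi b + pairing hi (fun x => - hr x) a).
  rewrite /pairing -rintD; [|exact: lintD..].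
  apply: eq_Rintegral => x _.
  transitivity (hr x * Im (fourier_fun phi x) + hi x * Re (fourier_fun phi x)).
    exact: ImM.
  by rewrite Er Ei; ring.
rewrite T1// T2// -rintD; [|exact: t1.2|exact: t2.2].
by apply: eq_Rintegral => x _; rewrite ImM.
Qed.

Lemma rschwartz_lint2 u : rschwartz u -> lint2 mu u.
Proof.
move=> su; split; first exact: rschwartz_measurable.
have [C _ uC] := rschwartz_bounded su.
rewrite (_ : (fun x => _) = (fun x => u x * u x)); last by apply/funext => x; rewrite expr2.
exact: lintM (rschwartz_measurable su) uC (rschwartz_lint su).
Qed.

Lemma lint2_testable p : lint2 mu p -> testable p.
Proof.
move=> lp; split=> [|u su]; first exact: lp.1.
exact: lint2M lp (rschwartz_lint2 su).
Qed.

End distributions.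

(** * Transforms of integrable and of square-integrable functions *)

Section transforms.
Context {R : realType} {n : nat}.
Local Notation V := 'rV[R]_n.
Local Notation mu := (@lebesgue_rV R n).
Local Notation fc := (@fourier_cst R n).
Implicit Types (x y xi : V) (u v w p q k : V -> R).

Lemma lint_ctransM c u w : lint mu u -> lint mu w ->
  lint mu (fun x => w x * (fc * ctrans c u x)).
Proof.
move=> iu iw; rewrite (_ : (fun x => _) = (fun x => fc * (ctrans c u x * w x))).
  by apply: lintZ; exact: lintM (measurable_ctrans c iu) (fun x => ctrans_bounded c x iu) iw.
by apply/funext => x; ring.
Qed.

Lemma scaled_ctrans_swap c u w : lint mu u -> lint mu w ->
  \int[mu]_x (u x * (fc * ctrans c w x)) =
  \int[mu]_x (w x * (fc * ctrans c u x)).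
Proof.
move=> iu iw.
transitivity (fc * \int[mu]_x (u x * ctrans c w x)).
  rewrite -rintZ; first by apply: eq_Rintegral => x _; rewrite mulrCA.
  rewrite (_ : (fun x => _) = (fun x => ctrans c w x * u x)).
    exact: lintM (measurable_ctrans c iw) (fun x => ctrans_bounded c x iw) iu.
  by apply/funext => x; rewrite mulrC.
rewrite -ctrans_swap// -rintZ; last first.
  exact: lintM (measurable_ctrans c iu) (fun x => ctrans_bounded c x iu) iw.
by apply: eq_Rintegral => x _; rewrite mulrA mulrC.
Qed.

Lemma cosT_swap u w : lint mu u -> lint mu w ->
  \int[mu]_x (u x * cosT w x) = \int[mu]_x (w x * cosT u x).
Proof. exact: scaled_ctrans_swap. Qed.

Lemma sinT_swap u w : lint mu u -> lint mu w ->
  \int[mu]_x (u x * sinT w x) = \int[mu]_x (w x * sinT u x).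
Proof. exact: scaled_ctrans_swap. Qed.

(** Plancherel's identity; the two integrals of squares are moved onto [u] by
    symmetry of the kernels, and recombine by the inversion formula. *)
Lemma plancherel u : rschwartz u -> nrm2 mu (cosT u) + nrm2 mu (sinT u) = nrm2 mu u.
Proof.
move=> su; have iu := rschwartz_lint su.
have sc := rschwartz_cosT su; have ss := rschwartz_sinT su.
have ic := rschwartz_lint sc; have is' := rschwartz_lint ss.
have E v : nrm2 mu v = \int[mu]_x (v x * v x) by apply: eq_Rintegral => x _; rewrite expr2.
rewrite !E cosT_swap// sinT_swap// -rintD; [|exact: lint_ctransM..].
by apply: eq_Rintegral => x _; rewrite -mulrDr cos_cosT.
Qed.

Lemma pairing_le p q u : lint2 mu p -> lint2 mu q -> rschwartz u ->
  pairing p q u ^+ 2 <= 2 * (nrm2 mu p + nrm2 mu q) * nrm2 mu u.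
Proof.
move=> lp lq su.
have lc := rschwartz_lint2 (rschwartz_cosT su); have ls := rschwartz_lint2 (rschwartz_sinT su).
rewrite /pairing rintD; [|exact: lint2M..].
have := cauchy_schwarz lp lc; have := cauchy_schwarz lq ls; rewrite -(plancherel su).
have := nrm2_ge0 mu p; have := nrm2_ge0 mu q.
have := nrm2_ge0 mu (cosT u); have := nrm2_ge0 mu (sinT u).
move: (\int[mu]_x _) (\int[mu]_x _) (nrm2 _ _) (nrm2 _ _) (nrm2 _ _) (nrm2 _ _) => a b c d e f.
move=> c0 d0 e0 f0 H1 H2.
have := sqr_ge0 (a - b); have := mulr_ge0 c0 f0; have := mulr_ge0 d0 e0; nra.
Qed.

(** Plancherel's identity bounds the pairing by the [L^2] norm of the test
    function. *)
Lemma weak_transform_lint2 p q B : lint2 mu p -> lint2 mu q -> 0 < B ->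
  2 * (nrm2 mu p + nrm2 mu q) <= B ->
  exists k, [/\ lint2 mu k, nrm2 mu k <= 20 * B & weak_transform p q k].
Proof.
move=> lp lq B0 HB.
have [||||//||k [k1 k2 k3]] := @riesz_subspace _ _ _ mu (@rschwartz R n) (pairing p q) B.
- exact: rschwartz_lint2.
- exact: rschwartz0.
- by move=> u v t su sv; apply: rschwartzD => //; exact: rschwartzZ.
- move=> u v t su sv; have [i1 i2] := pairing_lint (lint2_testable lp) (lint2_testable lq) su.
  have [i3 i4] := pairing_lint (lint2_testable lp) (lint2_testable lq) sv.
  rewrite /pairing -rintZ -?rintD; [|by repeat (apply: lintD || apply: lintZ)..].
  apply: eq_Rintegral => x _; rewrite cosTD ?sinTD; [ring|exact: rschwartz_lint..].
- move=> u su; apply: le_trans (pairing_le lp lq su) _.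
  by apply: ler_wpM2r HB; exact: nrm2_ge0.
- by exists k; split=> //; split=> //; exact: lint2_testable.
Qed.

Lemma bounded_testable C u : measurable_fun setT u -> (forall x, `|u x| <= C) -> testable u.
Proof. by move=> mu' uC; split=> // v sv; exact: lintM mu' uC (rschwartz_lint sv). Qed.

Lemma lint_testable p : lint mu p -> testable p.
Proof.
move=> ip; split=> [|u su]; first exact: (lint_measurable ip).
rewrite (_ : (fun x => _) = (fun x => u x * p x)); last by apply/funext => x; rewrite mulrC.
have [C _ uC] := rschwartz_bounded su.
exact: lintM (rschwartz_measurable su) uC ip.
Qed.

Lemma cosT_bounded p x : lint mu p -> `|cosT p x| <= fc * \int[mu]_y `|p y|.
Proof.
move=> ip; rewrite normrM ger0_norm ?fourier_cst_ge0// ler_wpM2l ?fourier_cst_ge0//.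
exact: ctrans_bounded.
Qed.

Lemma sinT_bounded p x : lint mu p -> `|sinT p x| <= fc * \int[mu]_y `|p y|.
Proof.
move=> ip; rewrite normrM ger0_norm ?fourier_cst_ge0// ler_wpM2l ?fourier_cst_ge0//.
exact: ctrans_bounded.
Qed.

Lemma weak_transform_lint p q : lint mu p -> lint mu q ->
  weak_transform p q (fun x => cosT p x + sinT q x).
Proof.
move=> ip iq; split.
  apply: testableD.
    apply: bounded_testable (fun x => cosT_bounded x ip).
    by apply: measurable_funM => //; exact: measurable_ctrans.
  apply: bounded_testable (fun x => sinT_bounded x iq).
  by apply: measurable_funM => //; exact: measurable_ctrans.
move=> u su; have iu := rschwartz_lint su.
rewrite /pairing rintD; [|exact: lint_ctransM..].
rewrite cosT_swap// sinT_swap// -rintD; [|exact: lint_ctransM..].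
by apply: eq_Rintegral => x _; rewrite -mulrDr mulrC.
Qed.

(** In the transform of a sum of an [L^2] and an [L^1] pair, [w] is the
    contribution of the first; that of the second is uniformly small. *)
Lemma weak_transform_split b1 b2 g1 g2 e : 0 < e -> lint2 mu b1 -> lint2 mu b2 ->
  nrm2 mu b1 <= e -> nrm2 mu b2 <= e -> lint mu g1 -> lint mu g2 ->
  \int[mu]_x `|g1 x| <= e -> \int[mu]_x `|g2 x| <= e ->
  exists k w, [/\ weak_transform (fun x => b1 x + g1 x) (fun x => b2 x + g2 x) k, lint2 mu w,
    nrm2 mu w <= 80 * e & forall x, `|k x - w x| <= 2 * fc * e].
Proof.
move=> e0 l1 l2 n1 n2 i1 i2 m1 m2.
have [||w [lw nw tw]] := @weak_transform_lint2 b1 b2 (4 * e) l1 l2.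
- by rewrite mulr_gt0.
- by move: n1 n2; move: (nrm2 _ _) (nrm2 _ _) => a b; lra.
exists (fun x => w x + (cosT g1 x + sinT g2 x)), w; split => //.
- by apply: weak_transformD => //; [exact: lint2_testable|exact: lint2_testable|
    exact: lint_testable|exact: lint_testable|exact: weak_transform_lint].
- by move: nw; move: (nrm2 _ _) => a; lra.
move=> x; rewrite addrAC subrr add0r (le_trans (ler_normD _ _))//.
rewrite -mulrA mulrDl mul1r lerD//.
  by apply: le_trans (cosT_bounded _ i1) _; rewrite ler_wpM2l// fourier_cst_ge0.
by apply: le_trans (sinT_bounded _ i2) _; rewrite ler_wpM2l// fourier_cst_ge0.
Qed.

End transforms.

(** * Functions that vanish against all test functions *)

Section bumps.
Context {R : realType} {n : nat}.
Local Notation V := 'rV[R]_n.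
Local Notation mu := (@lebesgue_rV R n).
Implicit Types (x a b : V) (u v h : V -> R).

(** Smooth approximations, from inside, of the indicator function of a
    rectangle. *)
Definition bump (k : R) a b x : R :=
  \prod_(i < n) (flat 0 (k * x ord0 i + - (k * a ord0 i)) *
                 flat 0 (- k * x ord0 i + k * b ord0 i)).

Lemma mult_bump k a b : multiplier (bump k a b).
Proof.
rewrite /bump; elim: (index_enum _) => [|i s IH].
  rewrite (_ : (fun x => _) = cst 1); first exact: mult_cst.
  by apply/funext => x; rewrite big_nil.
rewrite (_ : (fun x => _) = (fun x => (flat 0 (k * x ord0 i + - (k * a ord0 i)) *
     flat 0 (- k * x ord0 i + k * b ord0 i)) * \prod_(i <- s)
   (flat 0 (k * x ord0 i + - (k * a ord0 i)) * flat 0 (- k * x ord0 i + k * b ord0 i)))).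
  by apply: mult_mul => //; apply: mult_mul; exact: mult_flat.
by apply/funext => x; rewrite big_cons.
Qed.

Lemma flat0_le1 (t : R) : flat 0 t <= 1.
Proof. by have := flat_le 0 t; rewrite expr0. Qed.

Lemma bump_ge0 k a b x : 0 <= bump k a b x.
Proof. by apply: prodr_ge0 => i _; rewrite mulr_ge0// flat_ge0. Qed.

Lemma bump_le1 k a b x : bump k a b x <= 1.
Proof.
apply: prodr_ile1 => i _; rewrite mulr_ge0 ?flat_ge0//=.
by rewrite mulr_ile1 ?flat_ge0 ?flat0_le1.
Qed.

Lemma flat0_cvg (s : R) : (fun j : nat => flat 0 (j.+1%:R * s)) @ \oo --> ((0 < s)%R%:R : R).
Proof.
have [s0|s0] := ltP 0 s; last first.
  rewrite (_ : (fun j => _) = cst 0); first exact: cvg_cst.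
  apply/funext => j; rewrite /flat ltNge (_ : _ * s <= 0)//.
  by rewrite mulr_ge0_le0.
rewrite (_ : (fun j => _) = (fun j => expR (- (s^-1 * j.+1%:R^-1)))); last first.
  by apply/funext => j; rewrite /flat mulr_gt0// expr0 mul1r invfM mulrC.
rewrite -[X in _ --> X]expR0 -[X in expR X]oppr0 -(mulr0 s^-1).
apply: (cvg_comp (fun j : nat => - (s^-1 / j.+1%:R)) expR _ (@continuous_expR R _)).
apply: cvgN; apply: cvgMr; exact: cvg_harmonic.
Qed.

Lemma bump_cvg a b x : (fun j : nat => bump j.+1%:R a b x) @ \oo --> (\1_(rect a b) x : R).
Proof.
have -> : \1_(rect a b) x = \prod_(i < n) ((0 < x ord0 i - a ord0 i)%R%:R * (0 < b ord0 i - x ord0 i)%R%:R) :> R.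
  rewrite indicE; case: (boolP (x \in rect a b)) => [/set_mem xab|].
    by rewrite big1// => i _; rewrite !subr_gt0; have /andP[-> ->] := xab i; rewrite ?mulr1.
  rewrite notin_setE => /existsNP[j]; rewrite (bigD1 j)//= !subr_gt0.
  by case: (_ < _); case: (_ < _); rewrite /= ?mul0r ?mulr0 ?mul0r.
rewrite /bump; elim: (index_enum _) => [|i s IH].
  by rewrite big_nil (_ : (fun j => _) = cst 1); [exact: cvg_cst|apply/funext => j; rewrite big_nil].
rewrite big_cons (_ : (fun j => _) = (fun j => flat 0 (j.+1%:R * (x ord0 i - a ord0 i)) * flat 0 (j.+1%:R * (b ord0 i - x ord0 i)) *
   \prod_(i <- s) (flat 0 (j.+1%:R * x ord0 i + - (j.+1%:R * a ord0 i)) * flat 0 (- j.+1%:R * x ord0 i + j.+1%:R * b ord0 i)))).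
  by apply: cvgM => //; apply: cvgM; exact: flat0_cvg.
by apply/funext => j; rewrite big_cons !mulrBr mulNr [in RHS](addrC (_ * b _ _)).
Qed.

Lemma bump_neq0 k a b x : 0 < k -> bump k a b x != 0 -> rect a b x.
Proof.
move=> k0 /prodf_neq0 H i; have := H i isT.
rewrite mulf_eq0 negb_or /flat => /andP[].
case: ifPn => [+ _|]; last by rewrite eqxx.
case: ifPn => [+ + _|]; last by rewrite eqxx.
rewrite mulNr addrC !subr_gt0 !(ltr_pM2l k0) => -> ->; exact.
Qed.

End bumps.

Section vanishing.
Context {R : realType} {n : nat}.
Local Notation V := 'rV[R]_n.
Local Notation mu := (@lebesgue_rV R n).
Implicit Types (x a b : V) (u v h : V -> R) (U : set V).

Definition test_in U u := [/\ rschwartz u, compact (closure [set x | u x != 0]) &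
  closure [set x | u x != 0] `<=` U].

Lemma closed_cbox a (r : R) : closed (cbox a r).
Proof.
rewrite (_ : cbox a r = \bigcap_(i in [set: 'I_n])
   ((fun x : V => `|x ord0 i - a ord0 i|) @^-1` [set t : R | t <= r])); last first.
  by apply/seteqP; split=> x h i; [move=> _; exact: h|exact: (h i I)].
apply: closed_bigI => i _; apply: preimage_closed; last exact: closed_le.
move=> x _; apply: (@continuous_comp _ _ _ (fun x : V => x ord0 i - a ord0 i) Num.norm).
  by apply: continuousB; [exact: coord_continuous|exact: cst_continuous].
exact: norm_continuous.
Qed.

Lemma compact_cbox a (r : R) : compact (cbox a r).
Proof.
apply: (bounded_closed_compact _ (@closed_cbox a r)).
exists (`|a| + `|r|); split; first exact: num_real.
move=> M aM x xa; apply: ltW; apply: le_lt_trans aM.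
rewrite -[`|x|]/(mx_norm x) mx_normrE; apply: bigmax_le => [|[i j] _ /=]; first by rewrite addr_ge0.
rewrite (ord1 i) -[x ord0 j](subrK (a ord0 j)) addrC.
apply: (le_trans (ler_normD _ _)); apply: lerD; first exact: normr_coord_le.
by apply: le_trans (xa j) _; exact: ler_norm.
Qed.

(** The first bump keeps the support in a closed box inside [U]; the second one,
    on an arbitrary rectangle, is what tests a function there. *)
Lemma test_bump U q a b (k : R) u : rat_cbox q `<=` U -> 0 < k -> rschwartz u ->
  test_in U (fun x => bump k (\row_i (map_mx ratr q.1 ord0 i - q.2.+1%:R^-1))
     (\row_i (map_mx ratr q.1 ord0 i + q.2.+1%:R^-1)) x * (bump k a b x * u x)).
Proof.
move=> qU k0 su; set w := (fun x => _).
have sub : closure [set x | w x != 0] `<=` rat_cbox q.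
  rewrite [X in _ `<=` X](closure_id _).1; last exact: closed_cbox.
  apply: closure_subset => x /=; rewrite mulf_eq0 negb_or => /andP[/(bump_neq0 k0) + _].
  by rewrite -box_rect => xq i; exact: ltW (xq i).
split.
- by do 2 apply: rschwartzM (mult_bump _ _ _) _.
- by apply: (subclosed_compact _ (@compact_cbox _ _) sub); exact: closed_closure.
- exact: subset_trans sub qU.
Qed.

(** Countably many rational boxes suffice. *)
Lemma ae_local (W P : set V) :
  (forall x, W x -> exists2 q, rat_box q x & {ae mu, forall y, rat_box q y -> P y}) ->
  {ae mu, forall x, W x -> P x}.
Proof.
move=> WP; pose good q := {ae mu, forall y, rat_box q y -> P y}.
pose N k : set V := if unpickle k is Some q then
    (if `[< good q >] then [set x | rat_box q x /\ ~ P x] else set0) else set0.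
have : mu.-negligible (\bigcup_k N k).
  apply: negligible_bigcup => k; rewrite /N; case: unpickle => [q|]; last exact: negligible_set0.
  case: ifPn => [/asboolP|_]; last exact: negligible_set0.
  by apply: negligibleS => x /= [xq Px] /(_ xq).
apply: negligibleS => x /= /not_implyP[Wx Px].
have [q qx Pq] := WP x Wx; exists (pickle q) => //.
by rewrite /N pickleK asboolT.
Qed.

(** The fundamental lemma of the calculus of variations. Testing against bumps
    that increase to the indicator of a rectangle shows that the integral of
    [h], weighted by a Gaussian, is zero over each rectangle contained in a
    small box; by Dynkin's lemma it is zero over each measurable part of the
    box. *)
Lemma ae_vanish U h : open U -> testable h ->
  (forall u, test_in U u -> \int[mu]_x (h x * u x) = 0) ->
  {ae mu, forall x, U x -> h x = 0}.
Proof.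
move=> oU [mh th] hU.
suff H q : rat_cbox q `<=` U -> {ae mu, forall x, rat_box q x -> h x = 0}.
  by apply: ae_local => x /(open_rat_box oU)[q qU qx]; exists q => //; exact: H.
move=> qU; set a0 := \row_i (map_mx ratr q.1 ord0 i - q.2.+1%:R^-1) : V.
set b0 := \row_i (map_mx ratr q.1 ord0 i + q.2.+1%:R^-1) : V.
have qE : rat_box q = rect a0 b0 by exact: box_rect.
have mR a b : measurable (rect a b) by rewrite measurable_rects; apply: sub_sigma_algebra; exists a, b.
pose g x := h x * gauss 1 x.
have ig : lint mu g by apply: th; exact: rschwartz_gauss.
pose g1 x := \1_(rect a0 b0) x * g x.
have ind1 (A : set V) x : `|\1_A x : R| <= 1 by rewrite indicE; case: (_ \in _); rewrite ?normr1 ?normr0.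
have ig1 : lint mu g1 by exact: lintM (ind1 _) ig.
have key a b : (\int[mu]_(x in rect a b) (g1 x)%:E = 0)%E.
  pose w (j : nat) x := h x * (bump j.+1%:R a0 b0 x * (bump j.+1%:R a b x * gauss 1 x)).
  have [|||||_ _] := @dominated_convergence _ _ _ mu setT measurableT (fun j x => (w j x)%:E)
     (fun x => (\1_(rect a b) x * g1 x)%:E) (fun x => `|g x|%:E).
  - move=> j; apply/measurable_EFinP; apply: measurable_funM => //; apply: rschwartz_measurable.
    by do 2 apply: rschwartzM (mult_bump _ _ _) _; exact: rschwartz_gauss.
  - by apply/measurable_EFinP; apply: measurable_funM; [exact: measurable_indic|exact: lint_measurable ig1].
  - apply: aeW => x _; apply: cvg_EFin; first exact: nearW.
    rewrite (_ : _ \o _ = (fun j : nat => bump j.+1%:R a b x * (bump j.+1%:R a0 b0 x * g x))); last first.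
      by apply/funext => j; rewrite /= /w /g; ring.
    by apply: cvgM; [exact: bump_cvg|apply: cvgM; [exact: bump_cvg|exact: cvg_cst]].
  - exact: lint_norm.
  - apply: aeW => x j _; rewrite /= lee_fin /w /g !normrM.
    rewrite (_ : _ * _ = `|bump j.+1%:R a0 b0 x| * `|bump j.+1%:R a b x| * (`|h x| * `|gauss 1 x|)); last by ring.
    apply: ler_piMl; first exact: mulr_ge0.
    by rewrite mulr_ile1// ger0_norm ?bump_ge0 ?bump_le1.
  rewrite (_ : (fun j => _) = cst 0%E); last first.
    apply/funext => j /=; rewrite lint_EFin.
      rewrite hU//; apply: test_bump => //; exact: rschwartz_gauss.
    by apply: th; do 2 apply: rschwartzM (mult_bump _ _ _) _; exact: rschwartz_gauss.
  move=> H; have <- := cvg_unique (@ereal_hausdorff R) H (@cvg_cst _ 0%E nat _ _).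
  rewrite [LHS]integral_mkcond; apply: eq_integral => x _.
  by rewrite patchE indicE; case: (_ \in _); rewrite ?mul1r ?mul0r.
have tot : (\int[mu]_x (g1 x)%:E = 0)%E.
  rewrite -(key a0 b0) [RHS]integral_mkcond; apply: eq_integral => x _.
  by rewrite patchE /g1 indicE; case: (_ \in _); rewrite ?mul1r ?mul0r.
have all0 A : measurable A -> (\int[mu]_(x in A) (g1 x)%:E = 0)%E.
  rewrite measurable_rects; apply: (dynkin_induction (P := fun A => (\int[mu]_(x in A) (g1 x)%:E = 0)%E)).
  - exact: measurable_rects.
  - exact: rectsI.
  - exact: tot.
  - by move=> _ [a [b ->]]; exact: key.
  - move=> S mS S0; have := tot; rewrite -(setUv S) integral_setU//.
    + by rewrite S0 add0e.
    + exact: measurableC.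
    + by apply: measurable_funTS; exact: measurable_int ig1.
    + exact/disj_setPCl.
  - move=> F mF tF F0; rewrite integral_bigcup//; first by rewrite eseries0.
    by apply: integrableS ig1 => //; exact: bigcupT_measurable.
have H : ae_eq mu setT (EFin \o g1) (cst 0%E).
  apply: (integral_ae_eq measurableT ig1) => [|E _ mE]; first exact: measurable_cst.
  by rewrite all0// integral0.
apply: filterS H => x /(_ I) /= [g0] xq; move: g0.
rewrite /g1 indicE -qE mem_set// mul1r /g => /eqP; rewrite mulf_eq0 => /orP[/eqP//|].
by rewrite gt_eqF// expR_gt0.
Qed.

End vanishing.

(** * Functions that represent a distribution *)

Section representation.
Context {R : realType} {n : nat}.
Local Notation V := 'rV[R]_n.
Local Notation mu := (@lebesgue_rV R n).
Implicit Types (x y xi : V) (u v p q k : V -> R) (f h : V -> R[i]) (phi : schwartz R n).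
Implicit Types w : functional R n.

Definition of_real u : schwartz R n := to_schwartz (fun x => (u x)%:C).

Lemma of_realE u : rschwartz u -> of_real u = (fun x => (u x)%:C) :> (V -> R[i]).
Proof. by move=> su; apply: to_schwartzE => //; exact: rschwartz0. Qed.

Lemma represents_testable w h : represents w h ->
  testable (@Re R \o h) /\ testable (@Im R \o h).
Proof.
move=> [[mr mi] ih _]; split; split=> // u su.
  have [+ _] := ih (of_real u); rewrite of_realE//; congr (_.-integrable _ _).
  by apply/funext => x /=; rewrite ReM /= mulr0 subr0.
have [_] := ih (of_real u); rewrite of_realE//; congr (_.-integrable _ _).
by apply/funext => x /=; rewrite ImM /= mulr0 add0r.
Qed.

Lemma represents_vanish w h (U : set V) : open U -> represents w h ->
  (forall phi, compact (closure [set y | phi y != 0]) ->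
     closure [set y | phi y != 0] `<=` U -> w phi = 0) ->
  {ae mu, forall x, U x -> h x = 0}.
Proof.
move=> oU wh w0; have [tr ti] := represents_testable wh; have [_ _ wE] := wh.
have T u : test_in U u -> \int[mu]_x (Re (h x) * u x) = 0 /\ \int[mu]_x (Im (h x) * u x) = 0.
  move=> [su cu Uu].
  have E : [set y | of_real u y != 0] = [set y | u y != 0].
    by rewrite of_realE//; apply/seteqP; split=> y /=; rewrite eq_complex /= eqxx andbT.
  have := w0 (of_real u); rewrite E => /(_ cu Uu); rewrite wE /dist_of /cintegral => -[H1 H2].
  split; [rewrite -[RHS]H1|rewrite -[RHS]H2]; apply: eq_Rintegral => x _; rewrite of_realE//.
    by rewrite ReM /= mulr0 subr0.
  by rewrite ImM /= mulr0 add0r.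
have := ae_vanish oU tr (fun u tu => (T u tu).1); have := ae_vanish oU ti (fun u tu => (T u tu).2).
apply: filterS2 => x H1 H2 Ux; apply: complex_eqP; [exact: H2|exact: H1].
Qed.

Lemma represents_unique w h1 h2 : represents w h1 -> represents w h2 ->
  {ae mu, forall x, h1 x = h2 x}.
Proof.
move=> r1 r2; have := represents_vanish openT (representsB r1 r2).
have -> : w - w = 0 by exact: subrr.
move=> /(_ (fun _ _ _ => erefl)); apply: filterS => x /(_ I) /eqP.
by rewrite [X in X == _]/(h1 x - h2 x) subr_eq0 => /eqP.
Qed.

End representation.

Section norms.
Context d {T : measurableType d} {R : realType} (nu : {measure set T -> \bar R}).

Lemma Lnorm_ae_eq (p : \bar R) (f g : T -> \bar R) :
  measurable_fun setT f -> measurable_fun setT g ->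
  {ae nu, forall x, f x = g x} -> Lnorm nu p f = Lnorm nu p g.
Proof.
move=> mf mg fg; rewrite unlock /Lnorm; case: p => [r||].
- congr (_ `^ _)%E; apply: ae_eq_integral => //.
  + by apply: (@measurableT_comp _ _ _ _ _ _ (fun x => x `^ r)%E); [exact: measurable_poweR|exact: measurableT_comp].
  + by apply: (@measurableT_comp _ _ _ _ _ _ (fun x => x `^ r)%E); [exact: measurable_poweR|exact: measurableT_comp].
  + by apply: filterS fg => x /= ->.
- by case: ifP => // _; apply: eq_ess_sup; apply: filterS fg => x /= ->.
- by case: ifP => // _; apply: eq_ess_inf; apply: filterS fg => x /= ->.
Qed.

End norms.

Section distribution_norms.
Context {R : realType} {n : nat}.
Local Notation V := 'rV[R]_n.
Local Notation mu := (@lebesgue_rV R n).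
Implicit Types (x y xi : V) (f h : V -> R[i]) (w : functional R n).

Lemma measurable_normc_EFin h : cmeasurable h -> measurable_fun setT (fun x => (normc (h x))%:E).
Proof. by move=> mh; apply/measurable_EFinP; exact: measurable_normc. Qed.

(** All representing functions agree almost everywhere, so the infimum is over
    one value. *)
Lemma dLnormE p w h : represents w h -> dLnorm p w = cLnorm mu p h.
Proof.
move=> wh; have [mh _ _] := wh.
rewrite /dLnorm (_ : [set _ | _ in _] = [set cLnorm mu p h]) ?ereal_inf1//.
apply/seteqP; split=> [_ [k wk <-]|_ ->]; last by exists h.
have [mk _ _] := wk; apply: Lnorm_ae_eq; [exact: measurable_normc_EFin..|].
by apply: filterS (represents_unique wk wh) => x ->.
Qed.

Lemma represents_fourier_hat w h : represents (dfourier w) h ->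
  represents (dfourier w) (fourier_hat w).
Proof. by move=> wh; rewrite /fourier_hat; apply: xgetPex; exists h. Qed.

Lemma fourier_hat_dsupp w h : represents (dfourier w) h ->
  {ae mu, forall x, (~` dsupp (dfourier w)) x -> fourier_hat w x = 0}.
Proof.
move=> /represents_fourier_hat wh; apply: ae_local => x; rewrite /dsupp setCK => -[U [oU Ux U0]].
have [q qU qx] := open_rat_box oU Ux; exists q => //.
apply: filterS (represents_vanish oU wh U0) => y Hy yq; apply: Hy; apply: qU => i.
exact: ltW (yq i).
Qed.

Lemma closed_dsupp w : closed (dsupp w).
Proof.
apply: open_closedC; pose S U := open U /\ forall phi : schwartz R n,
  compact (closure [set y | phi y != 0]) -> closure [set y | phi y != 0] `<=` U -> w phi = 0.
rewrite (_ : [set x | _] = \bigcup_(U in [set U | S U]) U); first by apply: bigcup_open => U [].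
by apply/seteqP; split=> x [U]; [move=> [oU Ux U0]; exists U|move=> [oU U0] Ux; exists U].
Qed.

End distribution_norms.

Section square_norms.
Context d {T : measurableType d} {R : realType} (nu : {measure set T -> \bar R}).
Implicit Types (u : T -> R) (h : T -> R[i]).

Lemma sqre_poweR (x : \bar R) : (0 <= x -> x ^+ 2 = x `^ 2)%E.
Proof.
case: x => [r||//] r0; last by rewrite /= pnatr_eq0 /= mulyy.
by rewrite poweR_EFin powR_mulrn// EFin_expe.
Qed.

Lemma Lnorm_sqr u :
  (Lnorm nu 2%:E (fun x => (u x)%:E) ^+ 2 = \int[nu]_x ((u x) ^+ 2)%:E)%E.
Proof.
rewrite sqre_poweR ?Lnorm_ge0// poweR_Lnorm ?pnatr_eq0//; apply: eq_integral => x _ /=.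
by rewrite powR_mulrn// real_normK// num_real.
Qed.

Lemma lint2P u : measurable_fun setT u ->
  lint2 nu u <-> (\int[nu]_x ((u x) ^+ 2)%:E < +oo)%E.
Proof.
move=> mu'; have E : (\int[nu]_x `|((u x) ^+ 2)%:E| = \int[nu]_x ((u x) ^+ 2)%:E)%E.
  by apply: eq_integral => x _; rewrite gee0_abs// lee_fin sqr_ge0.
split=> [[_ /integrableP[_]]|H]; first by rewrite /= E.
by split=> //; apply/integrableP; split; [exact/measurable_EFinP/measurable_funX|rewrite /= E].
Qed.

Lemma cLnorm2_lint2 h : cmeasurable h -> (cLnorm nu 2%:E h < +oo)%E ->
  lint2 nu (fun x => normc (h x)) /\ lint2 nu (@Re R \o h) /\ lint2 nu (@Im R \o h).
Proof.
move=> mh hoo; have mn := measurable_normc mh.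
have H : lint2 nu (fun x => normc (h x)).
  apply/(lint2P mn); rewrite -Lnorm_sqr -/(cLnorm nu 2%:E h).
  have := Lnorm_ge0 nu 2%:E (fun x => (normc (h x))%:E); rewrite -/(cLnorm nu 2%:E h).
  by case: (cLnorm _ _ _) hoo => // r _ _; rewrite -EFin_expe ltry.
split=> //; have [mr mi] := mh.
split; apply: lint2_le H => // x /=; rewrite [leRHS]ger0_norm ?modulus_ge0//.
  exact: normc_ge_Re.
exact: normc_ge_Im.
Qed.

End square_norms.

Section sobolev_functions.
Context {R : realType} {n : nat}.
Local Notation V := 'rV[R]_n.
Local Notation mu := (@lebesgue_rV R n).
Implicit Types (x y xi : V) (h : V -> R[i]) (w : functional R n).

Lemma fourier_square_integrable h : lint2 mu (@Re R \o h) -> lint2 mu (@Im R \o h) ->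
  exists2 k, represents (dfourier (dist_of h)) k & lint2 mu (fun x => normc (k x)).
Proof.
move=> lr li; have tr := lint2_testable lr; have ti := lint2_testable li.
have lr' : lint2 mu (fun x => - Re (h x)).
  rewrite (_ : (fun x => _) = (fun x => -1 * Re (h x))); first exact: lint2Z.
  by apply/funext => x; rewrite mulN1r.
have [k1 [l1 _ T1]] : exists k, [/\ lint2 mu k, nrm2 mu k <= 20 * (2 * (nrm2 mu (@Re R \o h) + nrm2 mu (@Im R \o h)) + 1) &
    weak_transform (@Re R \o h) (@Im R \o h) k].
  apply: weak_transform_lint2 => //; last by rewrite lerDl.
  by apply: ltr_wpDl => //; rewrite mulr_ge0// addr_ge0// nrm2_ge0.
have [k2 [l2 _ T2]] : exists k, [/\ lint2 mu k, nrm2 mu k <= 20 * (2 * (nrm2 mu (@Im R \o h) + nrm2 mu (fun x => - Re (h x))) + 1) &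
    weak_transform (@Im R \o h) (fun x => - Re (h x)) k].
  apply: weak_transform_lint2 => //; last by rewrite lerDl.
  by apply: ltr_wpDl => //; rewrite mulr_ge0// addr_ge0// nrm2_ge0.
exists (fun x => k1 x +i* k2 x); first exact: represents_dfourier.
split; first by apply: measurable_normc; split; [exact: l1.1|exact: l2.1].
rewrite (_ : (fun x => _) = (fun x => k1 x ^+ 2 + k2 x ^+ 2)).
  by apply: lintD; [exact: l1.2|exact: l2.2].
by apply/funext => x; rewrite normc_sqr.
Qed.

Lemma bessel_fourier t w h : represents (bessel t w) h ->
  dfourier (dist_of h) = dmul (fun x => japanese x `^ t) (dfourier w).
Proof. by move=> [_ _ <-]; exact: dfourier_bessel. Qed.

Lemma represents_of_bessel t w h k : represents (bessel t w) h ->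
  represents (dfourier (dist_of h)) k -> represents (dfourier w) (japmul (- t) k).
Proof. by move=> /bessel_fourier -> /(represents_japmul (- t)); rewrite dmulK. Qed.

Lemma bessel_fourier_hat t w h k : represents (bessel t w) h ->
  represents (dfourier (dist_of h)) k ->
  represents (dfourier w) (fourier_hat w) /\
  {ae mu, forall x, japmul t (fourier_hat w) x = k x}.
Proof.
move=> wh hk; have wF := represents_fourier_hat (represents_of_bessel wh hk); split => //.
have := represents_japmul t wF; rewrite -(bessel_fourier wh) => H.
exact: represents_unique H hk.
Qed.

Section element.
Variables (s : R) (f : sobolev R n s).

Definition weight x : R := japanese x `^ s * normc (fourier_hat f x).

Lemma normc_japmul t h x : normc (japmul t h x) = japanese x `^ t * normc (h x).
Proof.
by rewrite /japmul normcM /= expr0n addr0 sqrtr_sqr ger0_norm// powR_ge0.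
Qed.

Lemma sobolev_hat : represents (dfourier f) (fourier_hat f) /\ lint2 mu weight.
Proof.
have := valP f; rewrite inE => -[_ [h fh hoo]].
have [mh _ _] := fh; have [_ [lr li]] := cLnorm2_lint2 mh hoo.
have [k hk lk] := fourier_square_integrable lr li.
have [fF fk] := bessel_fourier_hat fh hk; split=> //.
have mW : measurable_fun setT weight.
  apply: measurable_funM; first exact: measurable_japanese_powR.
  by apply: measurable_normc; case: fF.
apply/(lint2P _ mW); have [mk _] := lk.
rewrite (ae_eq_integral (fun x => (normc (k x) ^+ 2)%:E)) //.
- exact/(lint2P _ mk).
- exact/measurable_EFinP/measurable_funX.
- exact/measurable_EFinP/measurable_funX.
- by apply: filterS fk => x /= <- _; rewrite normc_japmul.
Qed.

Lemma sobolev_norm_sqr : (sobolev_norm f ^+ 2 = \int[mu]_x (weight x ^+ 2)%:E)%E.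
Proof.
rewrite -Lnorm_sqr /sobolev_norm /cLnorm; congr (Lnorm _ _ _ ^+ 2)%E.
by apply/funext => x; rewrite /weight -normc_japmul.
Qed.

End element.
End sobolev_functions.

(** * Reduction to the common support *)

Section reduction.
Context {R : realType} {n : nat} {s : R}.
Local Notation V := 'rV[R]_n.
Local Notation mu := (@lebesgue_rV R n).
Local Notation Hs := (sobolev R n s).
Implicit Types (P Q : Hs -> Hs) (f g u v : Hs) (x : V).

Lemma measurable_weight f : measurable_fun setT (weight f).
Proof. exact: (sobolev_hat f).2.1. Qed.

Lemma measurable_weight_sqr f : measurable_fun setT (fun x => (weight f x ^+ 2)%:E).
Proof. by apply/measurable_EFinP; apply: measurable_funX; exact: measurable_weight. Qed.

Lemma fourier_hatB u v :
  {ae mu, forall x, fourier_hat (u - v)%R x = fourier_hat u x - fourier_hat v x}.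
Proof.
have [ru _] := sobolev_hat u; have [rv _] := sobolev_hat v.
have [ruv _] := sobolev_hat (u - v).
have E : dfourier (u - v)%R = dfourier u - dfourier v.
  by rewrite [sobolev_dist (u - v)](raddfB val).
rewrite {1}E in ruv.
exact: represents_unique ruv (representsB ru rv).
Qed.

Lemma sobolev_norm_group P u : fourier_group P ->
  (sobolev_norm (P u) ^+ 2 = sobolev_norm u ^+ 2)%E.
Proof.
move=> [_ _ /(_ u) H]; rewrite !sobolev_norm_sqr; apply: ae_eq_integral => //.
- exact: measurable_weight_sqr.
- exact: measurable_weight_sqr.
- by apply: filterS H => x /= E _; rewrite /weight E.
Qed.

Lemma quotient_dist_ge0 (G : set (Hs -> Hs)) f g : (0 <= quotient_dist G f g)%E.
Proof. by apply: le_ereal_inf_tmp => _ [P _ <-]; exact: Lnorm_ge0. Qed.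

(** Elements of the group preserve the norm, so the distance is at most the
    norm of [P f - Q g], which is that of [f - P^-1 Q g]. *)
Lemma quotient_dist_le (G : set (Hs -> Hs)) f g P Q : is_subgroup G -> G P -> G Q ->
  (quotient_dist G f g ^+ 2 <= sobolev_norm (P f - Q g)%R ^+ 2)%E.
Proof.
move=> [GF _ GM GV] GP GQ; have GP' := GF _ GP; have [[P' PK KP] PD _] := GP'.
have P0 : P 0 = 0 by apply: (addrI (P 0)); rewrite -PD !addr0.
have PN v : P (- v) = - P v by apply/eqP; rewrite -addr_eq0 -PD addNr P0.
have -> : P f - Q g = P (f - P' (Q g)) by rewrite PD PN KP.
rewrite sobolev_norm_group// lee_sqr ?quotient_dist_ge0 ?Lnorm_ge0//.
apply: ereal_inf_lbound; exists (P' \o Q) => //.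
by apply: GM => //; exact: GV GP PK KP.
Qed.

Lemma normc_sub_sqr (z w : R[i]) : z = 0 \/ w = 0 ->
  normc (z - w) ^+ 2 = (normc z - normc w) ^+ 2.
Proof.
move=> [->|->]; first by rewrite sub0r normcN normc0 sub0r sqrrN.
by rewrite subr0 normc0 subr0.
Qed.

Definition common_supp f g : set V := dsupp (dfourier f) `&` dsupp (dfourier g).

Lemma measurable_common_supp f g : measurable (common_supp f g).
Proof.
have mS (w : functional R n) : measurable (dsupp w).
  rewrite -[dsupp w]setCK; apply: measurableC; apply: measurable_open.
  by apply: closed_openC; exact: closed_dsupp.
by apply: measurableI.
Qed.

(** Off the common support one of the two transforms is zero, and there the
    difference of the transforms has the modulus of the difference of their
    moduli. *)
Lemma sobolev_norm_sub_le P Q f g : fourier_group P -> fourier_group Q ->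
  (sobolev_norm (P f - Q g)%R ^+ 2 <=
   \int[mu]_x ((japanese x `^ s * (normc (fourier_hat f x) - normc (fourier_hat g x))) ^+ 2)%:E +
   \int[mu]_x (\1_(common_supp f g) x * weight (P f - Q g)%R x ^+ 2)%:E)%E.
Proof.
move=> [_ _ /(_ f) Hf] [_ _ /(_ g) Hg]; rewrite sobolev_norm_sqr.
have mA := measurable_common_supp f g.
have mf := measurable_weight f; have mg := measurable_weight g.
have m1 : measurable_fun setT (fun x => (japanese x `^ s * (normc (fourier_hat f x) - normc (fourier_hat g x))) ^+ 2).
  rewrite (_ : (fun x => _) = (fun x => (weight f x - weight g x) ^+ 2)).
    by apply: measurable_funX; exact: measurable_funB.
  by apply/funext => x; rewrite /weight mulrBr.
have m2 : measurable_fun setT (fun x => \1_(common_supp f g) x * weight (P f - Q g) x ^+ 2).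
  by apply: measurable_funM; [exact: measurable_indic|apply: measurable_funX; exact: measurable_weight].
rewrite -ge0_integralD//; last first.
- exact/measurable_EFinP.
- by move=> x _; rewrite lee_fin mulr_ge0// sqr_ge0.
- exact/measurable_EFinP.
- by move=> x _; rewrite lee_fin sqr_ge0.
apply: ae_ge0_le_integral => //.
- by move=> x _; rewrite lee_fin sqr_ge0.
- exact: measurable_weight_sqr.
- by move=> x _; rewrite -EFinD lee_fin addr_ge0 ?sqr_ge0// mulr_ge0// sqr_ge0.
- by apply: emeasurable_funD; exact/measurable_EFinP.
have Df := fourier_hat_dsupp (sobolev_hat f).1; have Dg := fourier_hat_dsupp (sobolev_hat g).1.
apply: filterS3 (fourier_hatB (P f) (Q g)) (filterI Hf Hg) (filterI Df Dg).
move=> x /= EB [Ef Eg] [Zf Zg] _; rewrite -EFinD lee_fin.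
rewrite indicE; case: (boolP (x \in _)) => [_|]; first by rewrite mul1r lerDr sqr_ge0.
rewrite notin_setE => /not_andP xA; rewrite mul0r addr0 /weight EB !exprMn Ef Eg ler_wpM2l ?sqr_ge0//.
rewrite normc_sub_sqr//; case: xA => [/Zf|/Zg] E0; [left|right]; apply: eq0_normc.
  by rewrite -Ef E0 normc0.
by rewrite -Eg E0 normc0.
Qed.

End reduction.

(** * Weighted norm inequalities *)

Section weighted_hoelder.
Context d {T : measurableType d} {R : realType} (nu : {measure set T -> \bar R}).
Implicit Types (m u v : T -> R) (p : R).
Local Open Scope ereal_scope.

Lemma sqre_EFin (r : R) : (r ^+ 2)%:E = r%:E ^+ 2.
Proof. by rewrite EFin_expe. Qed.

Lemma ae_le_Lnormy (u : T -> R) : 0 < nu setT ->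
  {ae nu, forall x, `|u x|%:E <= Lnorm nu +oo (fun x => (u x)%:E)}.
Proof.
move=> nu0; rewrite unlock /Lnorm nu0.
by apply: filterS (ess_sup_ge nu (abse \o (fun x => (u x)%:E))) => x.
Qed.

Lemma Lnorm_scale (q : \bar R) (a : R) u : measurable_fun setT u -> 0 < q -> (0 <= a)%R ->
  Lnorm nu q (fun x => (a * u x)%:E) = a%:E * Lnorm nu q (fun x => (u x)%:E).
Proof.
move=> mu' q0 a0; rewrite unlock /Lnorm; case: q q0 => [r||//]; last first.
  move=> _; case: ifP => nu0; last by rewrite mule0.
  rewrite -ess_supZl//; congr (ess_sup _ _); apply/funext => x /=.
  by rewrite normrM (ger0_norm a0) EFinM.
rewrite lte_fin => r0.
rewrite (_ : \int[nu]_x _ = (a `^ r)%:E * \int[nu]_x (`|(u x)%:E| `^ r)).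
  rewrite poweRM ?lee_fin ?powR_ge0//; last by apply: integral_ge0 => x _; exact: poweR_ge0.
  by rewrite poweR_EFin -powRrM mulfV ?gt_eqF// powRr1.
rewrite -ge0_integralZl//.
- by apply: eq_integral => x _; rewrite /= normrM (ger0_norm a0) powRM.
- apply/measurable_EFinP; apply: (measurableT_comp (measurable_powR _)).
  exact: measurableT_comp.
- by move=> x _; exact: poweR_ge0.
- by rewrite lee_fin powR_ge0.
Qed.

Lemma hoelder_exponent1 : hoelder_exponent (1 : R) = 1.
Proof.
rewrite /hoelder_exponent eq_sym -subr_eq0 (_ : 2 - 1 = 1 :> R)%R; last by ring.
by rewrite oner_eq0 divr1.
Qed.

Lemma hoelder_conjugateE p : (1 < p)%R -> hoelder_conjugate p%:E = (p / (p - 1))%:E.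
Proof.
move=> p1; rewrite /hoelder_conjugate /= eqe gt_eqF ?(lt_trans _ p1)//.
by rewrite -EFinD inver subr_eq0 gt_eqF// EFinM.
Qed.

(** Hölder's inequality for the exponents [p / (2 - p)] and [p' / 2], which
    are conjugate. *)
Lemma hoelder_weight p m v : (1 <= p <= 2)%R -> 0 < nu setT ->
  measurable_fun setT m -> measurable_fun setT v -> (forall x, 0 <= m x)%R ->
  \int[nu]_x (m x * v x ^+ 2)%:E <=
  Lnorm nu (hoelder_exponent p) (fun x => (m x)%:E) *
  Lnorm nu (hoelder_conjugate p%:E) (fun x => (v x)%:E) ^+ 2.
Proof.
move=> /andP[p1 p2] nu0 mm mv m0.
have mm' : measurable_fun setT (fun x => (m x)%:E) by exact/measurable_EFinP.
have mv2 : measurable_fun setT (fun x => (v x ^+ 2)%R) by exact: measurable_funX.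
have mv2' : measurable_fun setT (fun x => (v x ^+ 2)%:E) by exact/measurable_EFinP.
have mmv : measurable_fun setT (fun x => (m x * v x ^+ 2)%:E).
  by apply/measurable_EFinP; exact: measurable_funM.
have mv0 x : (0 <= m x * v x ^+ 2)%R by rewrite mulr_ge0// sqr_ge0.
have [{p1 p2}->|pn1] := eqVneq p 1%R.
  rewrite hoelder_exponent1 hoelder_conjugate1 Lnorm1.
  have N0 := Lnorm_ge0 nu +oo (fun x => (v x)%:E).
  have N20 := expe_ge0 2 N0.
  have -> : \int[nu]_x `|(m x)%:E| = \int[nu]_x (m x)%:E.
    by apply: eq_integral => x _; rewrite gee0_abs// lee_fin.
  rewrite -ge0_integralZr//; last by move=> x _; rewrite lee_fin.
  apply: ae_ge0_le_integral => //.
  - by move=> x _; rewrite lee_fin.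
  - by move=> x _; rewrite mule_ge0// lee_fin.
  - exact: emeasurable_funM.
  apply: filterS (ae_le_Lnormy v nu0) => x vx _; rewrite EFinM lee_wpmul2l ?lee_fin//.
  by rewrite -(real_normK (num_real (v x))) sqre_EFin lee_sqr.
have {pn1} p1 : (1 < p)%R by rewrite lt_neqAle eq_sym pn1.
have p0 : (0 < p)%R by exact: lt_trans p1.
have [->|pn2] := eqVneq p 2%R.
  rewrite /hoelder_exponent eqxx hoelder_conjugate2 Lnorm_sqr.
  rewrite -ge0_integralZl ?Lnorm_ge0//; last by move=> x _; rewrite lee_fin sqr_ge0.
  apply: ae_ge0_le_integral => //.
  - by move=> x _; rewrite lee_fin.
  - by move=> x _; rewrite mule_ge0 ?Lnorm_ge0// lee_fin sqr_ge0.
  - by apply: emeasurable_funM => //; exact: measurable_cst.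
  apply: filterS (ae_le_Lnormy m nu0) => x mx _.
  by rewrite EFinM lee_wpmul2r ?lee_fin ?sqr_ge0// (le_trans _ mx)// lee_fin ler_norm.
have {pn2} p2 : (p < 2)%R by rewrite lt_neqAle pn2.
have p10 : (0 < p - 1)%R by rewrite subr_gt0.
have p20 : (0 < 2 - p)%R by rewrite subr_gt0.
rewrite /hoelder_exponent lt_eqF// hoelder_conjugateE//.
set r := (p / (2 - p))%R; set q := (p / (p - 1))%R.
have r0 : (0 < r)%R by rewrite divr_gt0.
have q0 : (0 < q)%R by rewrite divr_gt0.
have rq : (r^-1 + (q / 2)^-1 = 1)%R.
  by rewrite /r /q; field; rewrite !gt_eqF.
have := hoelder nu mm mv2 r0 (divr_gt0 q0 (ltr0n R 2)) rq.
rewrite Lnorm1 [X in X <= _](_ : _ = \int[nu]_x (m x * v x ^+ 2)%:E); last first.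
  by apply: eq_integral => x _ /=; rewrite ger0_norm.
move=> /le_trans; apply; apply: lee_wpmul2l; first exact: Lnorm_ge0.
rewrite sqre_poweR ?Lnorm_ge0// unlock /Lnorm -poweRrM invfM invrK.
rewrite (_ : \int[nu]_x _ = \int[nu]_x (`|(v x)%:E| `^ q)); first by rewrite lexx.
apply: eq_integral => x _ /=; congr EFin.
rewrite ger0_norm ?sqr_ge0// -(real_normK (num_real (v x))) -powR_mulrn// -powRrM.
by congr (_ `^ _)%R; field.
Qed.

End weighted_hoelder.

(** * The constant of the Fourier transform *)

Section fourier_constant.
Context {R : realType} {n : nat}.
Local Notation V := 'rV[R]_n.
Local Notation mu := (@lebesgue_rV R n).
Implicit Types (x : V) (h v : V -> R[i]) (w : functional R n) (p : R).

Lemma lebesgue_rV_gt0 : (0 < mu setT)%E.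
Proof.
rewrite lt0e measure_ge0 andbT; apply/eqP => mu0.
have := @gauss_mass_gt0 R n 1 ltr01; rewrite -integral_gauss// /Rintegral.
rewrite (_ : (\int[mu]_x _)%E = 0%E) ?ltxx//.
by apply: null_set_integral => //; exact: (measurable_int mu (lint_gauss ltr01)).
Qed.

Lemma ae_neg (P : V -> Prop) : (forall x, ~ P x) -> ~ {ae mu, forall x, P x}.
Proof.
move=> nP aP; have : mu.-negligible setT by apply: negligibleS aP => x _; exact: nP.
by move=> /(negligibleP mu measurableT) mu0; have := lebesgue_rV_gt0; rewrite mu0 ltxx.
Qed.

Lemma representsZ (a : R) w h : represents w h ->
  represents (fun phi => a%:C * w phi) (fun x => a%:C * h x).
Proof.
move=> [[mr mi] ih wE]; split.
- split.
    rewrite (_ : _ \o _ = (fun x => a * Re (h x))); first exact: measurable_funM.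
    by apply/funext => x /=; rewrite Re_realM.
  rewrite (_ : _ \o _ = (fun x => a * Im (h x))); first exact: measurable_funM.
  by apply/funext => x /=; rewrite Im_realM.
- move=> phi; have [ir ii] := ih phi; split.
    rewrite (_ : _ \o _ = EFin \o (fun x => a * Re (h x * phi x))); first exact: lintZ.
    by apply/funext => x /=; rewrite -mulrA Re_realM.
  rewrite (_ : _ \o _ = EFin \o (fun x => a * Im (h x * phi x))); first exact: lintZ.
  by apply/funext => x /=; rewrite -mulrA Im_realM.
- apply/funext => phi; have [ir ii] := ih phi; rewrite wE /dist_of /cintegral.
  apply: complex_eqP; rewrite ?Re_realM ?Im_realM /= -rintZ//; apply: eq_Rintegral => x _.
    by rewrite -mulrA Re_realM.
  by rewrite -mulrA Im_realM.
Qed.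

Lemma cLnormZ (q : \bar R) (a : R) h : cmeasurable h -> (0 < q)%E -> 0 <= a ->
  cLnorm mu q (fun x => a%:C * h x) = (a%:E * cLnorm mu q h)%E.
Proof.
move=> mh q0 a0; rewrite /cLnorm -Lnorm_scale//; last exact: measurable_normc.
by apply: eq_Lnorm => x; rewrite normcM /= expr0n addr0 sqrtr_sqr ger0_norm.
Qed.

Lemma hoelder_conjugate_gt0 p : 1 <= p -> (0 < hoelder_conjugate p%:E)%E.
Proof.
rewrite le_eqVlt => /predU1P[<-|p1]; first by rewrite hoelder_conjugate1.
by rewrite hoelder_conjugateE// lte_fin divr_gt0 ?subr_gt0// (lt_trans _ p1).
Qed.

(** The bound that defines the constant, freed from the normalisation of [h]. *)
Lemma fourier_const_le p w h v : 1 <= p -> represents w h ->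
  represents (dfourier w) v -> (0 < cLnorm mu p%:E h < +oo)%E ->
  (cLnorm mu (hoelder_conjugate p%:E) v ^+ 2 <=
   fourier_const n p * cLnorm mu p%:E h ^+ 2)%E.
Proof.
move=> p1 wh wv /andP[N0 Noo]; have p0 : 0 < p by exact: lt_le_trans p1.
have [mh _ wE] := wh; have [mv _ _] := wv.
have [N NE] : exists N : R, cLnorm mu p%:E h = N%:E.
  by move: N0 Noo; case: (cLnorm _ _ _) => // N _ _; exists N.
rewrite NE lte_fin in N0 *; have iN : 0 <= N^-1 by rewrite invr_ge0 ltW.
set q := hoelder_conjugate _; have q0 : (0 < q)%E by exact: hoelder_conjugate_gt0.
have rh := representsZ N^-1 wh; have rv := representsZ N^-1 wv.
have [mh' _ hE] := rh.
rewrite /fourier_const; set S := ereal_sup _.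
have H : (N^-1%:E * cLnorm mu q v <= S)%E.
  rewrite -(cLnormZ mv q0 iN) -(dLnormE _ rv); apply: ereal_sup_ubound.
  exists (fun x => N^-1%:C * h x); last by rewrite -hE.
  by split=> //; rewrite cLnormZ// NE -EFinM mulVf ?gt_eqF.
have S0 : (0 <= S)%E by apply: le_trans H; rewrite mule_ge0 ?lee_fin// Lnorm_ge0.
have {H} : (cLnorm mu q v <= N%:E * S)%E.
  apply: le_trans (lee_wpmul2l _ H); last by rewrite lee_fin ltW.
  by rewrite muleA -EFinM mulfV ?gt_eqF// mul1e.
rewrite -lee_sqr ?Lnorm_ge0//; last first.
  by rewrite mule_ge0// lee_fin ltW.
by move=> /le_trans; apply; rewrite !expe2 muleACA [leRHS]muleC.
Qed.

Lemma gauss_le1 (a : R) x : 0 <= a -> gauss a x <= 1.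
Proof. by move=> a0; rewrite -expR0 ler_expR oppr_le0 mulr_ge0// dotrV_ge0. Qed.

(** A Gaussian has a nowhere vanishing transform. *)
Lemma fourier_const_gt0 p : 1 <= p -> (0 < fourier_const n p)%E.
Proof.
move=> p1; have p0 : 0 < p by exact: lt_le_trans p1.
pose h := (fun x => (gauss 1 x)%:C) : V -> R[i].
have ig : lint mu (gauss 1) by exact: lint_gauss.
have sg : rschwartz (gauss 1 : V -> R) by exact: rschwartz_gauss.
have i0 : lint mu (cst 0) by exact: lint0.
have iN : lint mu (fun x => - gauss 1 x).
  rewrite (_ : (fun x => _) = (fun x => -1 * gauss 1 x)); first exact: lintZ.
  by apply/funext => x; rewrite mulN1r.
have tg : testable (gauss 1 : V -> R) by exact: lint_testable.
have t0 : testable (cst 0 : V -> R) by exact: lint_testable.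
have mg := rschwartz_measurable sg.
have wh : represents (dist_of h) h.
  split=> //; first by split; [exact: mg|exact: measurable_cst].
  by move=> phi; apply: testable_cintegrable.
have wv := represents_dfourier (h := h) tg t0 (weak_transform_lint ig i0)
  (weak_transform_lint i0 iN).
set v := (fun x => _) in wv.
have v0 x : v x <> 0.
  move=> /(congr1 (@complex.Re R)) /= /eqP; rewrite gt_eqF//.
  have -> : sinT (cst 0) x = 0.
    rewrite /sinT /ctrans; under eq_Rintegral do rewrite mulr0.
    by rewrite /Rintegral integral0 mulr0.
  rewrite addr0 /cosT ctrans_gauss// cos0 mul1r mulr_gt0 ?powR_gt0 ?mulr_gt0 ?pi_gt0 ?expR_gt0//.
  exact: gauss_mass_gt0.
have nz (k : V -> R[i]) q : (0 < q)%E -> cmeasurable k -> (forall x, k x <> 0) -> (0 < cLnorm mu q k)%E.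
  move=> q0 mk k0; rewrite lt0e Lnorm_ge0 andbT; apply/eqP => /Lnorm_eq0_eq0.
  move=> /(_ (measurable_normc_EFin mk) q0) H; apply: (ae_neg k0).
  by apply: filterS H => x /= /(_ I) -[] /eq0_normc.
rewrite lt0e sqre_ge0 andbT; apply/eqP => c0.
have := fourier_const_le p1 wh wv; rewrite c0 mul0e.
have [mv _ _] := wv; have [mh _ _] := wh.
have := nz v _ (hoelder_conjugate_gt0 p1) mv v0; set N := cLnorm mu (hoelder_conjugate p%:E) v.
move=> N0 H; have : (N ^+ 2 <= 0)%E.
  apply: H; rewrite nz//= ?lte_fin//; last first.
    by move=> x /(congr1 (@complex.Re R)) /= /eqP; rewrite gt_eqF// expR_gt0.
  rewrite /cLnorm unlock /Lnorm; apply: poweR_lty.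
  have /integrableP[_] := ig; apply: le_lt_trans.
  apply: ge0_le_integral => //.
  - by move=> x _; exact: poweR_ge0.
  - apply/measurable_EFinP; apply: (measurableT_comp (measurable_powR _)).
    by apply: measurableT_comp => //; exact: measurable_normc mh.
  - by apply: measurableT_comp => //; exact/measurable_EFinP.
  move=> x _; rewrite /= lee_fin expr0n addr0 sqrtr_sqr normr_id ger0_norm ?expR_ge0//.
  rewrite -[leRHS]powRr1 ?expR_ge0//; apply: ger_powR => //.
  by rewrite expR_gt0 gauss_le1.
by apply/negP; rewrite -ltNge expe2 mule_gt0.
Qed.

End fourier_constant.

(** * Finiteness of the weight *)

Section weight_finite.
Context {R : realType} {n : nat}.
Local Notation V := 'rV[R]_n.
Local Notation mu := (@lebesgue_rV R n).
Implicit Types (x : V) (A : set V) (p b : R) (m : V -> R).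
Local Open Scope ereal_scope.

Lemma Lnorm_lty (r : \bar R) m : 0 < r -> measurable_fun setT m -> (forall x, 0 <= m x)%R ->
  (forall q : R, r = q%:E -> \int[mu]_x ((m x) `^ q)%:E < +oo) ->
  (r = +oo -> exists M, forall x, (m x <= M)%R) ->
  Lnorm mu r (fun x => (m x)%:E) < +oo.
Proof.
move=> r0 mm m0 Hq Hoo; rewrite unlock /Lnorm; case: r r0 Hq Hoo => [q||//] r0 Hq Hoo.
  apply: poweR_lty; rewrite (_ : \int[mu]_x _ = \int[mu]_x ((m x) `^ q)%:E); first exact: Hq.
  by apply: eq_integral => x _ /=; rewrite ger0_norm.
rewrite lebesgue_rV_gt0; have [M HM] := Hoo erefl.
apply: (@le_lt_trans _ _ M%:E); last exact: ltey.
by apply/ess_supP; apply: nearW => x /=; rewrite lee_fin ger0_norm.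
Qed.

Lemma hoelder_exponent_cases p : (1 <= p <= 2)%R ->
  (p = 2%R /\ hoelder_exponent p = +oo) \/
  ((p < 2)%R /\ hoelder_exponent p = (p / (2 - p))%:E).
Proof.
move=> /andP[_ p2]; rewrite /hoelder_exponent; case: eqVneq => [->|pn]; [left|right] => //.
by split=> //; rewrite lt_neqAle pn.
Qed.

Lemma hoelder_exponent_gt0 p : (1 <= p <= 2)%R -> 0 < hoelder_exponent p.
Proof.
move=> p12; have [[_ ->]//|[p2 ->]] := hoelder_exponent_cases p12.
have /andP[p1 _] := p12.
by rewrite lte_fin divr_gt0 ?subr_gt0// (lt_le_trans _ p1).
Qed.

Lemma measurable_indic_japanese A b : measurable A ->
  measurable_fun setT (fun x => \1_A x * japanese x `^ b)%R.
Proof.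
by move=> mA; apply: measurable_funM; [exact: measurable_indic|exact: measurable_japanese_powR].
Qed.

Lemma indic_japanese_ge0 A b x : (0 <= \1_A x * japanese x `^ b :> R)%R.
Proof. by rewrite mulr_ge0// powR_ge0. Qed.

Lemma weight_bounded_lty A p b (M : R) : (1 <= p <= 2)%R -> measurable A -> mu A < +oo ->
  (forall x, A x -> japanese x `^ b <= M)%R ->
  Lnorm mu (hoelder_exponent p) (fun x => (\1_A x * japanese x `^ b)%:E) < +oo.
Proof.
move=> p12 mA Aoo AM; have r0 := hoelder_exponent_gt0 p12.
have bM x : (\1_A x * japanese x `^ b <= `|M| * \1_A x)%R.
  rewrite indicE; case: (boolP (x \in A)) => [/set_mem xA|_]; last by rewrite mul0r mulr0.
  by rewrite mul1r mulr1 (le_trans (AM x xA))// ler_norm.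
apply: Lnorm_lty => //.
- exact: measurable_indic_japanese.
- by move=> x; exact: indic_japanese_ge0.
- move=> q qE; have q0 : (0 < q)%R by move: r0; rewrite qE lte_fin.
  apply: (@le_lt_trans _ _ (\int[mu]_x ((`|M| `^ q)%:E * (\1_A x)%:E))).
    apply: ge0_le_integral => //.
    + by move=> x _; rewrite lee_fin powR_ge0.
    + apply/measurable_EFinP; apply: (measurableT_comp (measurable_powR _)).
      exact: measurable_indic_japanese.
    + by apply: emeasurable_funM => //; exact/measurable_EFinP/measurable_indic.
    move=> x _; rewrite -EFinM lee_fin.
    apply: (@le_trans _ _ ((`|M| * \1_A x) `^ q)%R).
      by apply: ge0_ler_powR; rewrite ?nnegrE ?(ltW q0)// ?indic_japanese_ge0 ?mulr_ge0.
    rewrite powRM//; rewrite indicE; case: (_ \in A); first by rewrite powR1.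
    by rewrite powR0 ?gt_eqF.
  rewrite ge0_integralZl//; last exact/measurable_EFinP/measurable_indic.
  by rewrite integral_indic// setIT lte_mul_pinfty// ?lee_fin ?powR_ge0.
- move=> _; exists `|M|%R => x; apply: le_trans (bM x) _.
  by rewrite ler_piMr// indicE; case: (_ \in A).
Qed.

Lemma japanese_powR_le1 b x : (b <= 0 -> japanese x `^ b <= 1 :> R)%R.
Proof. by move=> b0; rewrite -(powRr0 (japanese x)); apply: ler_powR => //; exact: japanese_ge1. Qed.

Lemma compact_dotrV_bounded A : compact A -> exists M : R, forall x, A x -> (dotrV x x <= M)%R.
Proof.
move=> cA; have cd : continuous (fun x : V => dotrV x x).
  by move=> x; exact: has_grad_continuous has_grad_sqr x.
have /(@compact_bounded _ R)[M [_ HM]] := continuous_compact (@continuous_subspaceT _ _ A _ cd) cA.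
exists (M + 1)%R => x xA; apply: le_trans (ler_norm _) _.
by apply: HM; [rewrite ltrDl|exists x].
Qed.

(** On a bounded set the indicator is below a multiple of a Gaussian. *)
Lemma compact_lty A : measurable A -> compact A -> mu A < +oo.
Proof.
move=> mA /compact_dotrV_bounded[M AM].
have iA : mu A = \int[mu]_x (\1_A x)%:E by rewrite integral_indic// setIT.
rewrite iA; apply: (@le_lt_trans _ _ (\int[mu]_x (expR M * gauss 1 x)%:E)).
  apply: ge0_le_integral => //.
  - exact/measurable_EFinP/measurable_indic.
  - by apply/measurable_EFinP; apply: measurable_funM => //; exact: lint_measurable (lint_gauss ltr01).
  move=> x _; rewrite lee_fin indicE; case: (boolP (x \in A)) => [/set_mem xA|_]; last by rewrite mulr_ge0 ?expR_ge0.
  by rewrite -expRD -[leLHS]expR0 ler_expR mul1r subr_ge0 AM.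
by rewrite lint_EFin ?ltey//; apply: lintZ; exact: lint_gauss.
Qed.

Lemma weight_compact_lty A p b : (1 <= p <= 2)%R -> measurable A -> compact A ->
  Lnorm mu (hoelder_exponent p) (fun x => (\1_A x * japanese x `^ b)%:E) < +oo.
Proof.
move=> p12 mA cA; have [M AM] := compact_dotrV_bounded cA.
apply: (@weight_bounded_lty _ _ _ ((1 + M) `^ (`|b| / 2))%R) => // [|x xA].
  exact: compact_lty.
apply: (@le_trans _ _ (japanese x `^ `|b|)%R).
  by apply: ler_powR; [exact: japanese_ge1|exact: ler_norm].
rewrite japanese_powRE; have d0 := dotrV_ge0 x; have dM := AM x xA.
by apply: ge0_ler_powR; rewrite ?nnegrE ?divr_ge0//; lra.
Qed.

(** Raised to the power [p / (2 - p)], the weight decays faster than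
    [<xi>^-n]. *)
Lemma weight_decay_lty A p b : (1 <= p <= 2)%R -> measurable A ->
  (b < - (2 * n%:R * (p^-1 - 2^-1)))%R ->
  Lnorm mu (hoelder_exponent p) (fun x => (\1_A x * japanese x `^ b)%:E) < +oo.
Proof.
move=> p12 mA bn; have r0 := hoelder_exponent_gt0 p12; have /andP[p1 p2] := p12.
have p0 : (0 < p)%R by exact: lt_le_trans p1.
have b0 : (b <= 0)%R.
  apply: (le_trans (ltW bn)); rewrite oppr_le0 mulr_ge0 ?mulr_ge0//.
  by rewrite subr_ge0 lef_pV2 ?posrE.
apply: Lnorm_lty => //.
- exact: measurable_indic_japanese.
- by move=> x; exact: indic_japanese_ge0.
- have [[_ ->]//|[p2' ->]] := hoelder_exponent_cases p12 => _ [<-].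
  have rp : (0 < p / (2 - p))%R by rewrite divr_gt0 ?subr_gt0.
  apply: (@le_lt_trans _ _ (\int[mu]_x (japanese x `^ - (- b * (p / (2 - p))))%:E)).
    apply: ge0_le_integral => //.
    + by move=> x _; rewrite lee_fin powR_ge0.
    + apply/measurable_EFinP; apply: (measurableT_comp (measurable_powR _)).
      exact: measurable_indic_japanese.
    + by apply/measurable_EFinP; exact: measurable_japanese_powR.
    move=> x _; rewrite lee_fin -mulNr opprK [leRHS]powRrM.
    apply: ge0_ler_powR; rewrite ?nnegrE ?(ltW rp) ?indic_japanese_ge0 ?powR_ge0//.
    by rewrite ler_piMl ?powR_ge0// indicE; case: (_ \in A).
  apply: integral_japanese_lty.
  move: bn; rewrite -(ltr_pM2r rp) => bn; rewrite mulNr -ltrN2 opprK; apply: lt_le_trans bn _.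
  rewrite le_eqVlt; apply/orP; left; apply/eqP; field.
  by rewrite subr_eq0 (gt_eqF p2') gt_eqF.
- move=> _; exists 1%R => x; by rewrite mulr_ile1 ?powR_ge0 ?japanese_powR_le1//.
Qed.

End weight_finite.

(** * The estimate on the common support *)

Section support_estimate.
Context {R : realType} {n : nat} {s : R}.
Local Notation V := 'rV[R]_n.
Local Notation mu := (@lebesgue_rV R n).
Local Notation Hs := (sobolev R n s).
Implicit Types (x : V) (u : Hs) (p t : R) (A : set V).

Lemma bessel_normP t (p : \bar R) u : (bessel_norm t p u < +oo)%E ->
  exists2 h, represents (bessel t u) h & cLnorm mu p h = bessel_norm t p u.
Proof.
rewrite /bessel_norm => Noo; have [_ [h uh _] _] := ereal_inf_lt Noo.
by exists h => //; rewrite (dLnormE _ uh).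
Qed.

Lemma measurable_indic_weight A u : measurable A ->
  measurable_fun setT (fun x => (\1_A x * weight u x ^+ 2)%:E).
Proof.
move=> mA; apply/measurable_EFinP; apply: measurable_funM; first exact: measurable_indic.
by apply: measurable_funX; exact: measurable_weight.
Qed.

(** The function that Hölder's inequality leaves, [<xi>^t] times the transform of
    [u], is the transform of the function that represents [bessel t u]. *)
Lemma weight_le A t p u : measurable A -> 1 <= p <= 2 ->
  (0 < bessel_norm t p%:E u < +oo)%E ->
  (\int[mu]_x (\1_A x * weight u x ^+ 2)%:E <=
   fourier_const n p *
   Lnorm mu (hoelder_exponent p) (fun x => (\1_A x * japanese x `^ (2 * s - 2 * t))%:E) *
   bessel_norm t p%:E u ^+ 2)%E.
Proof.
move=> mA p12 /andP[N0 Noo]; have /andP[p1 _] := p12.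
have [h uh hE] := bessel_normP Noo; rewrite -hE in N0 Noo *.
have [uF _] := sobolev_hat u.
have [_ _ hD] := uh.
have wv : represents (dfourier (bessel t u)) (japmul t (fourier_hat u)).
  by rewrite dfourier_bessel; exact: represents_japmul.
have [mv _ _] := wv.
have := fourier_const_le p1 uh wv; rewrite N0 Noo => /(_ isT) H.
rewrite muleAC muleC; apply: le_trans (lee_wpmul2l (Lnorm_ge0 _ _ _) H).
rewrite /cLnorm; apply: le_trans (hoelder_weight p12 lebesgue_rV_gt0 _ (measurable_normc mv) _).
- rewrite le_eqVlt; apply/orP; left; apply/eqP; apply: eq_integral => x _; congr EFin.
  have E : (japanese x `^ s) ^+ 2 = japanese x `^ (2 * s - 2 * t) * (japanese x `^ t) ^+ 2.
    rewrite -!powR_mulrn ?powR_ge0// -!powRrM -powRD ?(gt_eqF (japanese_gt0 x)) ?implybT//.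
    by congr (_ `^ _); ring.
  by rewrite normc_japmul /weight !exprMn E !mulrA.
- exact: measurable_indic_japanese.
- by move=> x; exact: indic_japanese_ge0.
Qed.

End support_estimate.

(** * Convergence of transforms *)

Section fast_null.
Context d {T : measurableType d} {R : realType} (nu : {measure set T -> \bar R}).

Lemma ae_cvg0 (W : nat -> T -> R) (C : R) : 0 <= C -> (forall j, lint2 nu (W j)) ->
  (forall j, nrm2 nu (W j) <= C * 4^-1 ^+ j) ->
  {ae nu, forall x, (W ^~ x) @ \oo --> (0 : R)}.
Proof.
move=> C0 lW HW.
have := @ae_summable _ _ _ nu (fun j x => W j x ^+ 2) C (fun _ _ => sqr_ge0 _) (fun j => (lW j).2).
move=> H; apply: filterS (H _) => {H} [x Fx|j]; last first.
  apply: le_trans (HW j) _; rewrite ler_wpM2l// lerXn2r ?nnegrE ?invr_ge0// lef_pV2 ?posrE//.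
  by rewrite ler_nat.
have [M HM] := nneseries_bounded (fun j => sqr_ge0 (W j x)) Fx.
have cS : cvgn (series (fun j => W j x ^+ 2)).
  apply: nondecreasing_is_cvgn; last by exists M => _ [N _ <-]; exact: HM.
  by apply/nondecreasing_seqP => m; rewrite seriesSr lerDl sqr_ge0.
have /cvgrPdist_lt H := cvg_series_cvg_0 cS.
apply/cvgrPdist_lt => e e0; have := H (e ^+ 2) (exprn_gt0 2 e0).
apply: filterS => j; rewrite !sub0r !normrN normrX.
by rewrite ltr_pXn2r ?nnegrE// ltW.
Qed.

End fast_null.

Section Lp_transform.
Context {R : realType} {n : nat}.
Local Notation V := 'rV[R]_n.
Local Notation mu := (@lebesgue_rV R n).
Local Notation fc := (@fourier_cst R n).
Implicit Types (x : V) (h k : V -> R[i]) (z W : V -> R).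

Lemma lint2_norm z : lint2 mu z -> lint2 mu (fun x => `|z x|).
Proof.
move=> lz; apply: (lint2_le _ _ lz) => [|x]; last by rewrite normr_id.
exact: measurableT_comp lz.1.
Qed.

Section split.
Variables (p e : R) (h : V -> R[i]).
Hypotheses (p12 : 1 <= p <= 2) (e0 : 0 < e) (e1 : e <= 1) (mh : cmeasurable h).
Hypothesis he : (cLnorm mu p%:E h <= e%:E)%E.

Let phi x := normc (h x) `^ p.
Let p1 : 1 <= p. Proof. by case/andP: p12. Qed.
Let p0 : 0 < p. Proof. exact: lt_le_trans p1. Qed.

Let mphi : measurable_fun setT phi.
Proof. by apply: (measurableT_comp (measurable_powR _)); exact: measurable_normc. Qed.

Let phi_le : (\int[mu]_x (phi x)%:E <= e%:E)%E.
Proof.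
have E : (\int[mu]_x (phi x)%:E = cLnorm mu p%:E h `^ p)%E.
  rewrite /cLnorm poweR_Lnorm; last by rewrite gt_eqF.
  apply: eq_integral => x _ /=.
  by rewrite ger0_norm// modulus_ge0.
rewrite E; apply: (@le_trans _ _ (e%:E `^ p)%E).
  apply: gt0_ler_poweR => //; first exact: ltW.
  - by rewrite in_itv/= leey andbT Lnorm_ge0.
  - by rewrite in_itv/= leey andbT lee_fin ltW.
by rewrite poweR_EFin lee_fin -[leRHS]powRr1 ?(ltW e0)// ger_powR// e0.
Qed.

Let phi_lint : lint mu phi.
Proof.
apply/integrableP; split; first exact/measurable_EFinP.
under eq_integral do rewrite /= ger0_norm ?powR_ge0//.
exact: le_lt_trans phi_le (ltey _).
Qed.

Let phi_int : \int[mu]_x phi x <= e.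
Proof. by rewrite -lee_fin -lint_EFin. Qed.

Let small x : R := \1_[set x | normc (h x) <= 1] x.

Let smallE x : small x = (normc (h x) <= 1)%R%:R.
Proof. by rewrite /small indicE mem_setE. Qed.

Let msmall : measurable_fun setT small.
Proof.
apply: measurable_indic; rewrite -[X in measurable X]setTI.
by apply: measurable_fun_le => //; exact: measurable_normc.
Qed.

Let component z : measurable_fun setT z -> (forall x, `|z x| <= normc (h x)) ->
  [/\ lint2 mu (fun x => small x * z x), nrm2 mu (fun x => small x * z x) <= e,
      lint mu (fun x => (1 - small x) * z x) &
      \int[mu]_x `|(1 - small x) * z x| <= e].
Proof.
move=> mz zh.
have mb : measurable_fun setT (fun x => small x * z x) by exact: measurable_funM.
have mg : measurable_fun setT (fun x => (1 - small x) * z x).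
  by apply: measurable_funM => //; exact: measurable_funB.
have bphi x : (small x * z x) ^+ 2 <= phi x.
  rewrite smallE /phi; case: (leP (normc (h x)) 1) => h1; last by rewrite mulr0n mul0r expr0n powR_ge0.
  rewrite mulr1n mul1r -(real_normK (num_real (z x))).
  apply: (@le_trans _ _ (normc (h x) ^+ 2)); first by rewrite lerXn2r ?nnegrE ?modulus_ge0.
  have [->|hn] := eqVneq (normc (h x)) 0; first by rewrite expr0n powR_ge0.
  have hp : 0 < normc (h x) by rewrite lt0r hn modulus_ge0.
  rewrite -powR_mulrn ?modulus_ge0//; apply: ger_powR; first by rewrite hp.
  by case/andP: p12.
have gphi x : `|(1 - small x) * z x| <= phi x.
  rewrite smallE /phi; case: (leP (normc (h x)) 1) => h1; first by rewrite mulr1n subrr mul0r normr0 powR_ge0.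
  rewrite mulr0n subr0 mul1r (le_trans (zh x))//.
  by rewrite -[leLHS]powRr1 ?modulus_ge0//; apply: ler_powR => //; exact: ltW.
have lb : lint mu (fun x => (small x * z x) ^+ 2).
  apply: (lint_le _ _ phi_lint) => [|x]; first exact: measurable_funX.
  by rewrite ger0_norm ?sqr_ge0.
have lg : lint mu (fun x => (1 - small x) * z x) by exact: (lint_le mg gphi phi_lint).
split=> //.
- by apply: le_trans phi_int; apply: le_Rintegral.
- by apply: le_trans phi_int; apply: le_Rintegral => //; exact: lint_norm.
Qed.

(** An [L^p] function, [1 <= p <= 2], is cut at height one into an [L^2] part
    and an [L^1] part, whose norms are both controlled. *)
Lemma Lp_transform : exists k W, [/\ represents (dfourier (dist_of h)) k,
  lint2 mu W, nrm2 mu W <= 320 * e & forall x, normc (k x) <= W x + 4 * fc * e].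
Proof.
have [mr mi] := mh.
have mr' : measurable_fun setT (fun x => - Re (h x)) by exact: measurableT_comp.
have [r1 r2 r3 r4] := component mr (fun x => normc_ge_Re (h x)).
have [i1 i2 i3 i4] := component mi (fun x => normc_ge_Im (h x)).
have [s1 s2 s3 s4] : [/\ lint2 mu (fun x => small x * - Re (h x)), nrm2 mu (fun x => small x * - Re (h x)) <= e,
      lint mu (fun x => (1 - small x) * - Re (h x)) &
      \int[mu]_x `|(1 - small x) * - Re (h x)| <= e].
  by apply: component => // x; rewrite normrN normc_ge_Re.
have E z : (fun x => small x * z x + (1 - small x) * z x) = z.
  by apply/funext => x; ring.
have tr : testable (@Re R \o h).
  by rewrite -(E (@Re R \o h)); apply: testableD; [exact: lint2_testable|exact: lint_testable].
have ti : testable (@Im R \o h).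
  by rewrite -(E (@Im R \o h)); apply: testableD; [exact: lint2_testable|exact: lint_testable].
have [k1 [w1 [T1 l1 n1 d1]]] := weak_transform_split e0 r1 i1 r2 i2 r3 i3 r4 i4.
have [k2 [w2 [T2 l2 n2 d2]]] := weak_transform_split e0 i1 s1 i2 s2 i3 s3 i4 s4.
rewrite !E in T1; rewrite (E (@Im R \o h)) (E (fun x => - Re (h x))) in T2.
exists (fun x => k1 x +i* k2 x), (fun x => `|w1 x| + `|w2 x|); split.
- exact: represents_dfourier.
- by apply: lint2D; [exact: lint2_norm l1|exact: lint2_norm l2].
- apply: (@le_trans _ _ (\int[mu]_x (2 * w1 x ^+ 2 + 2 * w2 x ^+ 2))).
    apply: le_Rintegral => //.
    + exact: (lint2D (lint2_norm l1) (lint2_norm l2)).2.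
    + by apply: lintD; apply: lintZ; [exact: l1.2|exact: l2.2].
    + move=> x _; rewrite -(real_normK (num_real (w1 x))) -(real_normK (num_real (w2 x))).
      by have := sqr_ge0 (`|w1 x| - `|w2 x|); move: `|w1 x| `|w2 x| => a b; nra.
  rewrite rintD; [|apply: lintZ; exact: l1.2|apply: lintZ; exact: l2.2].
  rewrite !rintZ; [|exact: l2.2|exact: l1.2].
  by move: n1 n2; rewrite /nrm2; move: (\int[mu]_x _) (\int[mu]_x _) => a b; lra.
- move=> x; apply: le_trans (normc_le _) _ => /=.
  have h1 : `|k1 x| <= `|w1 x| + 2 * fc * e.
    by rewrite -lerBlDl (le_trans (lerB_dist _ _)).
  have h2 : `|k2 x| <= `|w2 x| + 2 * fc * e.
    by rewrite -lerBlDl (le_trans (lerB_dist _ _)).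
  by have := lerD h1 h2; move: (fc * e) (mulrA 2 fc e) (mulrA 4 fc e) => E' <- <-; lra.
Qed.

End split.
End Lp_transform.

Section null_sequence.
Context {R : realType} {n : nat} {s : R}.
Local Notation V := 'rV[R]_n.
Local Notation mu := (@lebesgue_rV R n).
Local Notation Hs := (sobolev R n s).
Implicit Types (x : V) (u : Hs) (p t : R).

(** Up to a constant of order [4^-j], the transforms are dominated by functions
    whose squared norms are of order [4^-j], which tend to zero almost
    everywhere. *)
Lemma fourier_hat_cvg0 t p (u : nat -> Hs) : 1 <= p <= 2 ->
  (forall j, bessel_norm t p%:E (u j) <= (4^-1 ^+ j)%:E)%E ->
  {ae mu, forall x, (fun j => weight (u j) x) @ \oo --> (0 : R)}.
Proof.
move=> p12 uj.
have H j : exists kW : (V -> R[i]) * (V -> R), [/\ lint2 mu kW.2, nrm2 mu kW.2 <= 320 * 4^-1 ^+ j,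
    forall x, normc (kW.1 x) <= kW.2 x + 4 * @fourier_cst R n * 4^-1 ^+ j &
    {ae mu, forall x, japmul t (fourier_hat (u j)) x = kW.1 x}].
  have Noo : (bessel_norm t p%:E (u j) < +oo)%E by exact: le_lt_trans (uj j) (ltey _).
  have [h uh hE] := bessel_normP Noo; have [mh _ _] := uh.
  have e0 : 0 < 4^-1 ^+ j :> R by rewrite exprn_gt0// invr_gt0.
  have e1 : 4^-1 ^+ j <= 1 :> R by rewrite exprn_ile1 ?invr_ge0// invf_le1// ler1n.
  have he : (cLnorm mu p%:E h <= (4^-1 ^+ j)%:E)%E by rewrite hE.
  have [k [W [hk lW nW kW]]] := Lp_transform p12 e0 e1 mh he.
  by exists (k, W); split=> //=; have [] := bessel_fourier_hat uh hk.
have [kW HkW] := choice H.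
have W0 : {ae mu, forall x, (fun j => (kW j).2 x) @ \oo --> (0 : R)}.
  have lW j : lint2 mu (kW j).2 by have [] := HkW j.
  have nW j : nrm2 mu (kW j).2 <= 320 * 4^-1 ^+ j by have [] := HkW j.
  exact: (ae_cvg0 (ler0n R 320) lW nW).
have aeE : {ae mu, forall x, forall j, japmul t (fourier_hat (u j)) x = (kW j).1 x}.
  by apply: ae_foralln => j; have [] := HkW j.
apply: filterS2 W0 aeE => x Wx Ex.
have E j : weight (u j) x = japanese x `^ (s - t) * normc ((kW j).1 x).
  rewrite -Ex normc_japmul mulrA -powRD ?(gt_eqF (japanese_gt0 x)) ?implybT// subrK//.
under eq_fun do rewrite E.
rewrite -(mulr0 (japanese x `^ (s - t))); apply: cvgMr.
have U : (fun j => (kW j).2 x + 4 * @fourier_cst R n * 4^-1 ^+ j) @ \oo --> (0 : R).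
  rewrite -[X in _ --> X]addr0 -[X in _ --> _ + X](mulr0 (4 * @fourier_cst R n)).
  apply: cvgD => //; apply: cvgMr; apply: cvg_expr.
  by rewrite ger0_norm ?invr_ge0// invf_lt1// ltr1n.
apply: (squeeze_cvgr _ (@cvg_cst _ (0 : R) nat _ _) U).
by apply: nearW => j; rewrite modulus_ge0; have [_ _ ->] := HkW j.
Qed.

End null_sequence.

(** * The quotient estimate *)

Section quotient_bound.
Context {R : realType} {n : nat} {s : R}.
Local Notation V := 'rV[R]_n.
Local Notation mu := (@lebesgue_rV R n).
Local Notation Hs := (sobolev R n s).
Implicit Types (x : V) (p t : R).
Variables (G : set (Hs -> Hs)) (f g : Hs).
Hypothesis sG : is_subgroup G.
Local Notation A := (common_supp f g).

Definition moduli_dist : \bar R := (\int[mu]_x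
  ((japanese x `^ s * (normc (fourier_hat f x) - normc (fourier_hat g x))) ^+ 2)%:E)%E.

Lemma moduli_dist_fin : moduli_dist \is a fin_num.
Proof.
have := lint2B (sobolev_hat f).2 (sobolev_hat g).2 => -[_ H].
have E : moduli_dist = (\int[mu]_x ((weight f x - weight g x) ^+ 2)%:E)%E.
  by apply: eq_integral => x _; rewrite /weight mulrBr.
by rewrite E lint_EFin.
Qed.

Lemma moduli_dist_ge0 : (0 <= moduli_dist)%E.
Proof. by apply: integral_ge0 => x _; rewrite lee_fin sqr_ge0. Qed.

Lemma quotient_dist_split P Q : G P -> G Q ->
  (quotient_dist G f g ^+ 2 <=
   moduli_dist + \int[mu]_x (\1_A x * weight (P f - Q g)%R x ^+ 2)%:E)%E.
Proof.
move=> GP GQ; have [GF _ _ _] := sG.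
apply: le_trans (quotient_dist_le f g sG GP GQ) _.
exact: sobolev_norm_sub_le (GF _ GP) (GF _ GQ).
Qed.

Lemma weight_group P u : G P -> {ae mu, forall x, weight (P u) x = weight u x}.
Proof.
move=> GP; have [GF _ _ _] := sG; have [_ _ /(_ u)] := GF _ GP.
by apply: filterS => x E; rewrite /weight E.
Qed.

Lemma weight_sub_le P Q : G P -> G Q -> {ae mu, forall x,
  weight (P f - Q g)%R x ^+ 2 <= 2 * (weight f x ^+ 2 + weight g x ^+ 2)}.
Proof.
move=> GP GQ; have := weight_group f GP; have := weight_group g GQ.
apply: filterS3 (fourier_hatB (P f) (Q g)) => x EB Eg Ef.
have : weight (P f - Q g) x <= weight f x + weight g x.
  rewrite -Ef -Eg /weight EB -mulrDr ler_wpM2l ?powR_ge0//.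
  by rewrite -[normc (fourier_hat (Q g) x)]normcN; exact: le_normcD.
have := mulr_ge0 (powR_ge0 (japanese x) s) (modulus_ge0 (fourier_hat (P f - Q g) x)).
rewrite -/(weight _ x); move: (weight _ x) (weight f x) (weight g x) => a b c.
by have := sqr_ge0 (b - c); nra.
Qed.

(** If the smallest Bessel norm is zero, the transforms of a minimising
    sequence tend to zero almost everywhere, and dominated convergence removes
    the term on the common support. *)
Lemma quotient_dist_null t p : 1 <= p <= 2 ->
  (forall e : R, 0 < e -> exists P Q, [/\ G P, G Q & (bessel_norm t p%:E (P f - Q g : Hs)%R <= e%:E)%E]) ->
  (quotient_dist G f g ^+ 2 <= moduli_dist)%E.
Proof.
move=> p12 H.
have H' j : exists PQ : (Hs -> Hs) * (Hs -> Hs), [/\ G PQ.1, G PQ.2 &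
    (bessel_norm t p%:E (PQ.1 f - PQ.2 g : Hs)%R <= (4^-1 ^+ j)%:E)%E].
  have e0 : 0 < 4^-1 ^+ j :> R by rewrite exprn_gt0// invr_gt0.
  by have [P [Q PQ]] := H _ e0; exists (P, Q).
have [PQ HPQ] := choice H'.
pose u j : Hs := (PQ j).1 f - (PQ j).2 g.
have u0 : {ae mu, forall x, (fun j => weight (u j) x) @ \oo --> (0 : R)}.
  have ub j : (bessel_norm t p%:E (u j) <= (4^-1 ^+ j)%:E)%E by have [] := HPQ j.
  exact: (fourier_hat_cvg0 p12 ub).
have mA := measurable_common_supp f g.
have [|||||_ _ C] := @dominated_convergence _ _ _ mu setT measurableT
   (fun j x => (\1_A x * weight (u j) x ^+ 2)%:E) (cst 0%E)
   (fun x => (2 * (weight f x ^+ 2 + weight g x ^+ 2))%:E).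
- by move=> j; exact: measurable_indic_weight.
- exact: measurable_cst.
- apply: filterS u0 => x ux _; apply: cvg_EFin; first exact: nearW.
  have L : (fun j => \1_A x * (weight (u j) x * weight (u j) x)) @ \oo --> (\1_A x * (0 * 0) : R).
    by apply: cvgM; [exact: cvg_cst|exact: cvgM].
  rewrite !mulr0 in L; apply: cvg_trans L; apply: near_eq_cvg.
  by apply: nearW => j /=; rewrite expr2.
- apply: (lintZ 2); apply: lintD; [exact: (sobolev_hat f).2.2|exact: (sobolev_hat g).2.2].
- apply: ae_foralln => j; have [GP GQ _] := HPQ j.
  apply: filterS (weight_sub_le GP GQ) => x Hx _.
  apply: (@le_trans _ _ (weight (u j) x ^+ 2)%:E); last by rewrite lee_fin.
  have i1 : (0 : R) <= \1_A x <= (1 : R) by rewrite indicE; case: (_ \in _); rewrite /= ?ler01 ?lexx.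
  have [i0 i1'] := andP i1.
  rewrite abse_EFin lee_fin ger0_norm; last by apply: mulr_ge0; [exact: i0|exact: sqr_ge0].
  by apply: ler_piMl; [exact: sqr_ge0|exact: i1'].
rewrite integral0 in C.
have C' : (fun j => moduli_dist + \int[mu]_x (\1_A x * weight (u j) x ^+ 2)%:E)%E @ \oo --> moduli_dist.
  rewrite -[X in _ --> X]adde0; apply: cvgeD => //; last exact: cvg_cst.
  exact: fin_num_adde_defr moduli_dist_fin.
rewrite -(cvg_lim _ C')//; apply: lime_ge; first by apply/cvg_ex; exists moduli_dist.
by apply: nearW => j; have [GP GQ _] := HPQ j; exact: quotient_dist_split.
Qed.

Lemma quotient_bound t p : 1 <= p <= 2 ->
  (quotient_dist G f g ^+ 2 <= moduli_dist + fourier_const n p *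
     Lnorm mu (hoelder_exponent p) (fun x => (\1_A x * japanese x `^ (2 * s - 2 * t))%:E) *
     ereal_inf [set y | exists P Q, [/\ G P, G Q &
       y = bessel_norm t p%:E (P f - Q g : Hs)%R ^+ 2]])%E.
Proof.
move=> p12; have /andP[p1 _] := p12; set K := Lnorm _ _ _; set B := ereal_inf _.
have c0 := @fourier_const_gt0 R n p p1; have K0 : (0 <= K)%E by exact: Lnorm_ge0.
have N0 (u : functional R n) : (0 <= bessel_norm t p%:E u)%E.
  by apply: le_ereal_inf_tmp => _ [h _ <-]; exact: Lnorm_ge0.
have B0 : (0 <= B)%E by apply: le_ereal_inf_tmp => _ [P [Q [_ _ ->]]]; exact: sqre_ge0.
have mA := measurable_common_supp f g.
(* If the weight is zero, the common support is negligible. *)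
have [Kz|Kn] := eqVneq K 0%E.
  rewrite Kz mule0 mul0e adde0; have [_ Gid _ _] := sG.
  apply: le_trans (quotient_dist_split Gid Gid) _.
  rewrite (_ : (\int[mu]_x _)%E = 0%E) ?adde0//.
  have mK : measurable_fun setT (fun x => (\1_A x * japanese x `^ (2 * s - 2 * t))%:E).
    by apply/measurable_EFinP; exact: measurable_indic_japanese.
  have H := Lnorm_eq0_eq0 mK (hoelder_exponent_gt0 p12) Kz.
  rewrite (ae_eq_integral (cst 0%E)) ?integral0//.
  - exact: measurable_indic_weight.
  - apply: filterS H => x /= /(_ I) [/eqP]; rewrite mulf_eq0 => /orP[/eqP ->|]; first by rewrite mul0r.
    by rewrite gt_eqF// powR_gt0// japanese_gt0.
have {Kn} Kp : (0 < K)%E by rewrite lt0e Kn.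
have [Bz|Bn] := eqVneq B 0%E.
  rewrite Bz mule0 adde0; apply: (quotient_dist_null (t := t) p12) => e e0.
  have : (B < (e ^+ 2)%:E)%E by rewrite Bz lte_fin exprn_gt0.
  move=> /ereal_inf_lt[_ [P [Q [GP GQ ->]]]] Hlt; exists P, Q; split=> //.
  rewrite -lee_sqr; [|exact: N0|by rewrite lee_fin ltW].
  by rewrite -sqre_EFin ltW.
have {Bn} Bp : (0 < B)%E by rewrite lt0e Bn.
(* The remaining factors are positive, so an infinite one makes the bound
   trivial. *)
have [cKoo|] := eqVneq (fourier_const n p * K)%E +oo%E.
  by rewrite cKoo gt0_mulye// addey ?leey// gt_eqF// (lt_le_trans _ moduli_dist_ge0).
have cK0 : (0 < fourier_const n p * K)%E by exact: mule_gt0.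
case cKE : (fourier_const n p * K)%E cK0 => [a||]// a0 _; rewrite lte_fin in a0.
have Dfin := moduli_dist_fin.
rewrite -leeBlDl//; rewrite muleC -lee_pdivrMr//.
apply: le_ereal_inf_tmp => _ [P [Q [GP GQ ->]]].
rewrite lee_pdivrMr// leeBlDl//.
have [Noo|] := eqVneq (bessel_norm t p%:E (P f - Q g : Hs)%R) +oo%E.
  have -> : (bessel_norm t p%:E (P f - Q g : Hs)%R ^+ 2 = +oo)%E by rewrite Noo expe2 mulyy.
  by rewrite gt0_mulye// addey ?leey// gt_eqF// (lt_le_trans _ moduli_dist_ge0).
move=> Nn; apply: le_trans (quotient_dist_split GP GQ) _.
rewrite leeD2l// muleC -cKE; apply: weight_le => //.
rewrite lt0e N0 andbT ltey Nn andbT; apply/eqP => Nz.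
have : (B <= 0)%E by apply: ereal_inf_lbound; exists P, Q; split=> //; rewrite Nz expe2 mule0.
by rewrite leNgt Bp.
Qed.

End quotient_bound.

Local Close Scope complex_scope.

Theorem theorem1p1 (R : realType) (n : nat) (t s p : R)
    (G : set (sobolev R n s -> sobolev R n s)) (f g : sobolev R n s) :
  (0 < n)%N -> 1 <= p <= 2 -> is_subgroup G ->
  let A := dsupp (dfourier f) `&` dsupp (dfourier g) in
  let K := Lnorm lebesgue_rV (hoelder_exponent p)
    (fun xi : 'rV[R]_n => (\1_A xi * japanese xi `^ (2 * s - 2 * t))%:E) in
  (quotient_dist G f g ^+ 2 <=
     Lnorm lebesgue_rV 2%:E (fun xi : 'rV[R]_n =>
       (japanese xi `^ s *
        (normc (fourier_hat f xi) - normc (fourier_hat g xi)))%:E) ^+ 2 +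
     fourier_const n p * K *
     ereal_inf [set y | exists P Q, [/\ G P, G Q &
       y = bessel_norm t p%:E (P f - Q g : sobolev R n s)%R ^+ 2]])%E /\
  (compact A \/
   (lebesgue_rV A < +oo)%E /\ s <= t \/
   s < t - n%:R * (p^-1 - 2^-1) -> (K < +oo)%E).
Proof.
move=> n0 p12 sG A K; have mA : measurable A by exact: measurable_common_supp.
split.
  have H := quotient_bound f g sG t p12.
  by rewrite Lnorm_sqr; exact: H.
move=> [cA|[[Aoo st]|st]].
- exact: weight_compact_lty.
- apply: (@weight_bounded_lty _ _ _ _ _ 1) => // x _.
  by apply: japanese_powR_le1; rewrite subr_le0 ler_pM2l.
- apply: weight_decay_lty => //; move: st; rewrite -mulrA; move: (n%:R * _) => a; lra.
Qed.
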